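(* For every $n\in\mathbb N$ there is a constant $k_n$, depending only on $n$, with the following property. Let $\rho>0$, let $g\in\mathcal C_{\rho,\mathbb Q}$ be such that $g_0=0$, and let $\omega\in\Omega_\gamma$ be a diophantine vector in $\mathbb R^n$ for some constant $\gamma>0$. Suppose there is a sequence $\mathcal S=(n_i)_{i\in\mathbb N}$ of natural numbers, cofinal for the divisibility order, such that $n_i\mid n_{i+1}$ for every natural number $i$ and $\|g\|_{\rho,\mathcal S,n}<\infty$. Then, for every $\delta$ with $0<\delta<\rho$, there is a solution $f\in\mathcal C_{\rho-\delta,\mathbb Q}$ of the diophantine equation $Df(\omega)=g$ such that $$\|f\|_{\rho-\delta}\le\frac{k_n}{\gamma\delta^{2n}}\,\|g\|_{\rho,\mathcal S,n}\qquad\text{and}\qquad \|Df\|_{\rho-\delta}\le\frac{k_n}{\gamma\delta^{2n+1}}\,\|g\|_{\rho,\mathcal S,n}.$$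
   Context: For a function $f$ (scalar or covector valued) on the strip $\{z\in\mathbb C^n:\|\mathrm{Im}(z)\|<\rho\}$ put $\|f\|_\rho=\sup_{\|\mathrm{Im}(z)\|<\rho}|f(z)|$; norms on $\mathbb R^n$, $\mathbb C^n$ are Euclidean. $Df(z)$ is the complex derivative of $f$ and $Df(\omega)$ is the function $z\mapsto Df(z)(\omega)=\sum_j\omega_j\,\partial f/\partial z_j(z)$; the equation $Df(\omega)=g$ is required on $\|\mathrm{Im}(z)\|<\rho-\delta$. $\mathcal C_{\rho,\mathbb Q}$ is the space of holomorphic functions $g$ on the strip $\|\mathrm{Im}(z)\|<\rho$ with $\|g\|_\rho<\infty$ that are limit periodic, i.e. for every $\varepsilon>0$ there is a natural number $N$ such that $|g(z+2\pi Nm)-g(z)|<\varepsilon$ for every $m\in\mathbb Z^n$ and every $z$ in the strip. Such a $g$ has a Pontryagin series $g(z)=\sum_{q\in\mathbb Q^n}g_q e^{iq\cdot z}$, with $g_q=\lim_{T\to\infty}(2T)^{-n}\int_{[-T,T]^n}g(x)e^{-iq\cdot x}\,dx$; in particular $g_0$ is the average of $g$. For a natural number $L$, $g_L$ is the $2\pi L$-periodic holomorphic function $g_L(z)=\sum_{q\in L^{-1}\mathbb Z^n}g_q e^{iq\cdot z}$. For $\gamma>0$, the set $\Omega_\gamma\subset\mathbb R^n$ of diophantine vectors consists of the $\omega$ with $|\omega\cdot k|>\gamma/|k|^n$ for every $k\in\mathbb Z^n\setminus\{0\}$. A sequence $\mathcal S=(n_i)_{i\ge1}$ is cofinal for divisibility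 if every natural number divides some $n_i$. For such a sequence with $n_i\mid n_{i+1}$, define $$\|g\|_{\rho,\mathcal S,n}=n_1^{2n+1}\|g_{n_1}\|_\rho+\sum_{i>1}n_i^{2n+1}\|g_{n_i}-g_{n_{i-1}}\|_\rho\in[0,\infty].$$ *)

(* Defs.v *)
From HB Require Import structures.
From mathcomp Require Import all_boot all_order all_algebra.
From mathcomp Require Import complex.
From mathcomp Require Import all_classical all_reals all_analysis.
From mathcomp Require showcase.summability.
Import Order.TTheory GRing.Theory Num.Theory.
Import numFieldNormedType.Exports.

Set Implicit Arguments.
Unset Strict Implicit.
Unset Printing Implicit Defensive.

Local Open Scope classical_set_scope.
Local Open Scope complex_scope.
Local Open Scope ring_scope.

(* R[i] packed as a numClosedFieldType: the library's topological and
   normed-module structures on fields, and on row vectors over them, are not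
   inferred for the bare type R[i]. *)
Definition Cx (R : realType) : numClosedFieldType := R[i].

Section Defs.
Context {R : realType}.
Local Notation C := (Cx R).

Definition cexp (z : C) : C :=
  (expR (complex.Re z))%:C * (cos (complex.Im z) +i* sin (complex.Im z)).

(* The ring norm `|z| on R[i] takes its values in R[i]; normc z is the same
   modulus as an element of R. *)
Definition cabs (z : C) : R := Normc.normc z.

(* The library norm on 'rV is the sup norm; these are the Euclidean ones. *)
Definition enorm n (x : 'rV[R]_n) : R := Num.sqrt (\sum_j x 0 j ^+ 2).
Definition cenorm n (z : 'rV[C]_n) : R := Num.sqrt (\sum_j cabs (z 0 j) ^+ 2).

Definition strip n (rho : R) : set 'rV[C]_n :=
  [set z | enorm (map_mx (@complex.Im R) z) < rho].

Definition snorm n (rho : R) (f : 'rV[C]_n -> C^o) : \bar R :=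
  ereal_sup [set (cabs (f z))%:E | z in @strip n rho].

Definition holomorphic_on n (U : set 'rV[C]_n) (f : 'rV[C]_n -> C^o) :=
  forall z, U z -> differentiable f z.

(* Df(z) as the row of its coordinates in the dual basis dz_1, ..., dz_n; its
   Euclidean norm, used in dsnorm, is also the operator norm of Df(z). *)
Definition covec n (f : 'rV[C]_n -> C^o) (z : 'rV[C]_n) : 'rV[C]_n :=
  \row_j 'd f z (delta_mx 0 j).

Definition dsnorm n (rho : R) (f : 'rV[C]_n -> C^o) : \bar R :=
  ereal_sup [set (cenorm (covec f z))%:E | z in @strip n rho].

Definition limit_periodic n (rho : R) (g : 'rV[C]_n -> C^o) :=
  forall eps : R, 0 < eps -> exists2 N : nat, (0 < N)%N &
    forall (m : 'rV[int]_n) (z : 'rV[C]_n), strip rho z ->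
      cabs (g (z + map_mx (fun a : int => (2 * pi * N%:R * a%:~R)%:C) m)
            - g z) < eps.

Definition CQ n (rho : R) (g : 'rV[C]_n -> C^o) :=
  [/\ holomorphic_on (@strip n rho) g,
      (snorm rho g < +oo)%E & limit_periodic rho g].

(* Integral over the cube [-T, T]^n as an iterated one-dimensional Lebesgue
   integral; it is only applied to continuous integrands. *)
Fixpoint cube_integral (T : R) n : ('rV[R]_n -> R) -> R :=
  match n with
  | 0%N => fun F => F 0
  | n'.+1 => fun F => \int[lebesgue_measure]_(t in [set` `[- T, T]])
      cube_integral T (fun x : 'rV[R]_n' => F (row_mx (t%:M : 'M[R]_1) x))
  end.

Definition ccube_integral (T : R) n (F : 'rV[R]_n -> C) : C :=
  cube_integral T (fun x => complex.Re (F x))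
  +i* cube_integral T (fun x => complex.Im (F x)).

Definition qdot n (q : 'rV[rat]_n) (z : 'rV[C]_n) : C :=
  \sum_j ratr (q 0 j) * z 0 j.

(* The Pontryagin coefficient g_q *)
Definition pcoef n (g : 'rV[C]_n -> C^o) (q : 'rV[rat]_n) : C^o :=
  lim ((((2 * T) ^- n)%:C *
        ccube_integral T (fun x : 'rV[R]_n =>
          g (map_mx (real_complex R) x) *
          cexp (- ((0 +i* 1) * qdot q (map_mx (real_complex R) x)))) : C^o)
       @[T --> +oo]).

(* g_L: unconditional sum of the Pontryagin series over q = k / L, k in Z^n,
   i.e. the limit along the finite subsets of Z^n *)
Definition periodic_part n (g : 'rV[C]_n -> C^o) (L : nat) (z : 'rV[C]_n)
    : C^o :=
  summability.sum (fun k : 'rV[int]_n =>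
    let q := map_mx (fun a : int => a%:~R / L%:R : rat) k in
    pcoef g q * cexp ((0 +i* 1) * qdot q z) : C^o).

Definition diophantine n (gamma : R) : set 'rV[R]_n :=
  [set omega | forall k : 'rV[int]_n, k != 0 ->
    `|\sum_j omega 0 j * (k 0 j)%:~R|
      > gamma / enorm (map_mx intr k) ^+ n].

Definition cofinal_div (s : nat -> nat) :=
  forall m, (0 < m)%N -> exists i, (m %| s i)%N.

(* s i stands for n_{i+1} *)
Definition snormS n (rho : R) (s : nat -> nat) (g : 'rV[C]_n -> C^o) : \bar R :=
  (((s 0%N)%:R ^+ n.*2.+1)%:E * snorm rho (periodic_part g (s 0%N)) +
   \sum_(0 <= i <oo)
     ((s i.+1)%:R ^+ n.*2.+1)%:E *
     snorm rho (fun z => (periodic_part g (s i.+1) z - periodic_part g (s i) z)%R))%E.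

End Defs.

(* Main.v *)
(* Each layer g_{n_i} - g_{n_{i-1}} is an absolutely convergent series of characters
   e^{iq.z} whose frequencies q lie in n_i^{-1} Z^n.  Moving the real slice inside the
   strip, towards -q, bounds its coefficients by ||g_{n_i} - g_{n_{i-1}}||_rho e^{-t|q|}
   for every t < rho, and the small divisor |omega.q| is at least gamma n_i^{-n-1} |q|^{-n}.
   Summing |k|^{n+p} e^{-delta|k|/(2 n_i)} over the nonzero k = n_i q in Z^n produces
   the factor n_i^{2n+1} / delta^{2n+p}, with p = 0 for f and p = 1 for Df, so the formal
   solution is one absolutely convergent series over Q^n.  It remains to see that g is the
   sum of its own Pontryagin series, which follows on real slices from uniqueness of the
   Fourier-Bohr coefficients of limit periodic functions (Fejer kernels).

   The mean of a limit periodic function is a limit of averages over finite grids adapted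
   to an almost period, which reduces all properties of means to finite sums. *)
Require Import Defs.
From HB Require Import structures.
From mathcomp Require Import all_boot all_order all_algebra.
From mathcomp Require Import complex.
From mathcomp Require Import all_classical all_reals all_analysis.
From mathcomp Require Import finmap ring lra zify.
From mathcomp Require showcase.summability.
Import Order.TTheory GRing.Theory Num.Theory.
Import numFieldNormedType.Exports.

Local Open Scope classical_set_scope.
Local Open Scope complex_scope.
Local Open Scope ring_scope.

Set Implicit Arguments.
Unset Strict Implicit.
Unset Printing Implicit Defensive.

(** * Integrals over cubes *)

Section SegmentIntegral.
Variable R : realType.
Implicit Types (f : R -> R) (a b B T s : R).

(** The solution is not assembled from solutions for the layers. Each frequency q is charged to a
    single layer, one whose coefficient at q is exactly g_q: this happens at a step of the sequence
    where q enters the lattice n_i^{-1} Z^n, and cofinality guarantees that such a step exists. The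
    radii rho, rho - delta/2 and rho - delta split the loss: the coefficients are estimated with
    decay rate rho - delta/2, and the remaining delta/2 pays for the small divisors and for the sum
    over the lattice.

    The finiteness of the norm controls only the coefficients g_q, and a priori g could differ from
    the series that they define; this is the obstacle that forces the uniqueness theorem.

    Once means are compared with grid averages, no integral is left. The contour shift is then
    carried out with Riemann sums, whose convergence is not uniform in the base point; since a mean
    is read off from finitely many grid points, pointwise convergence is enough. *)

Lemma continuous_integrable_segment f a b : continuous f ->
  lebesgue_measure.-integrable [set` `[a, b]] (EFin \o f).
Proof.
move=> cf; apply: continuous_compact_integrable; first exact: segment_compact.
by apply: continuous_subspaceT.
Qed.

Lemma Rintegral_segment_bound f B a b : a <= b -> continuous f ->
  (forall x, `|f x| <= B) ->
  `| \int[lebesgue_measure]_(t in [set` `[a, b]]) f t | <= (b - a) * B.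
Proof.
move=> ab cf Bf.
apply: le_trans (le_normr_Rintegral _ _) _ => //.
  exact: continuous_integrable_segment.
have -> : (b - a) * B = \int[lebesgue_measure]_(t in [set` `[a, b]]) B.
  rewrite Rintegral_cst//= lebesgue_measure_itv /= lte_fin mulrC.
  move: ab; rewrite le_eqVlt => /predU1P[->|->//].
  by rewrite ltxx /= subrr.
apply: le_Rintegral => //.
- apply: (@continuous_integrable_segment (fun x => `|f x|)) => x.
  by apply: cvg_norm; exact: cf.
- by apply: (@continuous_integrable_segment (fun=> B)) => x; exact: cvg_cst.
Qed.

Lemma Rintegral_segment_split f a b c : a <= b -> b <= c -> continuous f ->
  \int[lebesgue_measure]_(t in [set` `[a, c]]) f t =
  \int[lebesgue_measure]_(t in [set` `[a, b]]) f t +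
  \int[lebesgue_measure]_(t in [set` `[b, c]]) f t.
Proof.
move=> ab bc cf; have := @Rintegral_itvB R f (BLeft a) (BRight c) b.
rewrite Rintegral_itv_obnd_cbnd; last first.
  apply: integrableS (@continuous_integrable_segment f b c cf) => //.
  exact: subset_itv_oc_cc.
rewrite !bnd_simp => <- //; last exact: continuous_integrable_segment.
by rewrite addrC subrK.
Qed.

(** The segments [-T, T] and [-T + s, T + s] differ by two pieces of length |s|, or compare as such,
    and each piece contributes at most |s| B. For s < 0 the case of a positive shift is applied to
    the translate of [f] by [s]. *)
Lemma Rintegral_segment_shift f B T s :
  continuous f -> (forall x, `|f x| <= B) -> 0 <= T ->
  `| \int[lebesgue_measure]_(t in [set` `[- T, T]]) f (t + s) -
   \int[lebesgue_measure]_(t in [set` `[- T, T]]) f t | <= 2 * `|s| * B.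
Proof.
move=> cphi Bphi T0.
have wlog_case (psi : R -> R) (u : R) : continuous psi ->
  (forall x, `|psi x| <= B) -> 0 <= u ->
  `| \int[lebesgue_measure]_(t in [set` `[- T, T]]) psi (t + u) -
   \int[lebesgue_measure]_(t in [set` `[- T, T]]) psi t | <= 2 * u * B.
  move=> cpsi Bpsi u0.
  have -> : \int[lebesgue_measure]_(t in [set` `[- T, T]]) psi (t + u) =
     \int[lebesgue_measure]_(t in [set` `[- T + u, T + u]]) psi t.
    rewrite /Rintegral; congr fine.
    have drv (x : R) : is_derive x 1 (fun t : R => t + u) 1.
      by apply: is_derive_eq; rewrite addr0.
    have E : derive1 (fun t : R => t + u) = cst 1.
      by apply/funext => x; rewrite derive1E; case: (drv x).
    rewrite (@integration_by_substitution_increasing R (fun t => t + u) psi).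
    - by apply: eq_integral => x _ /=; rewrite E /= mulr1.
    - by lra.
    - by move=> x y _ _; rewrite ltrD2r.
    - by rewrite E => x _; exact: cvg_cst.
    - by rewrite E; exact: is_cvg_cst.
    - by rewrite E; exact: is_cvg_cst.
    - split.
      + by move=> x _; case: (drv x).
      + by apply: cvg_at_right_filter; apply: cvgD; [exact: cvg_id|exact: cvg_cst].
      + by apply: cvg_at_left_filter; apply: cvgD; [exact: cvg_id|exact: cvg_cst].
    - exact: continuous_subspaceT.
  have H1 := @Rintegral_segment_split psi (- T) T (T + u) ltac:(lra) ltac:(lra) cpsi.
  have H2 := @Rintegral_segment_split psi (- T) (- T + u) (T + u) ltac:(lra) ltac:(lra) cpsi.
  have B1 := @Rintegral_segment_bound psi B (- T) (- T + u) ltac:(lra) cpsi Bpsi.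
  have B2 := @Rintegral_segment_bound psi B T (T + u) ltac:(lra) cpsi Bpsi.
  move: B1 B2 H1 H2; rewrite !ler_norml.
  move: (\int[_]_(t in _) _) (\int[_]_(t in _) _) (\int[_]_(t in _) _)
    (\int[_]_(t in _) _) (\int[_]_(t in _) _) => a b c d e.
  nra.
case: (lerP 0 s) => s0.
  by rewrite (ger0_norm s0); exact: wlog_case.
rewrite distrC (ltr0_norm s0).
have := wlog_case (fun x => f (x + s)) (- s).
under eq_Rintegral do rewrite addrNK.
apply => //; last by lra.
move=> x; apply: (@continuous_comp _ _ _ (fun x => x + s) f); last exact: cphi.
by apply: cvgD; [exact: cvg_id|exact: cvg_cst].
Qed.

End SegmentIntegral.

Section CubeIntegral.
Variable R : realType.

(** Closeness is measured coordinate by coordinate with weak inequalities, so a slice inherits the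
    same [d] and the induction on the dimension loses nothing. *)
Definition unif_cont n (F : 'rV[R]_n -> R) := forall e : R, 0 < e ->
  exists2 d : R, 0 < d & forall x y : 'rV[R]_n, (forall j, `|x 0 j - y 0 j| <= d) ->
    `|F x - F y| <= e.

Definition slice n (F : 'rV[R]_n.+1 -> R) (t : R) (x : 'rV[R]_n) :=
  F (row_mx (t%:M : 'M[R]_1) x).

Lemma row_mx0E n (t : R) (x : 'rV[R]_n) (j : 'I_(1 + n)) :
  row_mx (t%:M : 'M[R]_1) x 0 j = match fintype.split j with inl _ => t | inr k => x 0 k end.
Proof.
rewrite mxE; case: splitP => k _ //.
by rewrite ord1 mxE eqxx.
Qed.

Lemma unif_cont_slice n (F : 'rV[R]_n.+1 -> R) t : unif_cont F -> unif_cont (slice F t).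
Proof.
move=> uF e e0; have [d d0 H] := uF e e0; exists d => // x y xy; apply: H => j.
rewrite !(row_mx0E _ _ j).
by case: fintype.split => k //; rewrite subrr normr0 ltW.
Qed.

Lemma unif_cont_lin n (F G : 'rV[R]_n -> R) a : unif_cont F -> unif_cont G ->
  unif_cont (fun x => a * F x + G x).
Proof.
move=> uF uG e e0.
have a1 : 0 < `|a| + 1 by rewrite ltr_wpDl.
have [d1 d10 H1] := uF (e / (2 * (`|a| + 1))) ltac:(by rewrite divr_gt0 // mulr_gt0).
have [d2 d20 H2] := uG (e / 2) ltac:(lra).
exists (Num.min d1 d2) => [|x y xy]; first by rewrite lt_min d10.
have {}H1 : `|F x - F y| <= e / (2 * (`|a| + 1)).
  by apply: H1 => j; have := xy j; rewrite le_min => /andP[].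
have {}H2 : `|G x - G y| <= e / 2.
  by apply: H2 => j; have := xy j; rewrite le_min => /andP[].
have -> : a * F x + G x - (a * F y + G y) = a * (F x - F y) + (G x - G y) by ring.
apply: le_trans (ler_normD _ _) _; rewrite normrM.
have : `|a| * `|F x - F y| <= e / 2.
  apply: le_trans (ler_wpM2l (normr_ge0 _) H1) _.
  rewrite mulrA ler_pdivrMr ?mulr_gt0 //.
  have -> : e / 2 * (2 * (`|a| + 1)) = e * (`|a| + 1) by field.
  by rewrite mulrC ler_pM2l // lerDl.
by move: H2; lra.
Qed.

Definition cube_integral_linear (T : R) n := forall (F G : 'rV[R]_n -> R) a,
  unif_cont F -> unif_cont G ->
  cube_integral T (fun x => a * F x + G x) = a * cube_integral T F + cube_integral T G.

Definition cube_integral_bounded (T : R) n := forall (F : 'rV[R]_n -> R) B,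
  unif_cont F -> (forall x, `|F x| <= B) -> `|cube_integral T F| <= (2 * T) ^+ n * B.

Lemma continuous_cube_integral_slice (T : R) n (F : 'rV[R]_n.+1 -> R) : 0 <= T ->
  cube_integral_linear T n -> cube_integral_bounded T n -> unif_cont F ->
  continuous (fun t => cube_integral T (slice F t)).
Proof.
move=> T0 IHl IHb uF t0; apply/cvgrPdist_le => e e0.
have c0 : 0 < (2 * T) ^+ n + 1 by rewrite ltr_wpDl // exprn_ge0 // mulr_ge0.
have [d d0 H] := uF (e / ((2 * T) ^+ n + 1)) (divr_gt0 e0 c0).
near=> t.
have -> : cube_integral T (slice F t0) - cube_integral T (slice F t) =
    cube_integral T (fun x => (-1) * slice F t x + slice F t0 x).
  rewrite IHl; [ring|exact: unif_cont_slice..].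
apply: le_trans (IHb _ (e / ((2 * T) ^+ n + 1)) _ _) _.
- by apply: unif_cont_lin; exact: unif_cont_slice.
- move=> x; rewrite mulN1r addrC; apply: H => j.
  rewrite !(row_mx0E _ _ j).
  case: fintype.split => k; last by rewrite subrr normr0 ltW.
  by near: t; exact: cvgr_dist_le.
- rewrite mulrCA ger_pMr // ler_pdivrMr // mul1r lerDl //.
Unshelve. all: by end_near. Qed.

(** Linearity and the bound go through the induction together: integrability of the outer integrand
    rests on its continuity in the slicing variable, which compares two slices by linearity and
    bounds their difference in the lower dimension. *)
Lemma cube_integral_lin_bound (T : R) n : 0 <= T ->
  cube_integral_linear T n /\ cube_integral_bounded T n.
Proof.
move=> T0; elim: n => [|n [IHl IHb]].
  by split=> [//|F B _ FB]; rewrite expr0 mul1r; exact: FB.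
have cont_slice (F : 'rV[R]_n.+1 -> R) (uF : unif_cont F) :=
  continuous_cube_integral_slice T0 IHl IHb uF.
split=> [F G a uF uG|F B uF FB] /=.
  rewrite -RintegralZl //; last first.
    exact: continuous_integrable_segment (cont_slice _ uF).
  rewrite -RintegralD //; last 2 first.
  - apply: continuous_integrable_segment => t.
    by apply: cvgM; [exact: cvg_cst|exact: (cont_slice _ uF)].
  - exact: continuous_integrable_segment (cont_slice _ uG).
  apply: eq_Rintegral => t _.
  by rewrite -IHl //; exact: unif_cont_slice.
rewrite exprS -mulrA.
have -> : 2 * T * ((2 * T) ^+ n * B) = (T - (- T)) * ((2 * T) ^+ n * B).
  by congr (_ * _); ring.
apply: Rintegral_segment_bound; first lra.
  exact: (cont_slice _ uF).
move=> t; apply: IHb; first exact: (@unif_cont_slice n F t uF).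
by move=> x; exact: FB.
Qed.

End CubeIntegral.

Section CubeIntegralShift.
Variable R : realType.

(** One coordinate is translated at a time, and each costs 2 S B (2T)^(n-1) = S B (2T)^n / T. The
    total is smaller than the volume by a factor of order 1/T, so averages become translation
    invariant in the limit. *)
Lemma cube_integral_shift n (F : 'rV[R]_n -> R) (s : 'rV[R]_n) (B S T : R) :
  unif_cont F -> (forall x, `|F x| <= B) -> 0 < T -> (forall j, `|s 0 j| <= S) ->
  `|cube_integral T (fun x => F (x + s)) - cube_integral T F| <=
    n%:R * S * B * (2 * T) ^+ n / T.
Proof.
elim: n F s B => [|n IH] F s B uF FB T0 sS.
  by rewrite /= (_ : 0 + s = 0) ?subrr ?normr0 ?mul0r //; apply/rowP => -[].
have T0' := ltW T0.
have S0 : 0 <= S by apply: le_trans (sS 0).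
have [IHl IHb] := @cube_integral_lin_bound R T n T0'.
have cS (G : 'rV[R]_n.+1 -> R) (uG : unif_cont G) :=
  continuous_cube_integral_slice T0' IHl IHb uG.
pose s0 := s 0 0; pose s' : 'rV[R]_n := \row_j s 0 (rshift 1 j).
have sE (t : R) (x : 'rV[R]_n) :
    (row_mx (t%:M : 'M[R]_1) x : 'rV[R]_n.+1) + s = row_mx ((t + s0)%:M : 'M[R]_1) (x + s').
  apply/rowP => j; rewrite mxE !(row_mx0E _ _ j).
  case: (@splitP 1 n j) => k jk; last first.
    by rewrite !mxE; congr (_ + s _ _); exact/val_inj.
  by congr (_ + s _ _); apply/val_inj; rewrite /= jk ord1.
pose c t := cube_integral T (slice F t).
pose cs t := cube_integral T (fun x => slice F t (x + s')).
have uF' (t : R) : unif_cont (slice F t) by exact: unif_cont_slice.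
have Fs : unif_cont (fun x => F (x + s)).
  move=> e e0; have [d d0 H] := uF e e0; exists d => // x y xy; apply: H => j.
  by rewrite !mxE (_ : _ - _ = x 0 j - y 0 j) //; ring.
have cc : continuous c by exact: cS.
have ccs : continuous (fun t => cs (t + s0)).
  have -> : (fun t => cs (t + s0)) = fun t => cube_integral T (slice (fun x => F (x + s)) t).
    by apply/funext => t; rewrite /cs /slice; congr (cube_integral T _); apply/funext => x; rewrite sE.
  exact: cS.
have ccs' : continuous (fun t => c (t + s0)).
  move=> t; apply: (@continuous_comp _ _ _ (fun x => x + s0) c); last exact: cc.
  by apply: cvgD; [exact: cvg_id|exact: cvg_cst].
have -> : cube_integral T (fun x => F (x + s)) =
    \int[lebesgue_measure]_(t in [set` `[- T, T]]) cs (t + s0).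
  rewrite /=; apply: eq_Rintegral => t _; rewrite /cs /slice.
  by congr (cube_integral T _); apply/funext => x; rewrite sE.
have -> : cube_integral T F = \int[lebesgue_measure]_(t in [set` `[- T, T]]) c t by [].
have cB t : `|c t| <= (2 * T) ^+ n * B.
  by apply: IHb => // x; exact: FB.
have B1 := Rintegral_segment_shift s0 cc cB T0'.
have B2 : `| \int[lebesgue_measure]_(t in [set` `[- T, T]]) (cs (t + s0) - c (t + s0))| <=
   (T - - T) * (n%:R * S * B * (2 * T) ^+ n / T).
  apply: Rintegral_segment_bound; first lra.
    by move=> t; apply: cvgB; [exact: ccs|exact: ccs'].
  move=> t; apply: (IH (slice F (t + s0))) => // [x|j]; first exact: FB.
  by rewrite mxE; exact: sS.
rewrite RintegralB // in B2; last 2 first.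
- exact: continuous_integrable_segment.
- exact: continuous_integrable_segment.
rewrite -(subrKA (\int[lebesgue_measure]_(t in [set` `[- T, T]]) c (t + s0))).
apply: le_trans (ler_normD _ _) _.
apply: le_trans (lerD B2 B1) _.
have -> : n.+1%:R * S * B * (2 * T) ^+ n.+1 / T =
  (T - - T) * (n%:R * S * B * (2 * T) ^+ n / T) + 2 * S * ((2 * T) ^+ n * B).
  by rewrite -natr1 exprS; field; apply/eqP => T00; move: T0; rewrite T00 ltxx.
rewrite lerD2l ler_wpM2r //; last by rewrite ler_wpM2l // sS.
by rewrite mulr_ge0 ?exprn_ge0 ?mulr_ge0 //; exact: le_trans (FB 0).
Qed.

End CubeIntegralShift.

(** * Averages over finite grids *)

Section GridAverage.
Variable R : realType.

Definition grid_point n (N M : nat) (a : {ffun 'I_n -> 'I_M}) : 'rV[R]_n :=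
  \row_j (2 * pi * N%:R * ((a j)%:R / M%:R)).

(** The scalar field is a parameter: real averages are compared with [cube_integral], complex ones
    with [mean]. *)
Definition grid_avg (K : numFieldType) n (F : 'rV[R]_n -> K) N M (x : 'rV[R]_n) : K :=
  (M%:R ^+ n)^-1 * \sum_(a : {ffun 'I_n -> 'I_M}) F (x + grid_point N a).

Definition lattice_point n (N : nat) (m : 'rV[int]_n) : 'rV[R]_n :=
  \row_j (2 * pi * N%:R * (m 0 j)%:~R).

Lemma grid_avg_le (K : numFieldType) n (F : 'rV[R]_n -> K) N M x (B : K) :
  (forall a, `|F (x + @grid_point n N M a)| <= B) -> (0 < M)%N -> `|grid_avg F N M x| <= B.
Proof.
move=> FB M0; rewrite /grid_avg normrM ger0_norm ?invr_ge0 ?exprn_ge0 //.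
rewrite mulrC ler_pdivrMr ?exprn_gt0 ?ltr0n //.
apply: le_trans (ler_norm_sum _ _ _) _.
apply: le_trans (ler_sum _ (fun a _ => FB a)) _.
by rewrite sumr_const card_ffun !card_ord -[B *+ _]mulr_natr natrX.
Qed.

Lemma grid_avgD (K : numFieldType) n (F G : 'rV[R]_n -> K) N M x c :
  grid_avg (fun x => c * F x + G x) N M x = c * grid_avg F N M x + grid_avg G N M x.
Proof. by rewrite /grid_avg big_split /= -mulr_sumr mulrDr; ring. Qed.

(** Rounding x down to a mesh point costs e by the modulus of continuity. Translation by a mesh
    point permutes the grid modulo 2 pi N, and the wrap-around is a lattice translation, which costs
    e by near periodicity. *)
Lemma grid_avg_near_const (K : numFieldType) n (F : 'rV[R]_n -> K) N M (e : K) :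
  (0 < N)%N -> (0 < M)%N ->
  (forall x m, `|F (x + lattice_point N m) - F x| <= e) ->
  (forall x y : 'rV[R]_n, (forall j, `|x 0 j - y 0 j| <= 2 * pi * N%:R / M%:R) -> `|F x - F y| <= e) ->
  forall x, `|grid_avg F N M x - grid_avg F N M 0| <= 2 * e.
Proof.
move=> N0 M0 Fper Fuc x.
pose w : R := 2 * pi * N%:R / M%:R.
have Mr : (M%:R : R) != 0 by rewrite pnatr_eq0 -lt0n.
have w0 : 0 < w by rewrite divr_gt0 ?mulr_gt0 ?ltr0n // pi_gt0.
pose m : 'rV[int]_n := \row_j Num.floor (x 0 j / w).
pose x0 : 'rV[R]_n := \row_j (w * (m 0 j)%:~R).
have ME : `|M%:R ^+ n| = M%:R ^+ n :> K by rewrite ger0_norm // exprn_ge0.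
have step1 : `|grid_avg F N M x - grid_avg F N M x0| <= e.
  have -> : grid_avg F N M x - grid_avg F N M x0 =
     grid_avg (fun y => (-1) * F (y + (x0 - x)) + F y) N M x.
    rewrite grid_avgD mulN1r [RHS]addrC; congr (_ - _).
    rewrite /grid_avg; congr (_ * _); apply: eq_bigr => a _; congr F.
    by apply/rowP => j; rewrite !mxE; ring.
  apply: grid_avg_le => // a; rewrite mulN1r addrC; apply: Fuc => j.
  rewrite !mxE -/w.
  have := floor_itv (x 0 j / w).
  move=> /andP[].
  rewrite ler_pdivlMr // ltr_pdivrMr // intrD => h1 h2.
  rewrite ler_norml; apply/andP; split; move: h1 h2; nra.
have step2 : `|grid_avg F N M x0 - grid_avg F N M 0| <= e.
  (* [sh r] translates the indices cyclically modulo M; the quotients by M reappear below as the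
     coordinates of the lattice translation. *)
  pose sh (r : 'I_n -> int) (a : {ffun 'I_n -> 'I_M}) : {ffun 'I_n -> 'I_M} :=
    [ffun j => Ordinal (ltn_pmod `|(((a j)%:Z + r j) %% M%:Z)%Z|%N M0)].
  have MZ : M%:Z != 0 by rewrite -lt0n.
  have shE r a j : (sh r a j : nat)%:Z = (((a j)%:Z + r j) %% M%:Z)%Z.
    rewrite ffunE /= modn_small; first by rewrite gez0_abs // modz_ge0.
    by rewrite -ltz_nat gez0_abs ?modz_ge0 // ltz_pmod.
  have shK r : cancel (sh r) (sh (fun j => - r j)).
    move=> a; apply/ffunP => j; apply/val_inj/eqP; rewrite -eqz_nat /=.
    rewrite !shE modzDml addrK.
    by rewrite modz_small //= ltz_nat ltn_ord.
  pose r j := m 0 j.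
  have bij : bijective (sh r).
    exists (sh (fun j => - r j)) => // a.
    by rewrite -{2}(shK (fun j => - r j) a); congr sh; apply/funext => j; rewrite opprK.
  rewrite /grid_avg -mulrBr normrM normfV ME mulrC ler_pdivrMr ?exprn_gt0 ?ltr0n //.
  rewrite [X in _ - X](reindex (sh r)) /=; last exact: onW_bij.
  rewrite -sumrB; apply: le_trans (ler_norm_sum _ _ _) _.
  apply: (@le_trans _ _ (\sum_(a : {ffun 'I_n -> 'I_M}) e)); last first.
    by rewrite sumr_const card_ffun !card_ord -[e *+ _]mulr_natr natrX.
  apply: ler_sum => a _.
  have -> : x0 + grid_point N a = (0 + grid_point N (sh r a)) +
     lattice_point N (\row_j (((a j)%:Z + r j) %/ M%:Z)%Z).
    apply/rowP => j; rewrite !mxE.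
    have -> : ((sh r a j)%:R : R) = (((a j)%:Z + r j) %% M%:Z)%Z%:~R.
      by rewrite -shE.
    have := divz_eq ((a j)%:Z + r j) M%:Z => /(congr1 (fun z : int => z%:~R : R)).
    rewrite rmorphD rmorphD rmorphM /= /r mxE => h.
    have -> : w * (Num.floor (x 0 j / w))%:~R + 2 * pi * N%:R * ((a j)%:R / M%:R) =
       2 * pi * N%:R / M%:R * ((a j)%:~R + (Num.floor (x 0 j / w))%:~R).
      by rewrite /w; ring.
    by rewrite h; field.
  exact: Fper.
rewrite mulr_natl mulr2n -(subrKA (grid_avg F N M x0)).
exact: le_trans (ler_normD _ _) (lerD step1 step2).
Qed.

End GridAverage.

Section CubeAverage.
Variable R : realType.

Lemma cube_integral_cst n (T c : R) : 0 <= T ->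
  cube_integral T (fun _ : 'rV[R]_n => c) = (2 * T) ^+ n * c.
Proof.
move=> T0; elim: n => [|n IH] /=; first by rewrite expr0 mul1r.
rewrite IH Rintegral_cst//= lebesgue_measure_itv /= lte_fin exprS.
case: ltP => [_|TT] /=; first by ring.
have -> : T = 0 by lra.
by rewrite !mulr0 !mul0r.
Qed.

Lemma unif_cont_cst n (c : R) : unif_cont (fun _ : 'rV[R]_n => c).
Proof. by move=> e e0; exists 1 => // x y _; rewrite subrr normr0 ltW. Qed.

Lemma unif_cont_shift n (f : 'rV[R]_n -> R) (s : 'rV[R]_n) :
  unif_cont f -> unif_cont (fun x => f (x + s)).
Proof.
move=> uf e e0; have [d d0 H] := uf e e0; exists d => // x y xy; apply: H => j.
by rewrite !mxE (_ : _ - _ = x 0 j - y 0 j) //; ring.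
Qed.

Lemma unif_contZ n (f : 'rV[R]_n -> R) a : unif_cont f -> unif_cont (fun x => a * f x).
Proof.
move=> uf; rewrite (_ : (fun x => _) = (fun x => a * f x + 0)).
  by apply: unif_cont_lin => //; exact: unif_cont_cst.
by apply/funext => x; rewrite addr0.
Qed.

Lemma unif_cont_sum n (I : Type) (r : seq I) (f : I -> 'rV[R]_n -> R) :
  (forall i, unif_cont (f i)) -> unif_cont (fun x => \sum_(i <- r) f i x).
Proof.
move=> uf; elim: r => [|i r IH].
  by under eq_fun do rewrite big_nil; exact: unif_cont_cst.
rewrite (_ : (fun x => _) = (fun x => 1 * f i x + \sum_(i <- r) f i x)).
  exact: unif_cont_lin.
by apply/funext => x; rewrite big_cons mul1r.
Qed.

Lemma cube_integral_sum n (T : R) (I : Type) (r : seq I) (f : I -> 'rV[R]_n -> R) :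
  0 <= T -> (forall i, unif_cont (f i)) ->
  cube_integral T (fun x => \sum_(i <- r) f i x) = \sum_(i <- r) cube_integral T (f i).
Proof.
move=> T0 uf; elim: r => [|i r IH].
  under eq_fun do rewrite big_nil.
  by rewrite big_nil cube_integral_cst // mulr0.
rewrite big_cons -IH -[cube_integral T (f i)]mul1r.
rewrite -(cube_integral_lin_bound n T0).1 //; last exact: unif_cont_sum.
by congr (cube_integral T _); apply/funext => x; rewrite big_cons mul1r.
Qed.

(** Both quantities are compared with the cube integral of the function [grid_avg f N M]. This
    function is nearly constant, and its integral is an average of integrals of translates of [f],
    each within O(1/T) of that of [f] after normalization. *)
Lemma cube_average_grid n (f : 'rV[R]_n -> R) (N M : nat) (B e T : R) :
  unif_cont f -> (forall x, `|f x| <= B) -> (0 < N)%N -> (0 < M)%N ->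
  (forall x m, `|f (x + lattice_point R N m) - f x| <= e) ->
  (forall x y : 'rV[R]_n, (forall j, `|x 0 j - y 0 j| <= 2 * pi * N%:R / M%:R) ->
     `|f x - f y| <= e) ->
  0 < T ->
  `|(2 * T) ^- n * cube_integral T f - grid_avg f N M 0| <=
    2 * e + n%:R * (2 * pi * N%:R) * B / T.
Proof.
move=> uf fB N0 M0 fper fuc T0; have T0' := ltW T0.
have [Il Ib] := cube_integral_lin_bound n T0'.
set S : R := 2 * pi * N%:R; set c := grid_avg f N M 0.
have Tn0 : 0 < (2 * T) ^+ n by rewrite exprn_gt0 // mulr_gt0.
have Mn0 : 0 < (M%:R : R) ^+ n by rewrite exprn_gt0 // ltr0n.
have S0 : 0 <= S by rewrite mulr_ge0 ?mulr_ge0 ?pi_ge0.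
have ug : unif_cont (grid_avg f N M).
  by apply: unif_contZ; apply: unif_cont_sum => a; exact: unif_cont_shift.
have step1 : `|cube_integral T (grid_avg f N M) - (2 * T) ^+ n * c| <= (2 * T) ^+ n * (2 * e).
  have -> : cube_integral T (grid_avg f N M) - (2 * T) ^+ n * c =
      cube_integral T (fun x => (-1) * (fun=> c) x + grid_avg f N M x).
    by rewrite Il //; [rewrite cube_integral_cst //; ring|exact: unif_cont_cst].
  apply: Ib => [|x].
    by apply: unif_cont_lin => //; exact: unif_cont_cst.
  by rewrite mulN1r addrC; exact: grid_avg_near_const.
have gE : cube_integral T (grid_avg f N M) =
    (M%:R ^+ n)^-1 * \sum_(a : {ffun 'I_n -> 'I_M})
       cube_integral T (fun x => f (x + grid_point R N a)).
  have us (a : {ffun 'I_n -> 'I_M}) := unif_cont_shift (grid_point R N a) uf.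
  rewrite -cube_integral_sum // -[RHS]addr0 -[X in _ + X](mulr0 ((2 * T) ^+ n)).
  rewrite -cube_integral_cst // -Il; [|exact: unif_cont_sum|exact: unif_cont_cst].
  by congr (cube_integral T _); apply/funext => x; rewrite addr0.
have step2 : `|cube_integral T (grid_avg f N M) - cube_integral T f| <=
    n%:R * S * B * (2 * T) ^+ n / T.
  have -> : cube_integral T (grid_avg f N M) - cube_integral T f =
      (M%:R ^+ n)^-1 * \sum_(a : {ffun 'I_n -> 'I_M})
       (cube_integral T (fun x => f (x + grid_point R N a)) - cube_integral T f).
    rewrite sumrB mulrBr -gE; congr (_ - _).
    rewrite sumr_const card_ffun !card_ord -[cube_integral T f *+ _]mulr_natr natrX.
    by field; rewrite lt0r_neq0 // ltr0n.
  rewrite normrM ger0_norm ?invr_ge0 ?(ltW Mn0) // mulrC ler_pdivrMr //.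
  apply: le_trans (ler_norm_sum _ _ _) _.
  apply: (@le_trans _ _ (\sum_(a : {ffun 'I_n -> 'I_M}) (n%:R * S * B * (2 * T) ^+ n / T))).
    apply: ler_sum => a _; apply: cube_integral_shift => // j.
    rewrite mxE normrM ger0_norm // ger0_norm ?mulr_ge0 ?invr_ge0 //.
    by rewrite ler_piMr // ler_pdivrMr ?ltr0n // mul1r ler_nat ltnW.
  by rewrite sumr_const card_ffun !card_ord -[leLHS]mulr_natr natrX.
have -> : (2 * T) ^- n * cube_integral T f - c =
    (2 * T) ^- n * ((cube_integral T (grid_avg f N M) - (2 * T) ^+ n * c) -
      (cube_integral T (grid_avg f N M) - cube_integral T f)).
  by field; rewrite lt0r_neq0.
rewrite normrM ger0_norm ?invr_ge0 ?(ltW Tn0) // mulrC ler_pdivrMr //.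
apply: le_trans (ler_normB _ _) _.
apply: le_trans (lerD step1 step2) _.
by rewrite le_eqVlt; apply/orP; left; apply/eqP; field; rewrite lt0r_neq0.
Qed.

End CubeAverage.

(** * Complex modulus and exponential *)

Section ComplexModulus.
Variable R : realType.
Local Notation C := (Cx R).
Implicit Types (z w : C) (x y : R).

Lemma cabsE z : `|z| = (cabs z)%:C.
Proof. by case: z. Qed.

Lemma cabs_ge0 z : 0 <= cabs z.
Proof. by case: z => a b; exact: sqrtr_ge0. Qed.

Lemma cabs0 : cabs (0 : C) = 0. Proof. exact: Normc.normc0. Qed.
Lemma cabs1 : cabs (1 : C) = 1. Proof. exact: Normc.normc1. Qed.
Lemma cabsM z w : cabs (z * w) = cabs z * cabs w. Proof. exact: Normc.normcM. Qed.
Lemma cabsV z : cabs z^-1 = (cabs z)^-1. Proof. exact: Normc.normcV. Qed.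
Lemma cabsN z : cabs (- z) = cabs z. Proof. exact: normcN. Qed.
Lemma cabsD z w : cabs (z + w) <= cabs z + cabs w. Proof. exact: le_normcD. Qed.
Lemma cabs_eq0 z : cabs z = 0 -> z = 0. Proof. exact: Normc.eq0_normc. Qed.

Lemma cabsC z w : cabs (z - w) = cabs (w - z).
Proof. by rewrite -cabsN opprB. Qed.

Lemma cabsB z w : cabs (z - w) <= cabs z + cabs w.
Proof. by rewrite -(cabsN w) cabsD. Qed.

Lemma cabs_distD u z w : cabs (z - w) <= cabs (z - u) + cabs (u - w).
Proof. by rewrite -(subrKA u) cabsD. Qed.

Lemma cabs_real x : cabs (x%:C : C) = `|x|.
Proof. by rewrite /cabs /= expr0n addr0 sqrtr_sqr. Qed.

Lemma cabs_i : cabs ((0 +i* 1) : C) = 1.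
Proof. by rewrite /cabs /= expr0n add0r expr1n sqrtr1. Qed.

Lemma cabs_nat (m : nat) : cabs (m%:R : C) = m%:R.
Proof. by rewrite -(rmorph_nat (real_complex R)) cabs_real normr_nat. Qed.

Lemma cabs_sum (I : Type) (r : seq I) (P : pred I) (F : I -> C) :
  cabs (\sum_(i <- r | P i) F i) <= \sum_(i <- r | P i) cabs (F i).
Proof.
apply: (big_ind2 (fun z x => cabs z <= x)) => [|z x w y zx wy|//]; first by rewrite cabs0.
exact: le_trans (cabsD _ _) (lerD zx wy).
Qed.

Lemma abs_Re z : `|complex.Re z| <= cabs z.
Proof. by case: z => a b /=; rewrite -sqrtr_sqr ler_wsqrtr // lerDl sqr_ge0. Qed.

Lemma abs_Im z : `|complex.Im z| <= cabs z.
Proof. by case: z => a b /=; rewrite -sqrtr_sqr ler_wsqrtr // lerDr sqr_ge0. Qed.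

Lemma cabs_le z : cabs z <= `|complex.Re z| + `|complex.Im z|.
Proof.
case: z => a b /=.
rewrite -[leRHS]ger0_norm ?addr_ge0 // -sqrtr_sqr ler_wsqrtr //.
rewrite sqrrD !real_normK ?num_real //.
by rewrite addrAC lerDl mulrn_wge0 // mulr_ge0.
Qed.

Lemma cabs_sqr z : cabs z ^+ 2 = complex.Re z ^+ 2 + complex.Im z ^+ 2.
Proof. by case: z => a b /=; rewrite sqr_sqrtr // addr_ge0 ?sqr_ge0. Qed.

Lemma ReD z w : complex.Re (z + w) = complex.Re z + complex.Re w.
Proof. by case: z w => [a b] [c d]. Qed.
Lemma ImD z w : complex.Im (z + w) = complex.Im z + complex.Im w.
Proof. by case: z w => [a b] [c d]. Qed.
Lemma ReN z : complex.Re (- z) = - complex.Re z. Proof. by case: z. Qed.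
Lemma ImN z : complex.Im (- z) = - complex.Im z. Proof. by case: z. Qed.
Lemma ReM_real x z : complex.Re (x%:C * z : C) = x * complex.Re z.
Proof. by case: z => a b /=; rewrite mul0r subr0. Qed.
Lemma ImM_real x z : complex.Im (x%:C * z : C) = x * complex.Im z.
Proof. by case: z => a b /=; rewrite mul0r addr0. Qed.

Lemma complexP z w : complex.Re z = complex.Re w -> complex.Im z = complex.Im w -> z = w.
Proof. by case: z w => [a b] [c d] /= -> ->. Qed.

Lemma lecabs z (e : R) : (`|z| <= e%:C) = (cabs z <= e).
Proof. by rewrite cabsE lecR. Qed.

Lemma cplx_pos (e : C) : 0 < e -> exists2 d : R, 0 < d & e = d%:C.
Proof.
case: e => a b; rewrite ltcE /= => /andP[/eqP b0 a0]; by exists a => //; rewrite b0.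
Qed.

Lemma cvgC_cabs (T : Type) (F : set_system T) {FF : Filter F} (f : T -> C^o) (l : C^o) :
  (forall e : R, 0 < e -> \forall x \near F, cabs (f x - l) <= e) <-> f @ F --> l.
Proof.
split => [H|H e e0].
  apply/cvgrPdist_le => e /cplx_pos[d d0 ->].
  by apply: filterS (H d d0) => x; rewrite cabsC -lecabs.
have e0' : (0 : C) < e%:C by rewrite ltcR.
move/cvgrPdist_le : H => /(_ _ e0').
by apply: filterS => x; rewrite cabsC -lecabs.
Qed.

End ComplexModulus.

Section ComplexExponential.
Variable R : realType.
Local Notation C := (Cx R).
Implicit Types (z w : C) (x y : R).

Lemma cexpD z w : cexp (z + w) = cexp z * cexp w.
Proof.
rewrite /cexp ReD ImD expRD sinD cosD.
by apply: complexP => /=; ring.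
Qed.

Lemma cexp0 : cexp (0 : C) = 1.
Proof. by rewrite /cexp /= expR0 cos0 sin0; apply: complexP => /=; ring. Qed.

Lemma cabs_cexp z : cabs (cexp z) = expR (complex.Re z).
Proof.
rewrite /cexp cabsM cabs_real ger0_norm ?expR_ge0 //.
by rewrite /cabs /= cos2Dsin2 sqrtr1 mulr1.
Qed.

Lemma norm_sin_le x : `|sin x| <= `|x|.
Proof.
have H y : 0 <= y -> `|sin y| <= y.
  rewrite le_eqVlt => /predU1P[<-|y0]; first by rewrite sin0 normr0.
  have csin : {within `[0, y], continuous (@sin R)}.
    by apply: continuous_subspaceT => u; exact: continuous_sin.
  have [c _] := MVT y0 (fun u _ => is_derive_sin u) csin.
  rewrite sin0 !subr0 => ->; rewrite normrM (gtr0_norm y0).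
  by rewrite ger_pMl // ler_norml cos_geN1 cos_le1.
have [x0|x0] := lerP 0 x; first by rewrite (ger0_norm x0) H.
by have := H (- x) ltac:(lra); rewrite sinN normrN (ltr0_norm x0).
Qed.

(** The chord from 1 to e^(iy) has length 2 |sin (y/2)|. *)
Lemma cabs_cis_sub1 y : cabs ((cos y +i* sin y : C) - 1) <= `|y|.
Proof.
have E : cabs ((cos y +i* sin y : C) - 1) ^+ 2 = (2 * sin (y / 2)) ^+ 2.
  rewrite cabs_sqr /= oppr0 addr0.
  have := cos2Dsin2 y.
  have -> : cos y = 1 - 2 * sin (y / 2) ^+ 2.
    have yE : (y / 2) *+ 2 = y by rewrite mulr2n -splitr.
    rewrite -{1}yE cos_mulr2n mulr2n; have := cos2Dsin2 (y / 2); lra.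
  nra.
have h := norm_sin_le (y / 2).
rewrite -ler_sqr ?nnegrE ?cabs_ge0 // E -[leLHS]real_normK ?num_real //.
rewrite ler_sqr ?nnegrE // normrM ger0_norm //.
by move: h; rewrite normrM [ `|2^-1|]ger0_norm //; lra.
Qed.

Lemma expR_sub1_le x : `|expR x - 1| <= `|x| * Num.max 1 (expR x).
Proof.
have h1 := expR_ge1Dx x; have h2 := expR_ge1Dx (- x).
have p := expR_gt0 x.
have h3 : expR x * expR (- x) = 1 by rewrite -expRD subrr expR0.
case: (lerP 0 x) => x0.
  have e1 : 1 <= expR x by lra.
  rewrite (max_idPr e1) !ger0_norm ?subr_ge0 //; nra.
have e1 : expR x <= 1.
  by rewrite -expR0 ler_expR ltW.
rewrite (max_idPl e1) ler0_norm ?subr_le0 // ler0_norm ?(ltW x0) // mulr1; lra.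
Qed.

(** The maximum covers both signs of Re w. For w = i q.h, multiplying it by the modulus of e^(iq.z)
    gives the larger of the moduli of the character at z and at z + h, a quantity that the strip
    controls. *)
Lemma cabs_cexp_sub1 w : cabs (cexp w - 1) <= 2 * cabs w * Num.max 1 (expR (complex.Re w)).
Proof.
set m := Num.max _ _.
have m1 : 1 <= m by rewrite le_max lexx.
have mx : expR (complex.Re w) <= m by rewrite le_max lexx orbT.
have -> : cexp w - 1 = (expR (complex.Re w))%:C *
   ((cos (complex.Im w) +i* sin (complex.Im w) : C) - 1) + (expR (complex.Re w) - 1)%:C.
  by rewrite /cexp; apply: complexP => /=; ring.
apply: le_trans (cabsD _ _) _; rewrite cabsM !cabs_real ger0_norm ?expR_ge0 //.
have h1 := cabs_cis_sub1 (complex.Im w).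
have h2 := expR_sub1_le (complex.Re w).
have h3 := abs_Re w; have h4 := abs_Im w.
have h5 := expR_ge0 (complex.Re w).
have -> : 2 * cabs w * m = cabs w * m + cabs w * m by ring.
apply: lerD.
  rewrite mulrC; apply: ler_pM => //; [exact: cabs_ge0|exact: le_trans h1 h4].
by apply: le_trans h2 _; apply: ler_pM.
Qed.

End ComplexExponential.

(** * Limit periodic functions and their means *)

Section AlmostPeriodic.
Variable R : realType.
Local Notation C := (Cx R).

Definition cunif_cont n (F : 'rV[R]_n -> C) := forall e : R, 0 < e ->
  exists2 d : R, 0 < d & forall x y : 'rV[R]_n, (forall j, `|x 0 j - y 0 j| <= d) ->
    cabs (F x - F y) <= e.

(** The almost periods form whole lattices 2 pi N Z^n, and multiples of a good N are equally good.
    Two functions therefore share the almost period given by a product, which makes sums and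
    products elementary. *)
Definition near_periodic n (F : 'rV[R]_n -> C) := forall e : R, 0 < e ->
  exists2 N, (0 < N)%N & forall m x, cabs (F (x + lattice_point R N m) - F x) <= e.

Definition apf n (F : 'rV[R]_n -> C) :=
  [/\ exists B, forall x, cabs (F x) <= B, cunif_cont F & near_periodic F].

Lemma lattice_pointM n N k (m : 'rV[int]_n) :
  lattice_point R (N * k) m = lattice_point R N (\row_j (k%:Z * m 0 j)).
Proof. by apply/rowP => j; rewrite !mxE natrM rmorphM /=; ring. Qed.

Lemma near_periodic_dvd n (F : 'rV[R]_n -> C) (e : R) N N' :
  (forall m x, cabs (F (x + lattice_point R N m) - F x) <= e) -> (N %| N')%N ->
  forall m x, cabs (F (x + lattice_point R N' m) - F x) <= e.
Proof. by move=> FN /dvdnP[k ->] m x; rewrite mulnC lattice_pointM. Qed.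

Lemma apf_cst n (c : C) : apf (fun _ : 'rV[R]_n => c).
Proof.
split; first by exists (cabs c).
  by move=> e e0; exists 1 => // x y _; rewrite subrr cabs0 ltW.
by move=> e e0; exists 1%N => // m x; rewrite subrr cabs0 ltW.
Qed.

Lemma bounded_pos n (F : 'rV[R]_n -> C) : (exists B, forall x, cabs (F x) <= B) ->
  exists2 B, 0 < B & forall x, cabs (F x) <= B.
Proof.
move=> [B FB]; exists (`|B| + 1) => [|x]; first by rewrite ltr_wpDl.
by apply: le_trans (FB x) _; apply: le_trans (ler_norm B) _; rewrite lerDl.
Qed.

Lemma apfM n (F G : 'rV[R]_n -> C) : apf F -> apf G -> apf (fun x => F x * G x).
Proof.
move=> [/bounded_pos[A A0 FA] uF pF] [/bounded_pos[B B0 GB] uG pG].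
have key (e : R) x y : cabs (F x - F y) <= e / (2 * B) ->
    cabs (G x - G y) <= e / (2 * A) -> cabs (F x * G x - F y * G y) <= e.
  move=> h1 h2.
  have -> : F x * G x - F y * G y = (F x - F y) * G x + F y * (G x - G y) by ring.
  apply: le_trans (cabsD _ _) _; rewrite !cabsM.
  have -> : e = e / (2 * B) * B + A * (e / (2 * A)).
    by field; rewrite !lt0r_neq0.
  by apply: lerD; apply: ler_pM => //; exact: cabs_ge0.
have pos (e D : R) : 0 < e -> 0 < D -> 0 < e / (2 * D).
  by move=> e0 D0; rewrite divr_gt0 // mulr_gt0.
split.
- exists (A * B) => x; rewrite cabsM.
  by apply: ler_pM => //; exact: cabs_ge0.
- move=> e e0.
  have [d1 d10 H1] := uF _ (pos _ _ e0 B0); have [d2 d20 H2] := uG _ (pos _ _ e0 A0).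
  exists (Num.min d1 d2) => [|x y xy]; first by rewrite lt_min d10.
  by apply: key; [apply: H1|apply: H2] => j; have := xy j; rewrite le_min => /andP[].
- move=> e e0.
  have [N1 N10 H1] := pF _ (pos _ _ e0 B0); have [N2 N20 H2] := pG _ (pos _ _ e0 A0).
  exists (N1 * N2)%N => [|m x]; first by rewrite muln_gt0 N10.
  apply: key; first exact: (near_periodic_dvd H1 (dvdn_mulr _ (dvdnn _))).
  exact: (near_periodic_dvd H2 (dvdn_mull _ (dvdnn _))).
Qed.

Lemma apfD n (F G : 'rV[R]_n -> C) : apf F -> apf G -> apf (fun x => F x + G x).
Proof.
move=> [[A FA] uF pF] [[B GB] uG pG].
have key (e : R) x y : cabs (F x - F y) <= e / 2 ->
    cabs (G x - G y) <= e / 2 -> cabs (F x + G x - (F y + G y)) <= e.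
  move=> h1 h2; rewrite opprD addrACA; apply: le_trans (cabsD _ _) _; lra.
split.
- exists (A + B) => x; exact: le_trans (cabsD _ _) (lerD (FA x) (GB x)).
- move=> e e0.
  have [d1 d10 H1] := uF (e / 2) ltac:(lra); have [d2 d20 H2] := uG (e / 2) ltac:(lra).
  exists (Num.min d1 d2) => [|x y xy]; first by rewrite lt_min d10.
  by apply: key; [apply: H1|apply: H2] => j; have := xy j; rewrite le_min => /andP[].
- move=> e e0.
  have [N1 N10 H1] := pF (e / 2) ltac:(lra); have [N2 N20 H2] := pG (e / 2) ltac:(lra).
  exists (N1 * N2)%N => [|m x]; first by rewrite muln_gt0 N10.
  apply: key; first exact: (near_periodic_dvd H1 (dvdn_mulr _ (dvdnn _))).
  exact: (near_periodic_dvd H2 (dvdn_mull _ (dvdnn _))).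
Qed.

Lemma apfZ n (c : C) (F : 'rV[R]_n -> C) : apf F -> apf (fun x => c * F x).
Proof. by move=> aF; apply: apfM => //; exact: apf_cst. Qed.

Lemma apfB n (F G : 'rV[R]_n -> C) : apf F -> apf G -> apf (fun x => F x - G x).
Proof.
move=> aF aG; rewrite (_ : (fun x => _) = (fun x => F x + (-1) * G x)).
  by apply: apfD => //; exact: apfZ.
by apply/funext => x; rewrite mulN1r.
Qed.

Lemma apf_sum n (I : Type) (r : seq I) (F : I -> 'rV[R]_n -> C) :
  (forall i, apf (F i)) -> apf (fun x => \sum_(i <- r) F i x).
Proof.
move=> aF; elim: r => [|i r IH].
  by under eq_fun do rewrite big_nil; exact: apf_cst.
by under eq_fun do rewrite big_cons; exact: apfD.
Qed.

Lemma apf_shift n (F : 'rV[R]_n -> C) s : apf F -> apf (fun x => F (x + s)).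
Proof.
move=> [[B FB] uF pF]; split; first by exists B.
  move=> e e0; have [d d0 H] := uF e e0; exists d => // x y xy; apply: H => j.
  by rewrite !mxE (_ : _ - _ = x 0 j - y 0 j) //; ring.
move=> e e0; have [N N0 H] := pF e e0; exists N => // m x.
by rewrite addrAC.
Qed.

Lemma apf_uniform_limit n (F : 'rV[R]_n -> C) :
  (forall e : R, 0 < e -> exists2 G, apf G & forall x, cabs (F x - G x) <= e) -> apf F.
Proof.
move=> FG.
have key (e : R) (G : 'rV[R]_n -> C) x y : (forall x, cabs (F x - G x) <= e / 3) ->
    cabs (G x - G y) <= e / 3 -> cabs (F x - F y) <= e.
  move=> h1 h2; have := h1 x; have := h1 y; rewrite cabsC.
  have := cabs_distD (G x) (F x) (F y); have := cabs_distD (G y) (G x) (F y); lra.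
split.
- have [G [[B GB] _ _] H] := FG 1 ltr01.
  exists (1 + B) => x; rewrite -(subrK (G x) (F x)).
  exact: le_trans (cabsD _ _) (lerD (H x) (GB x)).
- move=> e e0; have [G [_ uG _] H] := FG (e / 3) ltac:(lra).
  have [d d0 Hd] := uG (e / 3) ltac:(lra).
  by exists d => // x y xy; apply: key H _; exact: Hd.
- move=> e e0; have [G [_ _ pG] H] := FG (e / 3) ltac:(lra).
  have [N N0 HN] := pG (e / 3) ltac:(lra).
  by exists N => // m x; apply: key H _; exact: HN.
Qed.

Definition fine_grid n (F : 'rV[R]_n -> C) (e : R) (N M : nat) :=
  [/\ (0 < N)%N, (0 < M)%N,
      (forall x m, cabs (F (x + lattice_point R N m) - F x) <= e) &
      (forall x y : 'rV[R]_n, (forall j, `|x 0 j - y 0 j| <= 2 * pi * N%:R / M%:R) ->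
         cabs (F x - F y) <= e)].

(** The period may be any multiple of [N1], and the mesh is refined after the period is fixed; this
    lets two functions share a grid. *)
Lemma fine_grid_exists n (F : 'rV[R]_n -> C) (e : R) : apf F -> 0 < e ->
  exists2 N1, (0 < N1)%N & forall N, (N1 %| N)%N -> (0 < N)%N ->
    exists M1, forall M, (M1 <= M)%N -> fine_grid F e N M.
Proof.
move=> [_ uF pF] e0.
have [N1 N10 H1] := pF e e0; have [d d0 H2] := uF e e0.
exists N1 => // N N1N N0.
pose t : R := 2 * pi * N%:R / d.
exists (Num.truncn t).+1 => M MM.
have M0 : (0 < M)%N by apply: leq_trans MM.
split => // [x m|x y xy]; first exact: near_periodic_dvd.
apply: H2 => j; apply: le_trans (xy j) _.
rewrite ler_pdivrMr ?ltr0n // -ler_pdivrMl // mulrC ltW //.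
apply: lt_le_trans (truncnS_gt t) _.
by rewrite ler_nat.
Qed.

Definition cavg (T : R) n (F : 'rV[R]_n -> C) : C :=
  ((2 * T) ^- n)%:C * ccube_integral T F.

Lemma unif_cont_Re n (F : 'rV[R]_n -> C) : cunif_cont F -> unif_cont (fun x => complex.Re (F x)).
Proof.
move=> uF e e0; have [d d0 H] := uF e e0; exists d => // x y xy.
by apply: le_trans (H x y xy); rewrite -ReN -ReD abs_Re.
Qed.

Lemma unif_cont_Im n (F : 'rV[R]_n -> C) : cunif_cont F -> unif_cont (fun x => complex.Im (F x)).
Proof.
move=> uF e e0; have [d d0 H] := uF e e0; exists d => // x y xy.
by apply: le_trans (H x y xy); rewrite -ImN -ImD abs_Im.
Qed.

Lemma grid_avg_Re n (F : 'rV[R]_n -> C) N M x :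
  complex.Re (grid_avg F N M x) = grid_avg (fun x => complex.Re (F x)) N M x.
Proof.
rewrite /grid_avg.
have -> : (M%:R ^+ n)^-1 = ((M%:R ^+ n)^-1)%:C :> C by rewrite fmorphV rmorphXn /= rmorph_nat.
rewrite ReM_real; congr (_ * _).
by apply: (big_morph (@complex.Re R)) => // z w; exact: ReD.
Qed.

Lemma grid_avg_Im n (F : 'rV[R]_n -> C) N M x :
  complex.Im (grid_avg F N M x) = grid_avg (fun x => complex.Im (F x)) N M x.
Proof.
rewrite /grid_avg.
have -> : (M%:R ^+ n)^-1 = ((M%:R ^+ n)^-1)%:C :> C by rewrite fmorphV rmorphXn /= rmorph_nat.
rewrite ImM_real; congr (_ * _).
by apply: (big_morph (@complex.Im R)) => // z w; exact: ImD.
Qed.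

(** Real and imaginary parts are treated separately, which doubles both error terms of
    [cube_average_grid]. For large T the second one drops to 2 e, hence the 6 e of
    [cavg_grid_eventually] and, after passing to the limit, the 7 e of [mean_grid]. *)
Lemma cavg_grid n (F : 'rV[R]_n -> C) N M (B e T : R) :
  cunif_cont F -> (forall x, cabs (F x) <= B) -> fine_grid F e N M -> 0 < T ->
  cabs (cavg T F - grid_avg F N M 0) <= 4 * e + 2 * (n%:R * (2 * pi * N%:R) * B / T).
Proof.
move=> uF FB [N0 M0 per mesh] T0.
apply: le_trans (cabs_le _) _.
rewrite ReD ImD ReN ImN grid_avg_Re grid_avg_Im /cavg ReM_real ImM_real /=.
have -> (u : R) : 4 * e + 2 * u = (2 * e + u) + (2 * e + u) by ring.
apply: lerD; apply: cube_average_grid => //.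
- exact: unif_cont_Re.
- by move=> x; apply: le_trans (FB x); exact: abs_Re.
- by move=> x m; apply: le_trans (per x m); rewrite -ReN -ReD abs_Re.
- by move=> x y xy; apply: le_trans (mesh x y xy); rewrite -ReN -ReD abs_Re.
- exact: unif_cont_Im.
- by move=> x; apply: le_trans (FB x); exact: abs_Im.
- by move=> x m; apply: le_trans (per x m); rewrite -ImN -ImD abs_Im.
- by move=> x y xy; apply: le_trans (mesh x y xy); rewrite -ImN -ImD abs_Im.
Qed.

End AlmostPeriodic.

Section Mean.
Variable R : realType.
Local Notation C := (Cx R).

Definition mean n (F : 'rV[R]_n -> C) : C^o := lim ((cavg T F : C^o) @[T --> +oo%R]).

Lemma cavg_grid_eventually n (F : 'rV[R]_n -> C) (e : R) N M :
  apf F -> fine_grid F e N M -> 0 < e ->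
  \forall T \near +oo%R, cabs (cavg T F - grid_avg F N M 0) <= 6 * e.
Proof.
move=> [/bounded_pos[B B0 FB] uF pF] fg e0.
pose K : R := n%:R * (2 * pi * N%:R) * B.
near=> T.
have T0 : 0 < T by near: T; exact: nbhs_pinfty_gt.
have : K / e < T by near: T; apply: nbhs_pinfty_gt; exact: num_real.
rewrite ltr_pdivrMr // => h.
apply: le_trans (cavg_grid uF FB fg T0) _.
rewrite -/K; have : K / T <= e by rewrite ler_pdivrMr // mulrC ltW.
lra.
Unshelve. all: by end_near. Qed.

Lemma cvg_mean n (F : 'rV[R]_n -> C) : apf F ->
  (cavg T F : C^o) @[T --> +oo%R] --> mean F.
Proof.
move=> aF.
(* The Cauchy criterion is checked with grid averages as centres, separately for real and imaginary
   parts; 6 (e/7) < e gives the strict bound. *)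
have appr (e : R) : 0 < e -> exists c, \forall T \near +oo%R, cabs (cavg T F - c) < e.
  move=> e0; have e70 : 0 < e / 7 by lra.
  have [N N0 H] := fine_grid_exists aF e70.
  have [M H'] := H N (dvdnn _) N0.
  exists (grid_avg F N M 0); near=> T.
  apply: (@le_lt_trans _ _ (6 * (e / 7))); last lra.
  near: T; apply: cavg_grid_eventually => //; exact: H'.
have cR : cvg (complex.Re (cavg T F) @[T --> +oo%R]).
  apply/cauchy_cvgP/cauchy_exP => e e0.
  have [c Hc] := appr e e0; exists (complex.Re c).
  apply: (filterS _ Hc) => T; apply: le_lt_trans.
  by rewrite distrC -ReN -ReD abs_Re.
have cI : cvg (complex.Im (cavg T F) @[T --> +oo%R]).
  apply/cauchy_cvgP/cauchy_exP => e e0.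
  have [c Hc] := appr e e0; exists (complex.Im c).
  apply: (filterS _ Hc) => T; apply: le_lt_trans.
  by rewrite distrC -ImN -ImD abs_Im.
apply/cvg_ex; exists ((lim (complex.Re (cavg T F) @[T --> +oo%R]) +i*
   lim (complex.Im (cavg T F) @[T --> +oo%R])) : C^o).
apply/cvgC_cabs => e e0; have e20 : 0 < e / 2 by lra.
move/cvgrPdist_le : cR => /(_ _ e20) hR; move/cvgrPdist_le : cI => /(_ _ e20) hI.
apply: filterS2 hR hI => T hR hI.
apply: le_trans (cabs_le _) _; rewrite ReD ImD ReN ImN /= (splitr e).
by apply: lerD; rewrite distrC.
Unshelve. all: by end_near. Qed.

Lemma mean_grid n (F : 'rV[R]_n -> C) (e : R) N M :
  apf F -> 0 < e -> fine_grid F e N M -> cabs (mean F - grid_avg F N M 0) <= 7 * e.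
Proof.
move=> aF e0 fg.
suff [T [h1 h2]] : exists T, cabs (cavg T F - mean F) <= e /\
    cabs (cavg T F - grid_avg F N M 0) <= 6 * e.
  have := cabs_distD (cavg T F) (mean F) (grid_avg F N M 0).
  by rewrite cabsC in h1; lra.
have H1 := cavg_grid_eventually aF fg e0.
have H2 : \forall T \near +oo%R, cabs (cavg T F - mean F) <= e.
  by move/cvgC_cabs : (cvg_mean aF); apply.
have [T HT] := filter_ex (filterI H1 H2).
by exists T; case: HT.
Qed.

Lemma fine_grid2 n (F G : 'rV[R]_n -> C) (e : R) : apf F -> apf G -> 0 < e ->
  exists N M, fine_grid F e N M /\ fine_grid G e N M.
Proof.
move=> aF aG e0.
have [N1 N10 H1] := fine_grid_exists aF e0.
have [N2 N20 H2] := fine_grid_exists aG e0.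
have N120 : (0 < N1 * N2)%N by rewrite muln_gt0 N10.
have [M1 K1] := H1 (N1 * N2)%N (dvdn_mulr _ (dvdnn _)) N120.
have [M2 K2] := H2 (N1 * N2)%N (dvdn_mull _ (dvdnn _)) N120.
exists (N1 * N2)%N, (maxn M1 M2); split; [apply: K1|apply: K2].
  exact: leq_maxl.
exact: leq_maxr.
Qed.

Lemma cabs_le0_eq (z : C) (K : R) : 0 < K ->
  (forall e : R, 0 < e -> cabs z <= K * e) -> z = 0.
Proof.
move=> K0 H; apply: cabs_eq0; apply/eqP; rewrite eq_le cabs_ge0 andbT.
apply/ler_addgt0Pr => e e0; rewrite add0r.
by have := H (e / K) (divr_gt0 e0 K0); rewrite mulrCA divff ?mulr1 // lt0r_neq0.
Qed.

Lemma grid_avg_cabs n (F : 'rV[R]_n -> C) (B : R) N M x : (0 < M)%N ->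
  (forall x, cabs (F x) <= B) -> cabs (grid_avg F N M x) <= B.
Proof.
by move=> M0 FB; rewrite -lecabs; apply: grid_avg_le => // a; rewrite lecabs.
Qed.

Lemma mean_le n (F : 'rV[R]_n -> C) (B : R) : apf F -> (forall x, cabs (F x) <= B) ->
  cabs (mean F) <= B.
Proof.
move=> aF FB; apply/ler_addgt0Pr => e e0.
have [N [M [fg _]]] := fine_grid2 aF aF (divr_gt0 e0 (ltr0n _ 7)).
have h := mean_grid aF (divr_gt0 e0 (ltr0n _ 7)) fg.
rewrite -(subrK (grid_avg F N M 0) (mean F)); apply: le_trans (cabsD _ _) _.
rewrite addrC; apply: lerD; first by apply: grid_avg_cabs => //; case: fg.
by apply: le_trans h _; lra.
Qed.

Lemma meanD n (F G : 'rV[R]_n -> C) : apf F -> apf G ->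
  mean (fun x => F x + G x) = mean F + mean G.
Proof.
move=> aF aG; apply/eqP; rewrite -subr_eq0; apply/eqP.
have aFG : apf (fun x => F x + G x) by exact: apfD.
(* 7 e for each summand and 7 (2 e) for the sum, for which the common grid is fine up to 2 e. *)
apply: (@cabs_le0_eq _ 28) => // e e0.
have [N [M [fF fG]]] := fine_grid2 aF aG e0.
have fFG : fine_grid (fun x => F x + G x) (2 * e) N M.
  case: fF fG => N0 M0 p1 m1 [_ _ p2 m2]; split => // [x m|x y xy].
    rewrite opprD addrACA mulr_natl mulr2n.
    exact: le_trans (cabsD _ _) (lerD (p1 x m) (p2 x m)).
  rewrite opprD addrACA mulr_natl mulr2n.
  exact: le_trans (cabsD _ _) (lerD (m1 _ _ xy) (m2 _ _ xy)).
have h1 := mean_grid aF e0 fF; have h2 := mean_grid aG e0 fG.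
have h3 := mean_grid aFG (mulr_gt0 (ltr0n _ 2) e0) fFG.
have E : grid_avg (fun x => F x + G x) N M 0 = grid_avg F N M 0 + grid_avg G N M 0.
  rewrite -[grid_avg F N M 0]mul1r -grid_avgD.
  by rewrite /grid_avg; congr (_ * _); apply: eq_bigr => a _; rewrite mul1r.
rewrite E in h3.
have -> : mean (fun x => F x + G x) - (mean F + mean G) =
  (mean (fun x => F x + G x) - (grid_avg F N M 0 + grid_avg G N M 0)) -
  ((mean F - grid_avg F N M 0) + (mean G - grid_avg G N M 0)) by ring.
apply: le_trans (cabsB _ _) _.
have := cabsD (mean F - grid_avg F N M 0) (mean G - grid_avg G N M 0).
lra.
Qed.

Lemma mean_cst n (c : C) : mean (fun _ : 'rV[R]_n => c) = c.
Proof.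
apply/eqP; rewrite -subr_eq0; apply/eqP.
apply: (@cabs_le0_eq _ 7) => // e e0.
have [N [M [fg _]]] := fine_grid2 (apf_cst n c) (apf_cst n c) e0.
have := mean_grid (apf_cst n c) e0 fg; congr (cabs (_ - _) <= _).
rewrite /grid_avg sumr_const card_ffun !card_ord -[c *+ _]mulr_natl natrX mulKf //.
by rewrite expf_neq0 // pnatr_eq0 -lt0n; case: fg.
Qed.

Lemma meanZ n (c : C) (F : 'rV[R]_n -> C) : apf F -> mean (fun x => c * F x) = c * mean F.
Proof.
move=> aF; apply/eqP; rewrite -subr_eq0; apply/eqP.
apply: (@cabs_le0_eq _ (7 + cabs c * 7)) => [|e e0].
  by have := cabs_ge0 c; lra.
have [N [M [fF fG]]] := fine_grid2 aF (apfZ c aF) e0.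
have h1 := mean_grid aF e0 fF; have h2 := mean_grid (apfZ c aF) e0 fG.
have E : grid_avg (fun x => c * F x) N M 0 = c * grid_avg F N M 0.
  by rewrite /grid_avg -mulr_sumr mulrCA.
rewrite E in h2.
have -> : mean (fun x => c * F x) - c * mean F = 
   (mean (fun x => c * F x) - c * grid_avg F N M 0) - c * (mean F - grid_avg F N M 0) by ring.
apply: le_trans (cabsB _ _) _; rewrite cabsM.
have := ler_wpM2l (cabs_ge0 c) h1; lra.
Qed.

Lemma meanB n (F G : 'rV[R]_n -> C) : apf F -> apf G ->
  mean (fun x => F x - G x) = mean F - mean G.
Proof.
move=> aF aG; rewrite -[mean G]mul1r -mulNr -meanZ // -meanD //; last exact: apfZ.
by congr mean; apply/funext => x; rewrite mulN1r.
Qed.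

Lemma mean_sum n (I : Type) (r : seq I) (F : I -> 'rV[R]_n -> C) :
  (forall i, apf (F i)) ->
  mean (fun x => \sum_(i <- r) F i x) = \sum_(i <- r) mean (F i).
Proof.
move=> aF; elim: r => [|i r IH].
  by under eq_fun do rewrite big_nil; rewrite big_nil mean_cst.
under eq_fun do rewrite big_cons.
by rewrite big_cons meanD ?IH //; exact: apf_sum.
Qed.

Lemma mean_shift n (F : 'rV[R]_n -> C) s : apf F -> mean (fun x => F (x + s)) = mean F.
Proof.
move=> aF; apply/eqP; rewrite -subr_eq0; apply/eqP.
(* 7 e for each of the two means, and 2 e for moving the base point of the grid average. *)
apply: (@cabs_le0_eq _ 16) => // e e0.
have [N [M [fF fG]]] := fine_grid2 aF (apf_shift s aF) e0.
have h1 := mean_grid aF e0 fF; have h2 := mean_grid (apf_shift s aF) e0 fG.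
have E : grid_avg (fun x => F (x + s)) N M 0 = grid_avg F N M s.
  rewrite /grid_avg; congr (_ * _); apply: eq_bigr => a _; congr F.
  by rewrite add0r addrC.
have h3 : cabs (grid_avg F N M s - grid_avg F N M 0) <= 2 * e.
  rewrite -lecabs rmorphM /= rmorph_nat; case: fF => N0 M0 p m.
  by apply: grid_avg_near_const => // [x k|x y xy]; rewrite lecabs ?p ?m.
rewrite E in h2.
have := cabs_distD (grid_avg F N M s) (mean (fun x => F (x + s))) (mean F).
have := cabs_distD (grid_avg F N M 0) (grid_avg F N M s) (mean F).
have := cabsC (mean F) (grid_avg F N M 0).
lra.
Qed.

(** The majorant is complex valued so that the linear calculus of means applies to it; it will be a
    real trigonometric polynomial times a Fejer kernel. *)
Lemma mean_le_Re n (F G : 'rV[R]_n -> C) : apf F -> apf G ->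
  (forall x, cabs (F x) <= complex.Re (G x)) -> cabs (mean F) <= complex.Re (mean G).
Proof.
move=> aF aG FG; apply/ler_addgt0Pr => e' e'0.
pose e := e' / 14; have e0 : 0 < e by rewrite divr_gt0.
have [N [M [fF fG]]] := fine_grid2 aF aG e0.
have h1 := mean_grid aF e0 fF; have h2 := mean_grid aG e0 fG.
have M0 : (0 < M)%N by case: fF.
have h3 : cabs (grid_avg F N M 0) <= complex.Re (grid_avg G N M 0).
  rewrite grid_avg_Re /grid_avg cabsM cabsV -natrX cabs_nat natrX.
  rewrite ler_wpM2l ?invr_ge0 //; apply: le_trans (cabs_sum _ _ _) _.
  by apply: ler_sum.
have h4 := abs_Re (mean G - grid_avg G N M 0); rewrite ReD ReN in h4.
have h5 := cabsD (mean F - grid_avg F N M 0) (grid_avg F N M 0); rewrite subrK in h5.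
have := le_trans h4 h2; rewrite ler_norml => /andP[h6 _].
have : e' = 14 * e by rewrite /e; field.
lra.
Qed.

End Mean.

(** * Goursat lemma *)

Section Goursat.
Variable R : realType.
Local Notation C := (Cx R).

(** Everything follows from 1 + x <= e^x at x and at -x, the latter read as e^x (1 - x) <= 1. *)
Lemma expR_quad (x : R) : `|x| <= 1 / 2 ->
  expR x <= 2 /\ `|expR x - 1 - x| <= 2 * x ^+ 2.
Proof.
rewrite ler_norml => /andP[x1 x2].
have h1 := expR_ge1Dx x; have h2 := expR_ge1Dx (- x).
have p := expR_gt0 x; have p' := expR_gt0 (- x).
have h3 : expR x * expR (- x) = 1 by rewrite -expRD subrr expR0.
have h4 : expR x * (1 - x) <= 1 by nra.
split; first by nra.
rewrite ger0_norm; last by lra.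
have h5 : expR x <= 2 by nra.
nra.
Qed.

Lemma one_sub_cos_le (y : R) : `|cos y - 1| <= y ^+ 2 / 2.
Proof.
have := cabs_cis_sub1 y.
rewrite -ler_sqr ?nnegrE ?cabs_ge0 // cabs_sqr /= oppr0 addr0 real_normK ?num_real //.
have c1 : cos y - 1 <= 0 by have := cos_le1 y; lra.
rewrite (ler0_norm c1); have := cos2Dsin2 y; lra.
Qed.

Lemma sin_sub_le (y : R) : `|y| <= 1 / 2 -> `|sin y - y| <= y ^+ 2.
Proof.
have H (z : R) : 0 <= z -> z <= 1 / 2 -> `|sin z - z| <= z ^+ 2.
  rewrite le_eqVlt => /predU1P[<- _|z0 z1]; first by rewrite sin0 subr0 normr0 expr0n.
  have csin : {within `[0, z], continuous (@sin R)}.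
    by apply: continuous_subspaceT => u; exact: continuous_sin.
  have [c] := MVT z0 (fun u _ => is_derive_sin u) csin.
  rewrite in_itv /= sin0 !subr0 => /andP[c0 cz] ->.
  have := one_sub_cos_le c; have c1 : cos c - 1 <= 0 by have := cos_le1 c; lra.
  rewrite (ler0_norm c1) => h.
  have -> : cos c * z - z = - ((1 - cos c) * z) by ring.
  have h1 : 0 <= 1 - cos c by have := cos_le1 c; lra.
  by rewrite normrN ger0_norm; nra.
have [y0|y0] := lerP 0 y; first by rewrite (ger0_norm y0); exact: H.
rewrite (ltr0_norm y0) => y1; have := H (- y) ltac:(lra) y1.
by rewrite sinN -opprD normrN sqrrN.
Qed.

Lemma cexp_quad (w : C) : cabs w <= 1 / 2 -> cabs (cexp w - 1 - w) <= 6 * cabs w ^+ 2.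
Proof.
move=> w1; have hR := abs_Re w; have hI := abs_Im w.
set x := complex.Re w in hR *; set y := complex.Im w in hI *.
have -> : cexp w - 1 - w = (expR x)%:C * ((cos y - 1) +i* (sin y - y)) +
   ((expR x - 1 - x) +i* ((expR x - 1) * y)) :> C.
  by apply: complexP; rewrite /cexp !(ReD, ImD, ReN, ImN, ReM_real, ImM_real) -/x -/y /=; ring.
have [e1 e2] := expR_quad (le_trans hR w1).
have c1 := one_sub_cos_le y; have s1 := sin_sub_le (le_trans hI w1).
have e3 := expR_sub1_le x.
have e0 := expR_ge0 x.
have xw : x ^+ 2 <= cabs w ^+ 2 by rewrite cabs_sqr lerDl sqr_ge0.
have yw : y ^+ 2 <= cabs w ^+ 2 by rewrite cabs_sqr lerDr sqr_ge0.
have xy : x ^+ 2 + y ^+ 2 = cabs w ^+ 2 by rewrite cabs_sqr.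
apply: le_trans (cabsD _ _) _; rewrite cabsM cabs_real ger0_norm //.
have b1 : cabs ((cos y - 1) +i* (sin y - y) : C) <= y ^+ 2 / 2 + y ^+ 2.
  by apply: le_trans (cabs_le _) _; exact: lerD.
have b2 : cabs ((expR x - 1 - x) +i* ((expR x - 1) * y) : C) <= 2 * x ^+ 2 + 2 * `|x| * `|y|.
  apply: le_trans (cabs_le _) _; apply: lerD => //=.
  rewrite normrM ler_wpM2r //; apply: le_trans e3 _.
  by rewrite mulrC ler_wpM2r // ge_max e1 andbT; lra.
have b3 : 2 * `|x| * `|y| <= x ^+ 2 + y ^+ 2.
  rewrite -[x ^+ 2]real_normK ?num_real // -[y ^+ 2]real_normK ?num_real //.
  by have := sqr_ge0 (`|x| - `|y|); rewrite sqrrB; lra.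
have := cabs_ge0 ((cos y - 1) +i* (sin y - y) : C).
nra.
Qed.

Definition cdiff (F : C -> C) (p : C) := exists b : C, forall e : R, 0 < e ->
  exists2 d : R, 0 < d & forall z, cabs (z - p) <= d ->
    cabs (F z - F p - b * (z - p)) <= e * cabs (z - p).

Lemma cdiff_lip (F : C -> C) p b : (forall e : R, 0 < e ->
  exists2 d : R, 0 < d & forall z, cabs (z - p) <= d ->
    cabs (F z - F p - b * (z - p)) <= e * cabs (z - p)) ->
  exists2 d : R, 0 < d & forall z, cabs (z - p) <= d ->
    cabs (F z - F p) <= (cabs b + 1) * cabs (z - p).
Proof.
move=> H; have [d d0 Hd] := H 1 ltr01; exists d => // z /Hd h.
have -> : F z - F p = (F z - F p - b * (z - p)) + b * (z - p) by ring.
by apply: le_trans (cabsD _ _) _; rewrite cabsM; lra.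
Qed.

Lemma cdiffM (F G : C -> C) p : cdiff F p -> cdiff G p -> cdiff (fun z => F z * G z) p.
Proof.
move=> [b Hb] [c Hc]; exists (b * G p + F p * c) => e e0.
have [dF dF0 LF] := cdiff_lip Hb; have [dG dG0 LG] := cdiff_lip Hc.
have bp := cabs_ge0 b; have cp := cabs_ge0 c.
have Gp := cabs_ge0 (G p); have Fp := cabs_ge0 (F p).
have [d1 d10 H1] := Hb (e / (3 * (cabs (G p) + 1))) ltac:(by rewrite divr_gt0 // mulr_gt0 //; lra).
have [d2 d20 H2] := Hc (e / (3 * (cabs (F p) + 1))) ltac:(by rewrite divr_gt0 // mulr_gt0 //; lra).
(* [K] is the product of the two local Lipschitz constants, and [d3] makes the quadratic term K r^2
   at most e r / 3. *)
pose K := (cabs b + 1) * (cabs c + 1).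
have K0 : 0 < K by rewrite mulr_gt0 //; lra.
pose d3 := e / (3 * K).
have d30 : 0 < d3 by rewrite divr_gt0 // mulr_gt0.
exists (Num.min (Num.min dF dG) (Num.min (Num.min d1 d2) d3)).
  by rewrite !lt_min dF0 dG0 d10 d20 d30.
move=> z; rewrite !le_min => /andP[/andP[zF zG] /andP[/andP[z1 z2] z3]].
set r := cabs (z - p) in LF LG H1 H2 zF zG z1 z2 z3 *.
have r0 : 0 <= r by exact: cabs_ge0.
have -> : F z * G z - F p * G p - (b * G p + F p * c) * (z - p) =
  (F z - F p) * (G z - G p) + ((F z - F p - b * (z - p)) * G p +
   F p * (G z - G p - c * (z - p))) by ring.
apply: le_trans (cabsD _ _) _.
have h1 : cabs ((F z - F p) * (G z - G p)) <= e / 3 * r.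
  rewrite cabsM; apply: (@le_trans _ _ (((cabs b + 1) * r) * ((cabs c + 1) * r))).
    by apply: ler_pM (LF z zF) (LG z zG); exact: cabs_ge0.
  have -> : e / 3 = K * d3 by rewrite /d3; field; rewrite lt0r_neq0.
  have -> : (cabs b + 1) * r * ((cabs c + 1) * r) = K * r * r by rewrite /K; ring.
  by rewrite ler_wpM2r // ler_pM2l.
have h2 : cabs ((F z - F p - b * (z - p)) * G p) <= e / 3 * r.
  rewrite cabsM; apply: (@le_trans _ _ (e / (3 * (cabs (G p) + 1)) * r * (cabs (G p) + 1))).
    by apply: ler_pM (H1 z z1) _; [exact: cabs_ge0| |lra].
  by rewrite le_eqVlt; apply/orP; left; apply/eqP; field; rewrite lt0r_neq0 //; lra.
have h3 : cabs (F p * (G z - G p - c * (z - p))) <= e / 3 * r.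
  rewrite cabsM; apply: (@le_trans _ _ ((cabs (F p) + 1) * (e / (3 * (cabs (F p) + 1)) * r))).
    by apply: ler_pM _ (H2 z z2) => //; [exact: cabs_ge0|lra].
  by rewrite le_eqVlt; apply/orP; left; apply/eqP; field; rewrite lt0r_neq0 //; lra.
have := cabsD ((F z - F p - b * (z - p)) * G p) (F p * (G z - G p - c * (z - p))).
lra.
Qed.

Lemma cdiff_cexp (c0 c1 p : C) : cdiff (fun z => cexp (c0 + c1 * z)) p.
Proof.
set E := cexp (c0 + c1 * p); exists (E * c1) => e e0.
have E0 := cabs_ge0 E; have c10 := cabs_ge0 c1.
pose K := 6 * (cabs E + 1) * (cabs c1 + 1) ^+ 2.
have K0 : 0 < K by rewrite mulr_gt0 ?exprn_gt0 ?mulr_gt0 //; lra.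
exists (Num.min (1 / (2 * (cabs c1 + 1))) (e / K)).
  by rewrite lt_min !divr_gt0 // mulr_gt0 //; lra.
move=> z; rewrite le_min => /andP[z1 z2].
set r := cabs (z - p) in z1 z2 *; have r0 : 0 <= r by exact: cabs_ge0.
have -> : cexp (c0 + c1 * z) - cexp (c0 + c1 * p) - E * c1 * (z - p) =
  E * (cexp (c1 * (z - p)) - 1 - c1 * (z - p)).
  have -> : c0 + c1 * z = (c0 + c1 * p) + c1 * (z - p) by ring.
  by rewrite cexpD -/E; ring.
rewrite cabsM.
have h : cabs (c1 * (z - p)) <= (cabs c1 + 1) * r by rewrite cabsM ler_wpM2r //; lra.
have h' : cabs (c1 * (z - p)) <= 1 / 2.
  apply: le_trans h _; rewrite mulrC -ler_pdivlMr; last by lra.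
  by apply: le_trans z1 _; rewrite le_eqVlt; apply/orP; left; apply/eqP; field; rewrite lt0r_neq0 //; lra.
apply: (@le_trans _ _ ((cabs E + 1) * (6 * ((cabs c1 + 1) * r) ^+ 2))).
  apply: ler_pM => //; [exact: cabs_ge0|lra|].
  apply: le_trans (cexp_quad h') _; rewrite ler_pM2l // ler_sqr ?nnegrE ?cabs_ge0 //.
  by rewrite mulr_ge0 //; lra.
have -> : (cabs E + 1) * (6 * ((cabs c1 + 1) * r) ^+ 2) = K * r * r by rewrite /K; ring.
by rewrite ler_wpM2r // mulrC -ler_pdivlMr.
Qed.

Definition seg_avg m (F : C -> C) (w a : C) : C :=
  (2 ^+ m)^-1 * \sum_(j < 2 ^ m) F (a + w * (j%:R / 2 ^+ m)).

(** A Riemann sum for the contour integral around the parallelogram a, a + w, a + w + v, a + v, with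
    opposite sides grouped together. *)
Definition circuit m (F : C -> C) (w v a : C) : C :=
  w * (seg_avg m F w a - seg_avg m F w (a + v)) +
  v * (seg_avg m F v (a + w) - seg_avg m F v a).

Lemma seg_avgS m F w a :
  seg_avg m.+1 F w a = (seg_avg m F (w / 2) a + seg_avg m F (w / 2) (a + w / 2)) / 2.
Proof.
have two0 : (2 : C) != 0 by rewrite pnatr_eq0.
have p0 : (2 : C) ^+ m != 0 by rewrite expf_neq0.
rewrite /seg_avg.
have -> : \sum_(j < 2 ^ m.+1) F (a + w * (j%:R / 2 ^+ m.+1)) =
  \sum_(j < 2 ^ m) F (a + w / 2 * (j%:R / 2 ^+ m)) +
  \sum_(j < 2 ^ m) F (a + w / 2 + w / 2 * (j%:R / 2 ^+ m)).
  rewrite -(big_mkord xpredT (fun j => F (a + w * (j%:R / 2 ^+ m.+1)))).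
  rewrite expnS mul2n -addnn (@big_cat_nat _ _ _ (2 ^ m)%N) //= ?leq_addr //.
  rewrite -{2}[(2 ^ m)%N]addn0 addnC big_addn addnK !big_mkord; congr (_ + _).
    by apply: eq_bigr => j _; congr F; rewrite exprS; field; rewrite ?p0 ?two0.
  apply: eq_bigr => j _; congr F; rewrite natrD natrX exprS; by field; rewrite ?p0 ?two0.
by rewrite exprS; field; rewrite ?p0 ?two0.
Qed.

(** The four half-size parallelograms sample their common sides at the same points with opposite
    orientations, so the interior contributions cancel exactly and not only in the limit. *)
Lemma circuitS m F w v a :
  circuit m.+1 F w v a =
    (circuit m F (w / 2) (v / 2) a + circuit m F (w / 2) (v / 2) (a + w / 2)) +
    (circuit m F (w / 2) (v / 2) (a + v / 2) + circuit m F (w / 2) (v / 2) (a + w / 2 + v / 2)).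
Proof.
rewrite /circuit !seg_avgS.
have -> : a + v / 2 + v / 2 = a + v by field.
have -> : a + w / 2 + v / 2 + v / 2 = a + v + w / 2 by field.
have -> : a + v / 2 + w / 2 = a + w / 2 + v / 2 by ring.
have -> : a + w / 2 + v / 2 + w / 2 = a + w + v / 2 by field.
have -> : a + w / 2 + w / 2 = a + w by field.
by field.
Qed.

Lemma seg_avgD m F G w a : seg_avg m (fun z => F z + G z) w a = seg_avg m F w a + seg_avg m G w a.
Proof. by rewrite /seg_avg big_split mulrDr. Qed.

(** The difference depends neither on the direction nor on m, so for an affine function the two
    pairs of opposite sides of a circuit give - w b v and v b w, which cancel. *)
Lemma seg_avg_affine m (c b w a a' : C) :
  seg_avg m (fun z => c + b * z) w a - seg_avg m (fun z => c + b * z) w a' = b * (a - a').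
Proof.
have p0 : (2 : C) ^+ m != 0 by rewrite expf_neq0 // pnatr_eq0.
rewrite /seg_avg -mulrBr -sumrB.
rewrite (eq_bigr (fun=> b * (a - a'))); last by move=> j _; ring.
by rewrite sumr_const card_ord -[(b * (a - a')) *+ _]mulr_natl natrX mulKf.
Qed.

Lemma seg_avg_le m F w a (e : R) :
  (forall s : R, 0 <= s <= 1 -> cabs (F (a + w * s%:C)) <= e) -> cabs (seg_avg m F w a) <= e.
Proof.
move=> H; rewrite /seg_avg cabsM cabsV -natrX cabs_nat.
have p0 : (0 : R) < (2 ^ m)%:R by rewrite ltr0n expn_gt0.
rewrite mulrC ler_pdivrMr //.
apply: le_trans (cabs_sum _ _ _) _.
apply: (@le_trans _ _ (\sum_(j < 2 ^ m) e)); last first.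
  by rewrite sumr_const card_ord -[e *+ _]mulr_natr.
apply: ler_sum => j _.
have -> : (j%:R / (2 ^ m)%:R : C) = (j%:R / (2 ^ m)%:R : R)%:C.
  by rewrite rmorphM fmorphV !rmorph_nat.
apply: H; rewrite divr_ge0 // ler_pdivrMr // mul1r ler_nat ltnW //.
Qed.

Lemma circuit_le m F w v a (p b : C) (e D : R) :
  (forall s t : R, 0 <= s <= 1 -> 0 <= t <= 1 ->
     cabs (F (a + w * s%:C + v * t%:C) - F p - b * (a + w * s%:C + v * t%:C - p)) <= e * D) ->
  cabs (circuit m F w v a) <= 2 * (cabs w + cabs v) * (e * D).
Proof.
move=> H.
pose G z := F z - F p - b * (z - p).
have FE : F = (fun z => ((F p - b * p) + b * z) + G z).
  by apply/funext => z; rewrite /G; ring.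
have -> : circuit m F w v a = circuit m G w v a.
  rewrite {1}FE /circuit !(seg_avgD m (fun z => F p - b * p + b * z) G).
  have h1 := seg_avg_affine m (F p - b * p) b w a (a + v).
  have h2 := seg_avg_affine m (F p - b * p) b v (a + w) a.
  move/eqP: h1; rewrite subr_eq => /eqP ->; move/eqP: h2; rewrite subr_eq => /eqP ->; ring.
have I0 : 0 <= (0 : R) <= 1 by apply/andP; split; lra.
have I1 : 0 <= (1 : R) <= 1 by apply/andP; split; lra.
have b1 : cabs (seg_avg m G w a) <= e * D.
  by apply: seg_avg_le => s s1; have := H s 0 s1 I0; rewrite mulr0 addr0.
have b2 : cabs (seg_avg m G w (a + v)) <= e * D.
  apply: seg_avg_le => s s1; have := H s 1 s1 I1; rewrite mulr1.
  by rewrite (addrAC a v).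
have b3 : cabs (seg_avg m G v (a + w)) <= e * D.
  by apply: seg_avg_le => t t1; have := H 1 t I1 t1; rewrite mulr1.
have b4 : cabs (seg_avg m G v a) <= e * D.
  by apply: seg_avg_le => t t1; have := H 0 t I0 t1; rewrite mulr0 addr0.
rewrite /circuit; apply: le_trans (cabsD _ _) _; rewrite !cabsM.
have := ler_wpM2l (cabs_ge0 w) (le_trans (cabsB _ _) (lerD b1 b2)).
have := ler_wpM2l (cabs_ge0 v) (le_trans (cabsB _ _) (lerD b3 b4)).
lra.
Qed.

End Goursat.

Section GoursatTheorem.
Variable R : realType.
Local Notation C := (Cx R).

Lemma nested_intervals (x : nat -> R) : (forall k, x k <= x k.+1) ->
  (forall k, x k.+1 + (2 ^+ k.+1)^-1 <= x k + (2 ^+ k)^-1) ->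
  exists s, forall k, x k <= s <= x k + (2 ^+ k)^-1.
Proof.
move=> x_le x_ub.
have mono k j : (k <= j)%N -> x k <= x j.
  by move=> /subnKC <-; elim: (j - k)%N => [|i IH]; rewrite ?addn0 // addnS (le_trans IH).
have anti k j : (k <= j)%N -> x j + (2 ^+ j)^-1 <= x k + (2 ^+ k)^-1.
  by move=> /subnKC <-; elim: (j - k)%N => [|i IH]; rewrite ?addn0 // addnS (le_trans _ IH).
have ub k j : x j <= x k + (2 ^+ k)^-1.
  have p i : 0 <= (2 ^+ i : R)^-1 by rewrite invr_ge0 exprn_ge0.
  have [kj|/ltnW jk] := leqP k j.
    by apply: le_trans (anti k j kj); rewrite lerDl.
  by apply: le_trans (mono j k jk) _; rewrite lerDl.
exists (sup (range x)) => k; apply/andP; split.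
  apply: sup_upper_bound; last by exists k.
  split; first by exists (x 0%N); exists 0%N.
  by exists (x 0%N + (2 ^+ 0)^-1) => _ [j _ <-].
by apply: ge_sup => [|_ [j _ <-]] //; exists (x 0%N); exists 0%N.
Qed.

(* Goursat's bisection, with the four circuit integrals replaced by left Riemann
   sums on [2 ^ m] points: those are exactly additive under quartering and vanish
   exactly on affine functions, so no integral is needed. *)
Lemma goursat (F : C -> C) (w v a : C) :
  (forall s t : R, 0 <= s <= 1 -> 0 <= t <= 1 -> cdiff F (a + w * s%:C + v * t%:C)) ->
  forall e : R, 0 < e -> exists m0, forall m, (m0 <= m)%N -> cabs (circuit m F w v a) <= e.
Proof.
move=> dF e e0; apply: contrapT => nex.
pose h k : R := (2 ^+ k)^-1.
have hS k : h k.+1 + h k.+1 = h k.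
  by rewrite /h exprS; field; rewrite expf_neq0.
have h0 k : 0 < h k by rewrite invr_gt0 exprn_gt0.
pose sub m k x y := circuit m F (w * (h k)%:C) (v * (h k)%:C) (a + w * x%:C + v * y%:C).
(* A piece of relative side 2^-k is bad if its circuit exceeds the share e 4^-k for arbitrarily
   large m. Asking this for arbitrarily large m is what survives bisection, since each subdivision
   lowers m by one. *)
pose bad k (p : R * R) := forall m0, exists2 m, (m0 <= m)%N & e * h k ^+ 2 < cabs (sub m k p.1 p.2).
pose good_step k (p q : R * R) := [/\ bad k.+1 q, p.1 <= q.1, q.1 + h k.+1 <= p.1 + h k,
   p.2 <= q.2 & q.2 + h k.+1 <= p.2 + h k].
have bad0 : bad 0%N (0, 0).
  move=> m0; apply: contrapT => H; apply: nex; exists m0 => m mm.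
  rewrite leNgt; apply/negP => lt; apply: H; exists m => //=.
  rewrite /sub /h expr0 invr1 expr1n mulr1.
  by rewrite (_ : (1 : R)%:C = 1) // (_ : (0 : R)%:C = 0) // !mulr1 !mulr0 !addr0.
have step k p : bad k p -> exists q, good_step k p q.
  case: p => x y bk; apply: contrapT => H.
  have nb (dx dy : R) : dx \in [:: 0; h k.+1] -> dy \in [:: 0; h k.+1] ->
      exists m0, forall m, (m0 <= m)%N -> cabs (sub m k.+1 (x + dx) (y + dy)) <= e * h k.+1 ^+ 2.
    move=> dx0 dy0; apply: contrapT => H'; apply: H; exists (x + dx, y + dy).
    have hh := hS k; have hp := h0 k.+1.
    have bx d : d \in [:: 0; h k.+1] -> 0 <= d /\ d + h k.+1 <= h k.
      by rewrite !inE => /orP[]/eqP->; split; lra.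
    have [bx1 bx2] := bx _ dx0; have [by1 by2] := bx _ dy0.
    split => /=; try lra.
    move=> m0; apply: contrapT => H2; apply: H'; exists m0 => m mm.
    by rewrite leNgt; apply/negP => lt; apply: H2; exists m.
  have i0 : 0 \in [:: 0; h k.+1] by rewrite inE eqxx.
  have i1 : h k.+1 \in [:: 0; h k.+1] by rewrite !inE eqxx orbT.
  have [m1 H1] := nb _ _ i0 i0; have [m2 H2] := nb _ _ i1 i0.
  have [m3 H3] := nb _ _ i0 i1; have [m4 H4] := nb _ _ i1 i1.
  (* A successor beyond all four thresholds, so that its predecessor still passes each of them once
     [circuitS] has lowered it. *)
  have [[//|m] mm] := bk (maxn (maxn m1 m2) (maxn m3 m4)).+1.
  rewrite ltnS !geq_max in mm; move: mm => /andP[/andP[mm1 mm2] /andP[mm3 mm4]].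
  apply/negP; rewrite -leNgt /sub circuitS.
  have half (u : C) : u * (h k)%:C / 2 = u * (h k.+1)%:C.
    have -> : (h k)%:C = (2 : C) * (h k.+1)%:C by rewrite -hS rmorphD /=; ring.
    by field.
  rewrite !half.
  move: {H1 H2 H3 H4} (H1 m mm1) (H2 m mm2) (H3 m mm3) (H4 m mm4); rewrite /sub !addr0.
  have ad1 : a + w * (x + h k.+1)%:C + v * y%:C = a + w * x%:C + v * y%:C + w * (h k.+1)%:C.
    by rewrite rmorphD /=; ring.
  have ad2 : a + w * x%:C + v * (y + h k.+1)%:C = a + w * x%:C + v * y%:C + v * (h k.+1)%:C.
    by rewrite rmorphD /=; ring.
  have ad3 : a + w * (x + h k.+1)%:C + v * (y + h k.+1)%:C =
     a + w * x%:C + v * y%:C + w * (h k.+1)%:C + v * (h k.+1)%:C.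
    by rewrite !rmorphD /=; ring.
  rewrite ad1 ad2 ad3 /= => b1 b2 b3 b4.
  apply: le_trans (cabsD _ _) _.
  apply: le_trans (lerD (le_trans (cabsD _ _) (lerD b1 b2)) (le_trans (cabsD _ _) (lerD b3 b4))) _.
  by rewrite -(hS k) le_eqVlt; apply/orP; left; apply/eqP; ring.
have [nxt Hnxt] : {f : nat * (R * R) -> R * R &
    forall kp, bad kp.1 kp.2 -> good_step kp.1 kp.2 (f kp)}.
  apply: (@choice _ _ (fun kp q => bad kp.1 kp.2 -> good_step kp.1 kp.2 q)) => -[k p] /=.
  have [bk|nbk] := pselect (bad k p); last by exists p.
  by have [q Hq] := step k p bk; exists q.
pose P := fix P k := if k is k'.+1 then nxt (k', P k') else (0, 0).
have badP k : bad k (P k).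
  by elim: k => [//|k IH]; have [] := Hnxt (k, P k) IH.
have gP k : good_step k (P k) (P k.+1) by exact: (Hnxt (k, P k) (badP k)).
have [s Hs] : exists s, forall k, (P k).1 <= s <= (P k).1 + h k.
  by apply: nested_intervals => k; case: (gP k).
have [t Ht] : exists t, forall k, (P k).2 <= t <= (P k).2 + h k.
  by apply: nested_intervals => k; case: (gP k).
have h01 : h 0%N = 1 by rewrite /h expr0 invr1.
have s1 : 0 <= s <= 1 by have := Hs 0%N; rewrite /= h01 add0r.
have t1 : 0 <= t <= 1 by have := Ht 0%N; rewrite /= h01 add0r.
have [b Hb] := dF s t s1 t1.
set p := a + w * s%:C + v * t%:C in Hb.
pose W := cabs w + cabs v; have W0 : 0 <= W by rewrite addr_ge0 ?cabs_ge0.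
(* The final bound becomes 2 (W h)(eta W h) = e h^2 W^2 / (W + 1)^2, at most the share e h^2; W + 1
   keeps the denominator positive for a degenerate parallelogram. *)
pose eta := e / (2 * (W + 1) ^+ 2).
have W1 : 0 < (W + 1) ^+ 2 by rewrite exprn_gt0 //; lra.
have eta0 : 0 < eta by rewrite divr_gt0 // mulr_gt0.
have [d d0 Hd] := Hb eta eta0.
have [k hk] : exists k, W * h k <= d.
  pose k := (Num.truncn (W / d)).+1; exists k.
  rewrite /h ler_pdivrMr ?exprn_gt0 // mulrC -ler_pdivrMr //.
  apply: le_trans (ltW (truncnS_gt _)) _.
  by rewrite -natrX ler_nat ltnW // ltn_expl.
have [m _] := badP k 0%N.
apply/negP; rewrite -leNgt /sub.
case: (P k) (Hs k) (Ht k) => x y /= {}Hs {}Ht.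
have near_p (s' t' : R) : 0 <= s' <= 1 -> 0 <= t' <= 1 ->
   cabs (a + w * x%:C + v * y%:C + w * (h k)%:C * s'%:C + v * (h k)%:C * t'%:C - p) <= W * h k.
  move=> s'1 t'1.
  have -> : a + w * x%:C + v * y%:C + w * (h k)%:C * s'%:C + v * (h k)%:C * t'%:C - p =
     w * (x + h k * s' - s)%:C + v * (y + h k * t' - t)%:C.
    by rewrite !rmorphD !rmorphM !rmorphN /= /p; ring.
  apply: le_trans (cabsD _ _) _; rewrite !cabsM !cabs_real mulrDl.
  have hk0 := h0 k.
  have aux (u u' x' : R) : 0 <= u' <= 1 -> x' <= u <= x' + h k -> `|x' + h k * u' - u| <= h k.
    by move=> /andP[u1 u2] /andP[u3 u4]; rewrite ler_norml; apply/andP; split; nra.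
  by apply: lerD; rewrite ler_wpM2l ?cabs_ge0 //; exact: aux.
apply: le_trans (@circuit_le _ _ _ _ _ _ p b eta (W * h k) _) _.
  move=> s' t' s'1 t'1; have np := near_p s' t' s'1 t'1.
  apply: le_trans (Hd _ (le_trans np hk)) _.
  by rewrite ler_pM2l.
rewrite !cabsM !cabs_real gtr0_norm // -mulrDl -/W.
have -> : 2 * (W * h k) * (eta * (W * h k)) = (e * h k ^+ 2) * (W ^+ 2 / (W + 1) ^+ 2).
  by rewrite /eta; field; lra.
apply: ler_piMr; first by rewrite mulr_ge0 ?exprn_ge0 // ltW.
by rewrite ler_pdivrMr // mul1r ler_sqr ?nnegrE //; lra.
Qed.

End GoursatTheorem.

(** * Characters and contour shift *)

Section ExponentialCharacters.
Variable R : realType.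
Local Notation C := (Cx R).

Definition qexp n (q : 'rV[rat]_n) (z : 'rV[C]_n) : C := cexp ((0 +i* 1) * qdot q z).

Definition cpt n (x y : 'rV[R]_n) : 'rV[C]_n := \row_j (x 0 j +i* y 0 j).

Definition rdot n (q : 'rV[rat]_n) (x : 'rV[R]_n) : R := \sum_j ratr (q 0 j) * x 0 j.

(** Written exactly as the translation in [limit_periodic], so that the two are convertible. *)
Definition latC n (N : nat) (m : 'rV[int]_n) : 'rV[C]_n :=
  map_mx (fun a : int => (2 * pi * N%:R * a%:~R)%:C) m.

Lemma ratr_C (a : rat) : ratr a = (ratr a : R)%:C :> C.
Proof. by rewrite fmorph_rat. Qed.

Lemma qdotD n (q r : 'rV[rat]_n) z : qdot (R := R) (q + r) z = qdot q z + qdot r z.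
Proof.
by rewrite /qdot -big_split; apply: eq_bigr => j _; rewrite mxE rmorphD mulrDl.
Qed.

Lemma qdotN n (q : 'rV[rat]_n) z : qdot (R := R) (- q) z = - qdot q z.
Proof. by rewrite /qdot -sumrN; apply: eq_bigr => j _; rewrite mxE rmorphN mulNr. Qed.

Lemma qdotDr n (q : 'rV[rat]_n) z w : qdot (R := R) q (z + w) = qdot q z + qdot q w.
Proof. by rewrite /qdot -big_split; apply: eq_bigr => j _; rewrite mxE mulrDr. Qed.

Lemma qdot_cpt n (q : 'rV[rat]_n) x y : qdot q (cpt x y) = (rdot q x +i* rdot q y) :> C.
Proof.
rewrite /qdot /rdot; elim/big_rec3: _ => [//|j a b c _ ->].
by rewrite ratr_C mxE; apply: complexP => /=; ring.
Qed.

Lemma cpt_Re_Im n (z : 'rV[C]_n) :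
  z = cpt (map_mx (@complex.Re R) z) (map_mx (@complex.Im R) z).
Proof. by apply/rowP => j; rewrite !mxE; case: (z 0 j). Qed.

Lemma cpt_real n (x : 'rV[R]_n) : map_mx (real_complex R) x = cpt x 0.
Proof. by apply/rowP => j; rewrite !mxE. Qed.

Lemma cptD n (x y x' y' : 'rV[R]_n) : cpt (x + x') (y + y') = cpt x y + cpt x' y'.
Proof. by apply/rowP => j; rewrite !mxE. Qed.

Lemma cpt_lattice n N (m : 'rV[int]_n) (x y : 'rV[R]_n) :
  cpt (x + lattice_point R N m) y = cpt x y + latC N m.
Proof. by apply/rowP => j; rewrite !mxE; apply: complexP => /=; rewrite ?addr0. Qed.

Lemma qexpD n (q r : 'rV[rat]_n) z : qexp (q + r) z = qexp q z * qexp r z.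
Proof. by rewrite /qexp qdotD mulrDr cexpD. Qed.

Lemma qexpDr n (q : 'rV[rat]_n) z w : qexp q (z + w) = qexp q z * qexp q w.
Proof. by rewrite /qexp qdotDr mulrDr cexpD. Qed.

Lemma qexpN n (q : 'rV[rat]_n) z : qexp (- q) z = cexp (- ((0 +i* 1) * qdot q z)).
Proof. by rewrite /qexp qdotN mulrN. Qed.

Lemma qexp0 n (z : 'rV[C]_n) : qexp 0 z = 1.
Proof.
rewrite /qexp /qdot big1 => [|j _]; first by rewrite mulr0 cexp0.
by rewrite mxE rmorph0 mul0r.
Qed.

Lemma cabs_qexp n (q : 'rV[rat]_n) (x y : 'rV[R]_n) :
  cabs (qexp q (cpt x y)) = expR (- rdot q y).
Proof. by rewrite /qexp qdot_cpt cabs_cexp /=; congr expR; ring. Qed.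

Lemma cos_sin_int (k : int) : (cos (2 * pi * k%:~R) +i* sin (2 * pi * k%:~R) : C) = 1.
Proof.
have H (m : nat) : (cos (2 * pi * m%:R : R) = 1) * (sin (2 * pi * m%:R : R) = 0).
  elim: m => [|m [c s]]; first by rewrite mulr0 cos0 sin0.
  have -> : 2 * pi * m.+1%:R = 2 * pi * m%:R + pi *+ 2 :> R by rewrite -natr1 mulr2n; ring.
  by rewrite cosD2pi sinD2pi.
case: k => m; first by apply: complexP => /=; rewrite -pmulrn H.
by rewrite NegzE rmorphN /= mulrN cosN sinN -pmulrn !H oppr0.
Qed.

Lemma qexp_lattice n (q : 'rV[rat]_n) N (m : 'rV[int]_n) z :
  (forall j, exists k : int, q 0 j * N%:R = k%:~R) -> qexp q (z + latC N m) = qexp q z.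
Proof.
move=> qN; rewrite qexpDr -[RHS]mulr1; congr (_ * _).
have -> : latC N m = cpt (lattice_point R N m) 0 by apply/rowP => j; rewrite !mxE.
have [k Hk] := fin_all_exists qN.
rewrite /qexp qdot_cpt.
have -> : rdot q 0 = 0 :> R by rewrite /rdot big1 // => j _; rewrite mxE mulr0.
have -> : rdot q (lattice_point R N m) = 2 * pi * (\sum_j k j * m 0 j)%:~R.
  rewrite /rdot rmorph_sum mulr_sumr; apply: eq_bigr => j _.
  rewrite mxE rmorphM /=.
  have := congr1 (ratr : rat -> R) (Hk j); rewrite rmorphM /= ratr_nat ratr_int => <-.
  by ring.
rewrite /cexp /=.
have -> : 0 * (2 * pi * (\sum_j k j * m 0 j)%:~R) - 1 * 0 = 0 :> R by ring.
have -> : 0 * 0 + 1 * (2 * pi * (\sum_j k j * m 0 j)%:~R) = 2 * pi * (\sum_j k j * m 0 j)%:~R :> R by ring.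
by rewrite cos_sin_int expR0 mulr1.
Qed.

Lemma common_denominator n (q : 'rV[rat]_n) : exists2 N, (0 < N)%N &
  forall N', (N %| N')%N -> forall j, exists k : int, q 0 j * N'%:R = k%:~R.
Proof.
pose D j := absz (denq (q 0 j)).
have D0 j : (0 < D j)%N by rewrite absz_gt0 denq_neq0.
have DE j : (D j)%:R = (denq (q 0 j))%:~R :> rat by rewrite -(absz_denq (q 0 j)).
exists (\prod_j D j)%N => [|N' /dvdnP[c ->] j]; first exact: prodn_gt0.
have /dvdnP[d ->] : (D j %| \prod_j D j)%N by rewrite (bigD1 j) //= dvdn_mulr.
exists (numq (q 0 j) * (c * d)%N%:Z).
rewrite mulnA natrM DE -{1}(divq_num_den (q 0 j)) rmorphM /=.
by field; rewrite intr_eq0 denq_neq0.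
Qed.

End ExponentialCharacters.

(** * Complex differentials and the Euclidean norm *)

Lemma diff_of_approx (K : numFieldType) (V W : normedModType K) (f : V -> W)
  (df : {linear V -> W}) (x : V) : continuous df ->
  (forall e : K, 0 < e -> \forall h \near (0 : V), `|f (h + x) - (f x + df h)| <= e * `|h|) ->
  differentiable f x /\ 'd f x = df :> (V -> W).
Proof.
move=> cdf H.
have E : f \o shift x = cst (f x) + df +o_ (0 : V) id by apply/eqaddoP.
have dE := diff_unique cdf E.
split=> //; apply/diff_locallyP; rewrite dE; split=> //.
Qed.

Section Differentials.
Variable R : realType.
Local Notation C := (Cx R).

Lemma row_norm_le n (h : 'rV[C]_n) (D : R) : 0 <= D ->
  (`|h| <= D%:C) <-> (forall j, cabs (h 0 j) <= D).
Proof.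
move=> D0; have DC : 0 <= D%:C :> C by rewrite lecR.
have -> : (`|h| <= D%:C) = (mx_norm h <= (NngNum DC)%:num) by [].
rewrite mx_normE num_le; split.
  move/bigmax_leP => [_ H] j; have := H (0, j) isT.
  by rewrite -num_le /= cabsE lecR.
move=> H; apply/bigmax_leP; split; first by rewrite -num_le.
by move=> [i j] _; rewrite -num_le /= ord1 cabsE lecR.
Qed.

Lemma near_rowP n (z : 'rV[C]_n) (P : set 'rV[C]_n) :
  (\forall x \near z, P x) <->
  exists2 d : R, 0 < d & forall x : 'rV[C]_n, (forall j, cabs (x 0 j - z 0 j) <= d) -> P x.
Proof.
split.
  move/nbhs_ballP => [e /= /cplx_pos[d d0 ->] H].
  exists (d / 2) => [|x xz]; first by rewrite divr_gt0.
  apply: H; rewrite -ball_normE /= distrC.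
  apply: (@le_lt_trans _ _ ((d / 2)%:C : C)); last by rewrite ltcR; lra.
  by apply/row_norm_le => [|j]; [lra|rewrite !mxE].
move=> [d d0 H]; apply/nbhs_ballP; exists (d%:C : C); first by rewrite /= ltcR.
move=> x; rewrite -ball_normE /= distrC => /ltW; rewrite row_norm_le ?(ltW d0) // => xz.
by apply: H => j; have := xz j; rewrite !mxE.
Qed.

(** The sup norm of ['rV[C]_n] is complex valued; a real bound [D] on the coordinates replaces it,
    here and in the converse [differentiable_of_approx]. *)
Lemma differentiable_approx n (f : 'rV[C]_n -> C^o) z : differentiable f z ->
  forall e : R, 0 < e -> exists2 d : R, 0 < d & forall (h : 'rV[C]_n) (D : R),
    (forall j, cabs (h 0 j) <= D) -> D <= d -> 0 <= D ->
    cabs (f (z + h) - f z - 'd f z h) <= e * D.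
Proof.
move=> /diff_locallyP[_ /eqaddoP H] e e0.
have e0C : 0 < e%:C :> C by rewrite ltcR.
have /near_rowP[d d0 Hd] := H _ e0C.
exists d => // h D hD Dd D0.
have := Hd h (fun j => le_trans (_ : _ <= D) Dd).
rewrite /= !fctE /shift /= (addrC h z).
have -> : f (z + h) - (f z + 'd f z h) = f (z + h) - f z - 'd f z h by rewrite opprD addrA.
move=> H2; rewrite -lecabs; apply: le_trans (H2 _) _.
  by move=> j; rewrite mxE subr0; exact: hD.
rewrite rmorphM /=; apply: ler_wpM2l; first by rewrite lecR ltW.
by apply/row_norm_le.
Qed.

Definition lin_form n (b : 'rV[C]_n) (h : 'rV[C]_n) : C^o := \sum_j b 0 j * h 0 j.

Lemma lin_form_is_linear n (b : 'rV[C]_n) : linear (lin_form b).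
Proof.
move=> c x y; rewrite /lin_form scaler_sumr -big_split; apply: eq_bigr => j _ /=.
by rewrite !mxE mulrDr mulrCA.
Qed.

HB.instance Definition _ n (b : 'rV[C]_n) :=
  GRing.isLinear.Build C 'rV[C]_n C^o _ (lin_form b) (@lin_form_is_linear n b).

Lemma cabs_lin_form n (b h : 'rV[C]_n) (D : R) : (forall j, cabs (h 0 j) <= D) ->
  cabs (lin_form b h) <= (\sum_j cabs (b 0 j)) * D.
Proof.
move=> hD; apply: le_trans (cabs_sum _ _ _) _; rewrite mulr_suml.
by apply: ler_sum => j _; rewrite cabsM ler_wpM2l ?cabs_ge0.
Qed.

Lemma differentiable_of_approx n (f : 'rV[C]_n -> C^o) z (b : 'rV[C]_n) :
  (forall e : R, 0 < e -> exists2 d : R, 0 < d & forall (h : 'rV[C]_n) (D : R),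
    (forall j, cabs (h 0 j) <= D) -> D <= d -> 0 <= D ->
    cabs (f (z + h) - f z - lin_form b h) <= e * D) ->
  differentiable f z /\ 'd f z = lin_form b :> ('rV[C]_n -> C^o).
Proof.
move=> H.
have cb : continuous (lin_form b).
  move=> x; apply: (@cvgC_cabs R _ (nbhs x) (nbhs_filter x) (lin_form b) (lin_form b x)).1 => d d0.
  pose B := \sum_j cabs (b 0 j); have B0 : 0 <= B by apply: sumr_ge0 => j _; exact: cabs_ge0.
  apply/near_rowP; exists (d / (B + 1)) => [|y yx]; first by rewrite divr_gt0 //; lra.
  rewrite -linearB /=.
  apply: le_trans (@cabs_lin_form _ _ _ (d / (B + 1)) _) _.
    by move=> j; have := yx j; rewrite !mxE.
  rewrite -/B mulrCA ler_piMr ?(ltW d0) // ler_pdivrMr; lra.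
apply: (@diff_of_approx C 'rV[C]_n C^o f (lin_form b) z cb) => e /cplx_pos[d d0 ->].
have [r r0 Hr] := H d d0.
apply/near_rowP; exists r => // h hr.
rewrite (addrC h z).
have -> : f (z + h) - (f z + lin_form b h) = f (z + h) - f z - lin_form b h.
  by rewrite opprD addrA.
pose D := complex.Re `|h|.
have hn : `|h| = D%:C.
  have : (0 : C) <= `|h| by [].
  by rewrite /D; case: (`|h|) => u u'; rewrite lecE /= => /andP[/eqP -> _].
have D0 : 0 <= D by have : (0 : C) <= `|h| by []; rewrite hn lecR.
have hD : forall j, cabs (h 0 j) <= D by apply/row_norm_le => //; rewrite hn.
have Dr : D <= r.
  have : `|h| <= r%:C by apply/row_norm_le => [|j]; [exact: ltW|have := hr j; rewrite mxE subr0].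
  by rewrite hn lecR.
rewrite hn -rmorphM lecabs; exact: Hr.
Qed.

End Differentials.

Section EuclideanNorm.
Variable R : realType.
Implicit Types n : nat.

Lemma enorm_ge0 n (x : 'rV[R]_n) : 0 <= enorm x.
Proof. exact: sqrtr_ge0. Qed.

Lemma enorm_sqr n (x : 'rV[R]_n) : enorm x ^+ 2 = \sum_j x 0 j ^+ 2.
Proof. by rewrite sqr_sqrtr // sumr_ge0 // => j _; exact: sqr_ge0. Qed.

Lemma enorm_le n (x y : 'rV[R]_n) : (forall j, `|x 0 j| <= `|y 0 j|) -> enorm x <= enorm y.
Proof.
move=> xy; rewrite ler_wsqrtr // ler_sum // => j _.
by rewrite -[leLHS]real_normK ?num_real // -[leRHS]real_normK ?num_real // ler_sqr ?nnegrE.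
Qed.

Lemma coord_le_enorm n (x : 'rV[R]_n) j : `|x 0 j| <= enorm x.
Proof.
rewrite -ler_sqr ?nnegrE ?enorm_ge0 // enorm_sqr real_normK ?num_real //.
by rewrite (bigD1 j) //= lerDl sumr_ge0 // => k _; exact: sqr_ge0.
Qed.

Lemma enormZ n (c : R) (x : 'rV[R]_n) : enorm (c *: x) = `|c| * enorm x.
Proof.
apply/eqP; rewrite -(eqrXn2 (_ : (0 < 2)%N)) ?enorm_ge0 ?mulr_ge0 ?enorm_ge0 //.
rewrite exprMn !enorm_sqr real_normK ?num_real // mulr_sumr; apply/eqP.
by apply: eq_bigr => j _; rewrite mxE exprMn.
Qed.

(** The sum of the squares of |y|^2 x_j - (x.y) y_j expands to |y|^2 (|x|^2 |y|^2 - (x.y)^2); the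
    case y = 0 is treated apart. *)
Lemma cauchy_schwarz n (x y : 'rV[R]_n) : `|\sum_j x 0 j * y 0 j| <= enorm x * enorm y.
Proof.
set A := enorm x; set B := enorm y; set S := \sum_j _.
have A0 : 0 <= A by exact: enorm_ge0.
have B0 : 0 <= B by exact: enorm_ge0.
have H : 0 <= \sum_j (B ^+ 2 * x 0 j - S * y 0 j) ^+ 2.
  by apply: sumr_ge0 => j _; exact: sqr_ge0.
have E : \sum_j (B ^+ 2 * x 0 j - S * y 0 j) ^+ 2 = B ^+ 2 * ((A * B) ^+ 2 - S ^+ 2).
  transitivity (\sum_j (B ^+ 4 * x 0 j ^+ 2 - 2 * B ^+ 2 * S * (x 0 j * y 0 j) + S ^+ 2 * y 0 j ^+ 2)).
    by apply: eq_bigr => j _; ring.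
  rewrite big_split sumrB -!mulr_sumr /= -!enorm_sqr -/A -/B -/S; ring.
rewrite E in H.
rewrite -ler_sqr ?nnegrE ?mulr_ge0 // real_normK ?num_real //.
have [B00|B00] := eqVneq B 0; last first.
  by move: H; rewrite pmulr_rge0 ?exprn_gt0 ?lt0r ?B00 // subr_ge0.
have y0 j : y 0 j = 0.
  by have := coord_le_enorm y j; rewrite -/B B00 normr_le0 => /eqP.
have -> : S = 0 by rewrite /S big1 // => j _; rewrite y0 mulr0.
by rewrite expr0n sqr_ge0.
Qed.

Lemma rdot_le n (q : 'rV[rat]_n) (x : 'rV[R]_n) :
  `|rdot q x| <= enorm (map_mx (ratr : rat -> R) q) * enorm x.
Proof.
have := cauchy_schwarz (map_mx ratr q) x.
by under eq_bigr do rewrite mxE.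
Qed.

End EuclideanNorm.

(** * Real slices and displacement of the contour *)

Section Slices.
Variable R : realType.
Local Notation C := (Cx R).

(** Compactness gives a modulus of continuity at the points of one period cube, and near periodicity
    carries it to all of R^n at the cost of two more errors e/3. *)
Lemma near_periodic_unif_cont n (F : 'rV[R]_n -> C) :
  (forall (x : 'rV[R]_n) (e : R), 0 < e -> exists2 d : R, 0 < d &
     forall x' : 'rV[R]_n, (forall j, `|x' 0 j - x 0 j| <= d) -> cabs (F x' - F x) <= e) ->
  near_periodic F -> cunif_cont F.
Proof.
move=> cF pF e e0.
have [N N0 HN] := pF (e / 3) ltac:(lra).
pose w : R := 2 * pi * N%:R.
have w0 : 0 < w by rewrite !mulr_gt0 ?pi_gt0 ?ltr0n.
pose K := [set v : 'rV[R]_n | forall j, `[0, w]%classic (v ord0 j)].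
have cK : compact K by apply: (@rV_compact R n (fun=> `[0, w]%classic)) => j; exact: segment_compact.
(* Only x will be confined to the cube: its neighbour y is arbitrary and may lie outside. *)
pose P (d : R) (x : 'rV[R]_n) := forall y : 'rV[R]_n, (forall j, `|x 0 j - y 0 j| <= d) ->
  cabs (F x - F y) <= e / 3.
have HK : \forall d \near (0 : R)^'+, K `<=` P d.
  move/compact_near_coveringP : cK; apply => x _.
  have [d d0 Hd] := cF x (e / 6) ltac:(lra).
  exists ([set x' : 'rV[R]_n | forall j, `|x' 0 j - x 0 j| <= d / 2], [set t | t <= d / 2]).
    split => /=.
      apply/nbhs_ballP; exists (d / 2) => /=; first lra.
      move=> y; rewrite -ball_normE /= => xy j.
      have := le_trans (_ : `|y 0 j - x 0 j| <= `|x - y|) (ltW xy); apply.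
      rewrite distrC; have -> : `|x - y| = mx_norm (x - y) by [].
      rewrite mx_normrE; apply: le_trans (le_bigmax _ _ (0, j)) => /=.
      by rewrite !mxE.
    by apply: nbhs_right_le; lra.
  move=> [x' t] /= [x'x td] y x'y.
  have h1 := Hd x' (fun j => le_trans (x'x j) (_ : d / 2 <= d)).
  have {}h1 : cabs (F x' - F x) <= e / 6 by apply: h1; lra.
  have h2 : cabs (F y - F x) <= e / 6.
    apply: Hd => j; have := x'y j; have := x'x j.
    rewrite (distrC (x' 0 j) (y 0 j)) => a b.
    by have := ler_distD (x' 0 j) (y 0 j) (x 0 j); lra.
  have := cabs_distD (F x) (F x') (F y); rewrite (cabsC (F x) (F y)); lra.
have [d [Hd d0]] : exists d, (K `<=` P d) /\ 0 < d.
  near ((0 : R)^'+) => d; exists d; split; near: d => //.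
  exact: nbhs_right_gt.
exists d => // x y xy.
pose m : 'rV[int]_n := \row_j (- Num.floor (x 0 j / w)).
pose l := lattice_point R N m.
have xK : K (x + l).
  move=> j; rewrite /= in_itv /= !mxE -/w rmorphN /=.
  have := floor_itv (x 0 j / w) => /andP[].
  rewrite ler_pdivlMr // ltr_pdivrMr // intrD => h1 h2.
  by apply/andP; split; nra.
have h : cabs (F (x + l) - F (y + l)) <= e / 3.
  apply: Hd xK _ _ => j; rewrite !mxE.
  by apply: le_trans (xy j); rewrite (_ : _ - _ = x 0 j - y 0 j) //; ring.
have := HN m x; have := HN m y; rewrite -/l => hy hx.
have := cabs_distD (F (x + l)) (F x) (F y).
have := cabs_distD (F (y + l)) (F (x + l)) (F y).
rewrite (cabsC (F x) (F (x + l))); lra.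
Unshelve. all: by end_near. Qed.

End Slices.

Section ContourShift.
Variable R : realType.
Local Notation C := (Cx R).

Lemma snorm_ub n (rho : R) (f : 'rV[C]_n -> C^o) z : strip rho z ->
  ((cabs (f z))%:E <= snorm rho f)%E.
Proof. by move=> sz; apply: ereal_sup_ubound; exists z. Qed.

Lemma snorm_fin_bound n (rho : R) (f : 'rV[C]_n -> C^o) : (snorm rho f < +oo)%E ->
  forall z, strip rho z -> cabs (f z) <= fine (snorm rho f).
Proof.
move=> fin z sz; have H := snorm_ub f sz.
rewrite -lee_fin fineK // fin_real // fin andbT.
by apply: lt_le_trans H; rewrite ltNyr.
Qed.

Lemma strip_cpt n (rho : R) (x y : 'rV[R]_n) : strip rho (cpt x y) <-> enorm y < rho.
Proof.
rewrite /strip /= (_ : map_mx _ _ = y) //.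
by apply/rowP => j; rewrite !mxE.
Qed.

Lemma cpt_scale_real n (x y : 'rV[R]_n) (t : R) j :
  cpt x y + t%:C *: delta_mx 0 j = cpt (x + t *: delta_mx 0 j) y.
Proof.
apply/rowP => k; rewrite !mxE; apply: complexP => /=; case: (k == j) => //=;
  rewrite ?mulr1 ?mulr0 ?addr0 //=; ring.
Qed.

Lemma cpt_scale_im n (x y : 'rV[R]_n) (t : R) j :
  cpt x y + ((0 +i* 1) * t%:C) *: delta_mx 0 j = cpt x (y + t *: delta_mx 0 j).
Proof.
apply/rowP => k; rewrite !mxE; apply: complexP => /=; case: (k == j) => //=;
  rewrite ?mulr1 ?mulr0 ?addr0 //=; ring.
Qed.

Lemma latCM n N k (m : 'rV[int]_n) :
  latC R (N * k) m = latC R N (\row_j (k%:Z * m 0 j)).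
Proof.
by apply/rowP => j; rewrite !mxE; congr (_%:C); rewrite natrM rmorphM /=; ring.
Qed.

Lemma strip_latC n (rho : R) (z : 'rV[C]_n) N m : strip rho z -> strip rho (z + latC R N m).
Proof.
rewrite /strip /= (_ : map_mx _ (z + _) = map_mx (@complex.Im R) z) //.
by apply/rowP => j; rewrite !mxE ImD /= addr0.
Qed.

Lemma apf_qexp n (q : 'rV[rat]_n) (y : 'rV[R]_n) : apf (fun x => qexp q (cpt x y)).
Proof.
set K := expR (- rdot q y); have K0 : 0 < K by exact: expR_gt0.
pose A : R := \sum_j `|ratr (q 0 j)|; have A0 : 0 <= A by apply: sumr_ge0.
split.
- by exists K => x; rewrite cabs_qexp.
- move=> e e0; exists (e / (K * (A + 1))) => [|x x' xx'].
    by rewrite divr_gt0 // mulr_gt0 //; lra.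
  have -> : cpt x y = cpt x' y + cpt (x - x') 0.
    by rewrite -cptD addrCA subrr !addr0.
  have -> : qexp q (cpt x' y + cpt (x - x') 0) - qexp q (cpt x' y) =
     qexp q (cpt x' y) * (qexp q (cpt (x - x') 0) - 1) by rewrite qexpDr; ring.
  rewrite cabsM cabs_qexp -/K /qexp qdot_cpt.
  have -> : rdot q 0 = 0 :> R by rewrite /rdot big1 // => j _; rewrite mxE mulr0.
  have -> : cexp ((0 +i* 1 : C) * (rdot q (x - x') +i* 0)) =
    (cos (rdot q (x - x')) +i* sin (rdot q (x - x')) : C).
    rewrite /cexp /= !mul0r !mul1r subr0 expR0 add0r; exact: mul1r.
  have h : `|rdot q (x - x')| <= A * (e / (K * (A + 1))).
    rewrite /rdot /A mulr_suml; apply: le_trans (ler_norm_sum _ _ _) _.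
    by apply: ler_sum => j _; rewrite normrM ler_wpM2l // !mxE; exact: xx'.
  apply: le_trans (ler_wpM2l (ltW K0) (le_trans (cabs_cis_sub1 _) h)) _.
  have -> : K * (A * (e / (K * (A + 1)))) = e * (A / (A + 1)) by field; lra.
  by rewrite ler_piMr ?(ltW e0) // ler_pdivrMr; lra.
- move=> e e0; have [N N0 HN] := common_denominator q.
  exists N => // m x; rewrite cpt_lattice qexp_lattice ?subrr ?cabs0 ?(ltW e0) //.
  exact: HN.
Qed.

Section Holomorphic.
Variables (n : nat) (rho : R) (g : 'rV[C]_n -> C^o).
Hypothesis gCQ : CQ rho g.

(** The integrand of the coefficient g_q, extended holomorphically to the strip so that the slice
    can be moved. *)
Definition twist (q : 'rV[rat]_n) (z : 'rV[C]_n) : C := g z * qexp (- q) z.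

(** Holomorphy gives continuity at each point of the slice, through the first-order expansion; near
    periodicity upgrades it to uniform continuity. *)
Lemma apf_slice (y : 'rV[R]_n) : enorm y < rho -> apf (fun x => g (cpt x y)).
Proof.
case: gCQ => hg bg lp yr.
have np : near_periodic (fun x => (g (cpt x y) : C)).
  move=> e e0; have [N N0 HN] := lp e e0; exists N => // m x.
  by rewrite cpt_lattice ltW // HN //; apply/strip_cpt.
split=> //; first by exists (fine (snorm rho g)) => x; apply: snorm_fin_bound => //; apply/strip_cpt.
apply: near_periodic_unif_cont => // x e e0.
have sx : strip rho (cpt x y) by apply/strip_cpt.
have [d d0 Hd] := differentiable_approx (hg _ sx) ltr01.
pose b : R := \sum_j cabs ('d g (cpt x y) (delta_mx 0 j) : C).
have b0 : 0 <= b by apply: sumr_ge0 => j _; exact: cabs_ge0.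
exists (Num.min d (e / (b + 1))) => [|x' x'x].
  by rewrite lt_min d0 divr_gt0 //; lra.
set D := Num.min _ _ in x'x.
have D0 : 0 <= D by rewrite le_min (ltW d0) divr_ge0 // ?(ltW e0) //; lra.
have Dd : D <= d by rewrite ge_min lexx.
have De : D * (b + 1) <= e by rewrite -ler_pdivlMr; [rewrite ge_min lexx orbT|lra].
pose h := cpt (x' - x) 0.
have hD j : cabs (h 0 j) <= D by rewrite !mxE cabs_real.
have := Hd h D hD Dd D0; have -> : cpt x y + h = cpt x' y.
  by rewrite -cptD addr0 addrCA subrr addr0.
move=> H1.
have H2 : cabs ('d g (cpt x y) h : C) <= b * D.
  have -> : 'd g (cpt x y) h = \sum_j h 0 j *: 'd g (cpt x y) (delta_mx 0 j).
    by rewrite {1}(row_sum_delta h) linear_sum; apply: eq_bigr => j _; rewrite linearZ.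
  apply: le_trans (cabs_sum _ _ _) _; rewrite /b mulr_suml; apply: ler_sum => j _.
  by rewrite cabsM mulrC ler_wpM2l ?cabs_ge0.
have := cabsD (g (cpt x' y) - g (cpt x y) - 'd g (cpt x y) h) ('d g (cpt x y) h).
rewrite subrK; lra.
Qed.

Lemma apf_twist q (y : 'rV[R]_n) : enorm y < rho -> apf (fun x => twist q (cpt x y)).
Proof. by move=> yr; apply: apfM; [exact: apf_slice|exact: apf_qexp]. Qed.

Lemma twist_near_periodic q (e : R) : 0 < e -> exists2 N, (0 < N)%N &
  forall m z, strip rho z -> cabs (twist q (z + latC R N m) - twist q z) <= e.
Proof.
case: gCQ => _ _ lp e0.
pose K := expR (enorm (map_mx (ratr : rat -> R) (- q)) * rho).
have K0 : 0 < K by exact: expR_gt0.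
have [N1 N10 H1] := lp _ (divr_gt0 e0 K0).
have [N2 N20 H2] := common_denominator (- q).
exists (N1 * N2)%N => [|m z sz]; first by rewrite muln_gt0 N10.
rewrite /twist qexp_lattice; last by apply: H2; rewrite dvdn_mull.
rewrite -mulrBl cabsM.
have -> : e = e / K * K by rewrite divfK // lt0r_neq0.
apply: ler_pM; rewrite ?cabs_ge0 //.
  by rewrite latCM ltW // H1.
rewrite (cpt_Re_Im z) cabs_qexp ler_expR.
apply: le_trans (ler_norm _) _; rewrite normrN; apply: le_trans (rdot_le _ _) _.
by rewrite ler_wpM2l ?enorm_ge0 // ltW.
Qed.

Lemma cdiff_twist q (z : 'rV[C]_n) j (p : C) : strip rho (z + p *: delta_mx 0 j) ->
  cdiff (fun u => twist q (z + u *: delta_mx 0 j)) p.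
Proof.
move=> sp; apply: cdiffM.
  case: gCQ => hg _ _; exists ('d g (z + p *: delta_mx 0 j) (delta_mx 0 j)) => e e0.
  have [d d0 Hd] := differentiable_approx (hg _ sp) e0.
  exists d => // u ud.
  have := Hd ((u - p) *: delta_mx 0 j) (cabs (u - p)) _ ud (cabs_ge0 _).
  have -> : z + p *: delta_mx 0 j + (u - p) *: delta_mx 0 j = z + u *: delta_mx 0 j.
    by rewrite -addrA -scalerDl (addrC p) subrK.
  rewrite linearZ /= => H.
  have -> : 'd g (z + p *: delta_mx 0 j) (delta_mx 0 j) * (u - p) =
     (u - p) *: 'd g (z + p *: delta_mx 0 j) (delta_mx 0 j) by rewrite mulrC.
  apply: H => k; rewrite !mxE cabsM ler_piMr ?cabs_ge0 //.
  by case: (_ && _); rewrite ?cabs1 ?cabs0.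
have -> : (fun u => qexp (- q) (z + u *: delta_mx 0 j)) =
  (fun u => cexp ((0 +i* 1) * qdot (- q) z + ((0 +i* 1) * qdot (- q) (delta_mx 0 j)) * u)).
  apply/funext => u; rewrite /qexp qdotDr mulrDr; congr (cexp (_ + _)).
  rewrite -mulrA; congr (_ * _); rewrite /qdot mulr_suml; apply: eq_bigr => k _.
  by rewrite !mxE; ring.
exact: cdiff_cexp.
Qed.

End Holomorphic.

Lemma seg_avg_diff m (F : C -> C) w a a' (e : R) :
  (forall s : R, 0 <= s <= 1 -> cabs (F (a + w * s%:C) - F (a' + w * s%:C)) <= e) ->
  cabs (seg_avg m F w a - seg_avg m F w a') <= e.
Proof.
move=> H; have -> : seg_avg m F w a - seg_avg m F w a' =
    seg_avg m (fun u => F (a + u) - F (a' + u)) w 0.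
  rewrite /seg_avg -mulrBr -sumrB; congr (_ * _); apply: eq_bigr => j _.
  by rewrite add0r.
by apply: seg_avg_le => s s1; rewrite add0r; exact: H.
Qed.

End ContourShift.

Section CoefficientShift.
Variable R : realType.
Local Notation C := (Cx R).
Variables (n : nat) (rho : R) (g : 'rV[C]_n -> C^o).
Hypothesis gCQ : CQ rho g.

(** A grid for [F] serves its averages over 2^m translates for every m, so in [mean_twist_shift1]
    the grid can be fixed before m is known. *)
Lemma fine_grid_seg_avg (F : 'rV[R]_n -> C) (p : nat -> 'rV[R]_n) (e : R) N M m :
  fine_grid F e N M ->
  fine_grid (fun x => (2 ^+ m)^-1 * \sum_(k < 2 ^ m) F (x + p k)) e N M.
Proof.
case=> N0 M0 Fp Fu.
have avg (u v : 'I_(2 ^ m) -> C) : (forall k, cabs (u k - v k) <= e) ->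
    cabs ((2 ^+ m)^-1 * \sum_(k < 2 ^ m) u k - (2 ^+ m)^-1 * \sum_(k < 2 ^ m) v k) <= e.
  move=> uv; rewrite -mulrBr -sumrB cabsM cabsV -natrX cabs_nat.
  rewrite mulrC ler_pdivrMr ?ltr0n ?expn_gt0 //.
  apply: le_trans (cabs_sum _ _ _) _.
  apply: le_trans (ler_sum _ (fun k _ => uv k)) _.
  by rewrite sumr_const card_ord -[e *+ _]mulr_natr.
split=> // [x l|x y xy]; apply: avg => k.
  by rewrite addrAC.
apply: Fu => j; rewrite !mxE.
by apply: le_trans (xy j); rewrite (_ : _ - _ = x 0 j - y 0 j) //; ring.
Qed.

(** Cauchy's theorem on a rectangle in the j-th complex coordinate, of width an almost period w and
    height t. Averaging the difference of the two slices over 2^m translates along the width leaves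
    its mean unchanged. Multiplied by w, this average is the horizontal part of a circuit; the
    circuit is small by [goursat], and the vertical sides nearly cancel because they differ by the
    translation w. *)
Lemma mean_twist_shift1 q (y : 'rV[R]_n) j (t : R) :
  (forall s : R, 0 <= s <= 1 -> enorm (y + (s * t) *: delta_mx 0 j) < rho) ->
  mean (fun x => twist g q (cpt x y)) =
  mean (fun x => twist g q (cpt x (y + t *: delta_mx 0 j))).
Proof.
move=> ys; set y' := y + _.
have yr : enorm y < rho by have := ys 0; rewrite mul0r scale0r addr0; apply; rewrite lexx ler01.
have yr' : enorm y' < rho by have := ys 1; rewrite mul1r; apply; rewrite lexx ler01.
pose F x := twist g q (cpt x y) - twist g q (cpt x y').
have a1 := apf_twist gCQ q yr; have a2 := apf_twist gCQ q yr'.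
have aF : apf F by exact: apfB.
apply/eqP; rewrite -subr_eq0 -meanB // -/F; apply/eqP.
(* 7 e from [mean_grid] applied to [Q m], and (1 + |t|) e from the bound [small] on its values. *)
apply: (@cabs_le0_eq _ _ (8 + `|t|)) => [|e e0]; first by have := normr_ge0 t; lra.
have [N N0 HN] := twist_near_periodic gCQ q e0.
pose w : R := 2 * pi * N%:R.
(* Allows the factor w to be dropped from the bound on w |Q m x|. *)
have w1 : 1 <= w.
  have p2 := pi_ge2 R.
  have : 1 <= (N%:R : R) by rewrite ler1n.
  by rewrite /w; nra.
pose v : C := (0 +i* 1) * t%:C.
pose P x u := twist g q (cpt x y + u *: delta_mx 0 j).
pose sh m (k : nat) : 'rV[R]_n := (w * (k%:R / 2 ^+ m)) *: delta_mx 0 j.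
pose Q m (x : 'rV[R]_n) := (2 ^+ m)^-1 * \sum_(k < 2 ^ m) F (x + sh m k).
have natC (m k : nat) : (k%:R / 2 ^+ m : C) = (k%:R / 2 ^+ m : R)%:C.
  by rewrite rmorphM fmorphV rmorphXn /= !rmorph_nat.
have QE m x : Q m x = seg_avg m (P x) w%:C 0 - seg_avg m (P x) w%:C v.
  rewrite /Q /seg_avg -mulrBr -sumrB; congr (_ * _); apply: eq_bigr => k _.
  rewrite /F /P natC -rmorphM add0r cpt_scale_real; congr (_ - twist _ _ _).
  by rewrite scalerDl addrA cpt_scale_im cpt_scale_real.
have meanQ m : mean (Q m) = mean F.
  rewrite /Q meanZ; last by apply: apf_sum => k; exact: apf_shift.
  rewrite mean_sum; last by move=> k; exact: apf_shift.
  rewrite (eq_bigr (fun=> mean F)) => [|k _]; last exact: mean_shift.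
  by rewrite sumr_const card_ord -[mean F *+ _]mulr_natl natrX mulKf.
have vE (r : R) : v * r%:C = (0 +i* 1) * (t * r)%:C by rewrite rmorphM mulrA.
have small x : exists m0, forall m, (m0 <= m)%N -> cabs (Q m x) <= (1 + `|t|) * e.
  have dP (s r : R) : 0 <= s <= 1 -> 0 <= r <= 1 -> cdiff (P x) (0 + w%:C * s%:C + v * r%:C).
    move=> _ r1; apply: (cdiff_twist gCQ).
    rewrite add0r scalerDl addrA vE -(rmorphM (real_complex R) w s) cpt_scale_real cpt_scale_im.
    by apply/strip_cpt; rewrite (mulrC t); exact: ys.
  have [m0 Hm] := goursat dP e0; exists m0 => m /Hm Hc.
  have cE : circuit m (P x) w%:C v 0 =
      w%:C * Q m x + v * (seg_avg m (P x) v w%:C - seg_avg m (P x) v 0).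
    by rewrite QE /circuit (add0r v) (add0r w%:C).
  rewrite cE in Hc.
  have per : cabs (seg_avg m (P x) v w%:C - seg_avg m (P x) v 0) <= e.
    apply: seg_avg_diff => s s1; rewrite add0r /P (addrC w%:C) vE scalerDl addrA.
    rewrite cpt_scale_im cpt_scale_real.
    have -> : x + w *: delta_mx 0 j = x + lattice_point R N (delta_mx 0 j).
      by apply/rowP => k; rewrite !mxE /w; case: (_ && _).
    rewrite cpt_lattice; apply: HN; apply/strip_cpt.
    by rewrite (mulrC t); exact: ys.
  have h1 : w * cabs (Q m x) <= e + `|t| * e.
    have <- : cabs (w%:C * Q m x) = w * cabs (Q m x).
      by rewrite cabsM cabs_real ger0_norm //; lra.
    set c := w%:C * Q m x in Hc *; set d := v * _ in Hc.
    have -> : c = (c + d) - d by ring.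
    apply: le_trans (cabsB _ _) _; apply: lerD => //.
    rewrite /d cabsM; apply: ler_pM; rewrite ?cabs_ge0 //.
    by rewrite /v cabsM cabs_i mul1r cabs_real.
  rewrite mulrDl mul1r; apply: le_trans h1.
  by rewrite ler_peMl ?cabs_ge0.
have [N' N'0 HN'] := fine_grid_exists aF e0.
have [M HM] := HN' N' (dvdnn _) N'0.
have fg := HM M (leqnn _).
(* The threshold for m depends on the point, but only the finitely many grid points matter, so a
   maximum can be taken. *)
have [m0 Hm0] := fin_all_exists (fun a : {ffun 'I_n -> 'I_M} => small (0 + grid_point R N' a)).
pose m := (\max_a m0 a)%N.
have fgQ : fine_grid (Q m) e N' M by exact: fine_grid_seg_avg.
have aQ : apf (Q m) by apply: apfZ; apply: apf_sum => k; exact: apf_shift.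
have h1 := mean_grid aQ e0 fgQ.
have h2 : cabs (grid_avg (Q m) N' M 0) <= (1 + `|t|) * e.
  rewrite -lecabs; apply: grid_avg_le => [a|]; last by case: fg.
  by rewrite lecabs; apply: Hm0; exact: leq_bigmax.
rewrite -(meanQ m); have := cabsD (mean (Q m) - grid_avg (Q m) N' M 0) (grid_avg (Q m) N' M 0).
rewrite subrK; lra.
Qed.

(** The coordinates of y are switched on one at a time. Every intermediate point is dominated by y
    coordinate by coordinate, hence stays in the ball of radius rho. *)
Lemma mean_twist_shift q (y : 'rV[R]_n) : enorm y < rho ->
  mean (fun x => twist g q (cpt x 0)) = mean (fun x => twist g q (cpt x y)).
Proof.
move=> yr.
pose z k : 'rV[R]_n := \row_j (if (j < k)%N then y 0 j else 0).
have H k : (k <= n)%N -> mean (fun x => twist g q (cpt x 0)) = mean (fun x => twist g q (cpt x (z k))).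
  elim: k => [_|k IH kn].
    by congr mean; apply/funext => x; congr (twist _ _ (cpt _ _)); apply/rowP => j; rewrite !mxE.
  rewrite (IH (ltnW kn)); pose j := Ordinal kn.
  have zS : z k.+1 = z k + y 0 j *: delta_mx 0 j.
    apply/rowP => l; rewrite !mxE eqxx andTb ltnS leq_eqVlt.
    have -> : (l == j) = (nat_of_ord l == k) by [].
    case: eqP => [lk|_] /=; last by rewrite mulr0 addr0.
    by rewrite lk ltnn add0r mulr1; congr (y _ _); exact/val_inj.
  rewrite zS; apply: mean_twist_shift1 => s s1; apply: le_lt_trans yr; apply: enorm_le => l.
  rewrite !mxE eqxx andTb.
  have -> : (l == j) = (nat_of_ord l == k) by [].
  case: eqP => [lk|_] /=; last by rewrite mulr0 addr0; case: ifP => // _; rewrite normr0.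
  rewrite lk ltnn add0r mulr1 normrM (_ : l = j); last exact/val_inj.
  move: s1 => /andP[s0 s1]; rewrite (ger0_norm s0); exact: ler_piMl.
rewrite (H n (leqnn n)); congr mean; apply/funext => x; congr (twist _ _ (cpt _ _)).
by apply/rowP => j; rewrite !mxE ltn_ord.
Qed.

Lemma pcoef_mean q (y : 'rV[R]_n) : enorm y < rho ->
  pcoef g q = mean (fun x => twist g q (cpt x y)).
Proof.
move=> yr; rewrite -mean_twist_shift // /pcoef /mean /cavg.
have -> : (fun x : 'rV[R]_n => twist g q (cpt x 0)) =
  (fun x => g (map_mx (real_complex R) x) * cexp (- ((0 +i* 1) * qdot q (map_mx (real_complex R) x)))).
  by apply/funext => x; rewrite /twist cpt_real qexpN.
by [].
Qed.

End CoefficientShift.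

(** * Uniqueness of Fourier-Bohr coefficients *)

Section Uniqueness.
Variable R : realType.
Local Notation C := (Cx R).

(** For q nonzero, translating by s with q.s = pi multiplies the character by -1 while preserving
    the mean. *)
Lemma mean_qexp n (q : 'rV[rat]_n) :
  mean (fun x : 'rV[R]_n => qexp q (cpt x 0)) = (q == 0)%:R.
Proof.
have [->|q0] := eqVneq q 0.
  by under eq_fun do rewrite qexp0; rewrite mean_cst.
have [j qj] : exists j, q 0 j != 0.
  apply: contrapT => H; case/eqP: q0; apply/rowP => j; rewrite mxE.
  by apply/eqP/negPn/negP => qj; apply: H; exists j.
pose s : 'rV[R]_n := \row_k (if k == j then pi / ratr (q 0 j) else 0).
have qs : qexp q (cpt s 0) = -1 :> C.
  rewrite /qexp qdot_cpt.
  have -> : rdot q s = pi.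
    rewrite /rdot (bigD1 j) //= big1 ?addr0 => [|k kj]; last by rewrite mxE (negPf kj) mulr0.
    by rewrite mxE eqxx mulrC divfK // fmorph_eq0.
  have -> : rdot q 0 = 0 :> R by rewrite /rdot big1 // => k _; rewrite mxE mulr0.
  by rewrite /cexp /= !mul0r !mul1r subr0 add0r expR0 cospi sinpi; apply: complexP => /=; ring.
have := mean_shift s (apf_qexp q 0).
have -> : (fun x : 'rV[R]_n => qexp q (cpt (x + s) 0)) = (fun x => (-1) * qexp q (cpt x 0)).
  by apply/funext => x; rewrite -{1}[0]addr0 cptD qexpDr qs mulrC.
rewrite meanZ; last exact: apf_qexp.
move: (mean _) => c; rewrite mulN1r => /eqP.
by rewrite -subr_eq0 -opprD oppr_eq0 -mulr2n mulrn_eq0 /= => /eqP.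
Qed.

Lemma cosD2pi_int (t : R) (k : int) : cos (t + 2 * pi * k%:~R) = cos t.
Proof.
have /(congr1 (fun z : C => (complex.Re z, complex.Im z))) := cos_sin_int R k.
by case => h1 h2; rewrite cosD h1 h2 mulr1 mulr0 subr0.
Qed.

(** Korovkin's test-function bound. If every x_j / N is within t0 of 2 pi Z, then x is close to a
    lattice point and u(x) is within 2 e of u(0). Otherwise some 1 - cos (x_j / N) is at least a
    constant c > 0, and a large multiple of it beats twice the sup bound of u. *)
Lemma apf_korovkin n (u : 'rV[R]_n -> C) (e : R) : apf u -> 0 < e ->
  exists2 N, (0 < N)%N & exists2 B : R, 0 <= B &
    forall x : 'rV[R]_n, cabs (u 0 - u x) <= 2 * e + B * \sum_j (1 - cos (x 0 j / N%:R)).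
Proof.
move=> [/bounded_pos[B B0 uB] uu up] e0.
have [N N0 HN] := up e e0; have [d d0 Hd] := uu e e0.
have Nr : 0 < (N%:R : R) by rewrite ltr0n.
(* The cap 1 <= pi keeps [t0] in the interval where cos decreases. *)
pose t0 := Num.min (d / N%:R) 1.
have t00 : 0 < t0 by rewrite lt_min divr_gt0 //= ltr01.
have pi2 := pi_ge2 R.
have t0pi : t0 <= pi by rewrite ge_min; apply/orP; right; lra.
pose c := 1 - cos t0.
have c0 : 0 < c.
  rewrite subr_gt0 -cos0 ltr_cos // in_itv /= ?lexx /=; last by rewrite ltW.
  lra.
exists N => //; exists (2 * B / c) => [|x]; first by rewrite divr_ge0 ?mulr_ge0 ?ltW.
have pos j : 0 <= 1 - cos (x 0 j / N%:R) by rewrite subr_ge0 cos_le1.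
have Bc : 0 <= 2 * B / c by rewrite divr_ge0 ?mulr_ge0 ?ltW.
(* The half added before [floor] selects the nearest multiple of 2 pi N, which gives |t j| <= pi. *)
pose m : 'rV[int]_n := \row_j Num.floor (x 0 j / (2 * pi * N%:R) + 2^-1).
pose t j : R := x 0 j / N%:R - 2 * pi * (m 0 j)%:~R.
have tpi j : `|t j| <= pi.
  have := floor_itv (x 0 j / (2 * pi * N%:R) + 2^-1) => /andP[].
  have mE : Num.floor (x 0 j / (2 * pi * N%:R) + 2^-1) = m 0 j by rewrite mxE.
  rewrite mE; have -> : x 0 j / (2 * pi * N%:R) + 2^-1 = (t j + 2 * pi * (m 0 j)%:~R + pi) / (2 * pi).
    rewrite /t; have := pi_gt0 R; move: pi => p p0.
    by field; rewrite !(lt0r_neq0 Nr, lt0r_neq0 p0).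
  rewrite ler_pdivlMr ?ltr_pdivrMr ?mulr_gt0 ?pi_gt0 // intrD ler_norml => h1 h2.
  apply/andP; split; lra.
have cost j : cos (x 0 j / N%:R) = cos (t j).
  by rewrite -(cosD2pi_int (t j) (m 0 j)) /t subrK.
have [small|[j large]] : (forall j, `|t j| <= t0) \/ (exists j, t0 < `|t j|).
  have [H|H] := pselect (exists j, t0 < `|t j|); first by right.
  by left => j; rewrite leNgt; apply/negP => h; apply: H; exists j.
  apply: (@le_trans _ _ (2 * e)); last by rewrite lerDl mulr_ge0 // sumr_ge0.
  have h1 := HN (- m) x; set y := x + _ in h1.
  have h2 : cabs (u 0 - u y) <= e.
    apply: Hd => j; have -> : (0 : 'rV[R]_n) 0 j - y 0 j = - (N%:R * t j).
      rewrite mxE [y 0 j]mxE [lattice_point _ _ _ _ _]mxE [(- m) 0 j]mxE rmorphN /= /t.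
      by field; rewrite (lt0r_neq0 Nr).
    rewrite normrN normrM ger0_norm ?(ltW Nr) // mulrC -ler_pdivlMr //.
    by apply: le_trans (small j) _; rewrite ge_min lexx.
  have := cabs_distD (u y) (u 0) (u x); lra.
apply: (@le_trans _ _ (2 * B)).
  by apply: le_trans (cabsB _ _) _; have := uB 0; have := uB x; lra.
have h : c <= 1 - cos (x 0 j / N%:R).
  have i1 : `|t j| \in `[0, pi] by rewrite in_itv /= normr_ge0 tpi.
  have i2 : t0 \in `[0, pi] by rewrite in_itv /= (ltW t00) t0pi.
  by rewrite lerD2l lerN2 cost -(cos_norm (t j)) ltW // ltr_cos.
apply: (@le_trans _ _ (2 * B / c * \sum_j (1 - cos (x 0 j / N%:R)))); last first.
  by rewrite lerDr; lra.
rewrite -[leLHS](@mulfVK _ c) ?lt0r_neq0 // ler_wpM2l //.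
by apply: le_trans h _; rewrite (bigD1 j) //= lerDl sumr_ge0.
Qed.

End Uniqueness.

Section Fejer.
Variable R : realType.
Local Notation C := (Cx R).
Variables (n N J' : nat).
Hypothesis N0 : (0 < N)%N.
Local Notation J := J'.+1.
Local Notation idx := {ffun 'I_n -> 'I_J}.

Definition fejer_freq (a : idx) : 'rV[rat]_n := \row_j ((a j)%:R / N%:R).

(** The product Fejer kernel of period 2 pi N, that is J^-n |sum_a e^(i a.x/N)|^2 with a in {0, ...,
    J-1}^n, expanded into characters so that its means are counts of pairs of indices. *)
Definition fejer (x : 'rV[R]_n) : C :=
  (J%:R ^+ n)^-1 * \sum_(a : idx) \sum_(b : idx) qexp (fejer_freq a - fejer_freq b) (cpt x 0).

Lemma apf_fejer : apf fejer.
Proof.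
by apply: apfZ; apply: apf_sum => a; apply: apf_sum => b; exact: apf_qexp.
Qed.

Lemma qexp_conj (q : 'rV[rat]_n) (x : 'rV[R]_n) :
  qexp (- q) (cpt x 0) = conjc (qexp q (cpt x 0)) :> C.
Proof.
have r0 p : rdot p 0 = 0 :> R by rewrite /rdot big1 // => k _; rewrite mxE mulr0.
have rN : rdot (- q) x = - rdot q x :> R.
  by rewrite /rdot -sumrN; apply: eq_bigr => k _; rewrite mxE rmorphN mulNr.
rewrite /qexp !qdot_cpt !r0 rN /cexp /= !(mul0r, mul1r, add0r, oppr0) expR0 cosN sinN.
by apply: complexP => /=; ring.
Qed.

Lemma fejer_ge0 x : exists2 t : R, 0 <= t & fejer x = t%:C.
Proof.
pose D : C := \sum_(a : idx) qexp (fejer_freq a) (cpt x 0).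
exists ((J%:R ^+ n)^-1 * cabs D ^+ 2).
  by rewrite mulr_ge0 ?invr_ge0 ?exprn_ge0 ?cabs_ge0.
rewrite rmorphM fmorphV rmorphXn /= rmorph_nat /fejer; congr (_ * _).
have -> : (cabs D ^+ 2)%:C = D * conjc D.
  by rewrite cabs_sqr; case: D => p q; apply: complexP => /=; ring.
rewrite /D mulr_suml; apply: eq_bigr => a _.
rewrite (rmorph_sum conjc) mulr_sumr; apply: eq_bigr => b _.
by rewrite qexpD qexp_conj.
Qed.

Lemma mean_fejer_qexp (r : 'rV[rat]_n) :
  mean (fun x => fejer x * qexp r (cpt x 0)) =
  (J%:R ^+ n)^-1 * \sum_(a : idx) \sum_(b : idx) (fejer_freq a - fejer_freq b + r == 0)%:R.
Proof.
have -> : (fun x => fejer x * qexp r (cpt x 0)) = (fun x => (J%:R ^+ n)^-1 *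
   \sum_(a : idx) \sum_(b : idx) qexp (fejer_freq a - fejer_freq b + r) (cpt x 0)).
  apply/funext => x; rewrite /fejer -mulrA mulr_suml; congr (_ * _).
  apply: eq_bigr => a _; rewrite mulr_suml; apply: eq_bigr => b _.
  by rewrite [in RHS]qexpD.
rewrite meanZ; last by apply: apf_sum => a; apply: apf_sum => b; exact: apf_qexp.
rewrite mean_sum; last by move=> a; apply: apf_sum => b; exact: apf_qexp.
congr (_ * _); apply: eq_bigr => a _.
rewrite mean_sum; last by move=> b; exact: apf_qexp.
by apply: eq_bigr => b _; rewrite mean_qexp.
Qed.

Lemma fejer_freq_eq (a b : idx) (k : 'I_n -> int) (r : 'rV[rat]_n) :
  (forall j, r 0 j = (k j)%:~R / N%:R) ->
  (fejer_freq a - fejer_freq b + r == 0) =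
  [forall j, (a j)%:Z + k j == (b j)%:Z].
Proof.
move=> rk; have Nq : N%:R != 0 :> rat by rewrite pnatr_eq0 -lt0n.
have E j : (fejer_freq a - fejer_freq b + r) 0 j =
   ((a j)%:Z + k j - (b j)%:Z)%:~R / N%:R.
  by rewrite !mxE rk rmorphB rmorphD /= !mulrDl mulNr addrAC.
apply/eqP/forallP => [/rowP H j|H].
  have := H j; rewrite E mxE => /eqP; rewrite mulf_eq0 invr_eq0 (negPf Nq) orbF intr_eq0.
  by rewrite subr_eq0.
by apply/rowP => j; rewrite E mxE (eqP (H j)) subrr mul0r.
Qed.

Lemma mean_fejer : mean fejer = 1.
Proof.
have -> : fejer = (fun x => fejer x * qexp 0 (cpt x 0)).
  by apply/funext => x; rewrite qexp0 mulr1.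
rewrite mean_fejer_qexp.
have H (a b : idx) : (fejer_freq a - fejer_freq b + 0 == 0) = (a == b).
  rewrite (@fejer_freq_eq a b (fun=> 0)) => [|j]; last by rewrite mxE mul0r.
  apply/forallP/eqP => [H|-> j]; last by rewrite addr0.
  by apply/ffunP => j; have := H j; rewrite addr0 eqz_nat => /eqP/val_inj.
have -> : \sum_(a : idx) \sum_(b : idx) (fejer_freq a - fejer_freq b + 0 == 0)%:R = 
   \sum_(a : idx) (1 : C).
  apply: eq_bigr => a _; rewrite (bigD1 a) //= H eqxx big1 ?addr0 // => b ba.
  by rewrite H eq_sym (negPf ba).
by rewrite sumr_const card_ffun !card_ord -[LHS]/(_ * ((J ^ n)%N%:R)) natrX mulVf.
Qed.

(** The mean counts the pairs (a, b) with b = a + e_j, or b = a - e_j for the other sign: there are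
    (J - 1) J^(n-1) of them, to be divided by J^n. *)
Lemma mean_fejer_step (j : 'I_n) (s : bool) :
  mean (fun x => fejer x * qexp (\row_k ((if k == j then (-1) ^+ s else 0)%:~R / N%:R)) (cpt x 0)) =
  1 - J%:R^-1.
Proof.
rewrite mean_fejer_qexp.
have -> : \sum_(a : idx) \sum_(b : idx) (fejer_freq a - fejer_freq b +
     \row_k ((if k == j then (-1) ^+ s else 0)%:~R / N%:R) == 0)%:R =
   \sum_(a : idx) \sum_(b : idx)
     ([forall k, (a k)%:Z + (if k == j then (-1) ^+ s else 0) == (b k)%:Z])%:R :> C.
  apply: eq_bigr => a _; apply: eq_bigr => b _.
  by rewrite (@fejer_freq_eq a b (fun k => if k == j then (-1) ^+ s else 0)) // => k; rewrite mxE.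
(* Exchanging a and b reduces the sign -1 to the sign +1. *)
have symm : \sum_(a : idx) \sum_(b : idx)
     ([forall k, (a k)%:Z + (if k == j then (-1) ^+ s else 0) == (b k)%:Z])%:R =
   \sum_(a : idx) \sum_(b : idx)
     ([forall k, (a k)%:Z + (if k == j then 1 else 0) == (b k)%:Z])%:R :> C.
  case: s => //; rewrite exchange_big; apply: eq_bigr => a _; apply: eq_bigr => b _.
  congr (_ %:R); congr nat_of_bool; apply: eq_forallb => k.
  by case: (k == j); [rewrite expr1 subr_eq eq_sym|rewrite !addr0 eq_sym].
rewrite symm.
have inner (a : idx) : \sum_(b : idx)
     ([forall k, (a k)%:Z + (if k == j then 1 else 0) == (b k)%:Z])%:R =
   \prod_k (if k == j then ((a k).+1 < J)%N%:R else 1) :> C.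
  rewrite -big_mkcond /= big_pred1_eq.
  have [aj|aj] := boolP ((a j).+1 < J)%N.
    pose b0 : idx := [ffun k => if k == j then Ordinal aj else a k].
    have E (b : idx) : [forall k, (a k)%:Z + (if k == j then 1 else 0) == (b k)%:Z] = (b == b0).
      apply/forallP/eqP => [H|-> k].
        apply/ffunP => k; apply/val_inj; have := H k; rewrite ffunE.
        case: (eqVneq k j) => [->|_] /=; last by rewrite addr0 eqz_nat => /eqP.
        by rewrite -PoszD eqz_nat addn1 => /eqP.
      rewrite ffunE; case: (eqVneq k j) => [->|_] /=; last by rewrite addr0.
      by rewrite -PoszD eqz_nat addn1.
    by rewrite (bigD1 b0) //= E eqxx big1 ?addr0 // => b; rewrite E => /negPf ->.
  rewrite big1 // => b _; case: forallP => // /(_ j).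
  rewrite eqxx -PoszD eqz_nat addn1 => /eqP ab.
  by move: aj; rewrite ab ltn_ord.
rewrite (eq_bigr _ (fun a _ => inner a)).
rewrite -(bigA_distr_bigA (fun k (r : 'I_J) => if k == j then (r.+1 < J)%N%:R else 1 : C)).
rewrite (bigD1 j) //= eqxx.
have -> : \sum_(r < J) (r.+1 < J)%N%:R = J'%:R :> C.
  rewrite big_ord_recr /= ltnn addr0 (eq_bigr (fun=> 1)) => [|r _].
    by rewrite sumr_const card_ord.
  by rewrite ltnS ltn_ord.
rewrite (eq_bigr (fun=> J%:R)) => [|k kj]; last first.
  by rewrite (negPf kj) sumr_const card_ord.
rewrite prodr_const cardC1 card_ord.
have nE : n = n.-1.+1 by rewrite prednK //; case: (n) (j : 'I_n) => // -[].
rewrite [in X in (X)^-1]nE exprS -natr1.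
have J1 : J'%:R + 1 != 0 :> C by rewrite natr1 pnatr_eq0.
by field; rewrite J1 expf_neq0.
Qed.

End Fejer.

Section UniquenessTheorem.
Variable R : realType.
Local Notation C := (Cx R).

Lemma qexp_step_cos n N (j : 'I_n) (x : 'rV[R]_n) (s : bool) :
  qexp (\row_k ((if k == j then (-1) ^+ s else 0 : int)%:~R / N%:R)) (cpt x 0) =
  (cos (x 0 j / N%:R) +i* ((-1) ^+ s * sin (x 0 j / N%:R))) :> C.
Proof.
rewrite /qexp qdot_cpt.
have -> : rdot (\row_k ((if k == j then (-1) ^+ s else 0 : int)%:~R / N%:R)) 0 = 0 :> R.
  by rewrite /rdot big1 // => k _; rewrite [X in _ * X]mxE mulr0.
have -> : rdot (\row_k ((if k == j then (-1) ^+ s else 0 : int)%:~R / N%:R)) x = (-1) ^+ s * (x 0 j / N%:R).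
  rewrite /rdot (bigD1 j) //= big1 => [|k kj]; last by rewrite mxE (negPf kj) mul0r rmorph0 mul0r.
  rewrite mxE eqxx addr0 /= rmorphM fmorphV /= ratr_int ratr_nat rmorphXn rmorphN1 /=.
  by rewrite mulrAC mulrA.
rewrite /cexp /= !(mul0r, mul1r, add0r, oppr0) expR0.
case: s; rewrite ?expr1 ?expr0 ?mulN1r ?mul1r ?cosN ?sinN; apply: complexP => /=; ring.
Qed.

(** Against the kernel each 1 - cos (x_j / N) has mean 1 - (1 - 1/J) = 1/J; this decay expresses the
    concentration of the kernel at the lattice points. *)
Lemma mean_korovkin n N J' (B e : R) : (0 < N)%N ->
  let P := fun x : 'rV[R]_n => (e%:C + B%:C * \sum_j (1 - (cos (x 0 j / N%:R))%:C) : C) in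
  apf (fun x : 'rV[R]_n => P x * fejer N J' x) /\
  mean (fun x : 'rV[R]_n => P x * fejer N J' x) = (e + B * (n%:R / J'.+1%:R))%:C.
Proof.
move=> N0 P.
pose r j (s : bool) : 'rV[rat]_n := \row_k ((if k == j then (-1) ^+ s else 0 : int)%:~R / N%:R).
have cosE (x : 'rV[R]_n) j : (cos (x 0 j / N%:R))%:C = (qexp (r j true) (cpt x 0) + qexp (r j false) (cpt x 0)) * 2^-1 :> C.
  rewrite !qexp_step_cos expr1 expr0.
  rewrite (_ : _ + _ = 2 * (cos (x 0 j / N%:R))%:C); first by field.
  by apply: complexP => /=; ring.
have aK := @apf_fejer R n N J'.
have aq j s : apf (fun x : 'rV[R]_n => fejer N J' x * qexp (r j s) (cpt x 0)).
  by apply: apfM; [exact: aK|exact: apf_qexp].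
have PE : (fun x : 'rV[R]_n => P x * fejer N J' x) = (fun x : 'rV[R]_n => e%:C * fejer N J' x +
   B%:C * \sum_j (fejer N J' x - 2^-1 * (fejer N J' x * qexp (r j true) (cpt x 0) +
       fejer N J' x * qexp (r j false) (cpt x 0)))).
  apply/funext => x; rewrite /P mulrDl -mulrA mulr_suml; congr (_ + _ * _).
  apply: eq_bigr => j _; rewrite cosE.
  move: (fejer N J' x) (qexp (r j true) _) (qexp (r j false) _) => K u v; ring.
have aS j : apf (fun x : 'rV[R]_n => fejer N J' x - 2^-1 * (fejer N J' x * qexp (r j true) (cpt x 0) +
       fejer N J' x * qexp (r j false) (cpt x 0))).
  by apply: apfB => //; apply: apfZ; apply: apfD.
rewrite PE; split.
  by apply: apfD; apply: apfZ => //; exact: (apf_sum _ aS).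
rewrite meanD; [|exact: apfZ|by apply: apfZ; exact: (apf_sum _ aS)].
rewrite (meanZ e%:C aK) (meanZ B%:C (apf_sum _ aS)).
rewrite mean_fejer // mean_sum // mulr1.
rewrite (eq_bigr (fun=> (J'.+1%:R^-1 : C))) => [|j _]; last first.
  have aD := apfD (aq j true) (aq j false).
  rewrite (meanB aK (apfZ 2^-1 aD)) (meanZ 2^-1 aD) (meanD (aq j true) (aq j false)).
  have ms := congr2 +%R (mean_fejer_step R J' N0 j true) (mean_fejer_step R J' N0 j false).
  apply: etrans (congr2 (fun u v : C => u - 2^-1 * v) (mean_fejer R n J' N0) ms) _.
  by move: (J'.+1%:R^-1) => w; field.
rewrite sumr_const card_ord -[J'.+1%:R^-1 *+ n]mulr_natl.
by rewrite rmorphD !rmorphM fmorphV !rmorph_nat.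
Qed.

(** The kernel is a trigonometric polynomial of mean 1, so u(0) is the mean of (u(0) - u) times the
    kernel. The Korovkin bound and the positivity of the kernel make this at most 2 e + B n / J. *)
Lemma mean0_eq0_at0 n (u : 'rV[R]_n -> C) : apf u ->
  (forall q, mean (fun x : 'rV[R]_n => u x * qexp q (cpt x 0)) = 0) -> u 0 = 0.
Proof.
move=> au u0; apply: (@cabs_le0_eq _ _ 3) => // e e0.
have [N N0 [B B0 HB]] := apf_korovkin au e0.
(* J = J' + 1 exceeds B n / e, which brings the total to 3 e. *)
pose J' := Num.truncn (B * n%:R / e).
have aK := @apf_fejer R n N J'.
have [aG mG] := @mean_korovkin n N J' B (2 * e) N0.
have aU : apf (fun x : 'rV[R]_n => u x * fejer N J' x) by exact: apfM.
have mU : mean (fun x : 'rV[R]_n => u x * fejer N J' x) = 0.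
  have aq (a b : {ffun 'I_n -> 'I_J'.+1}) :
      apf (fun x : 'rV[R]_n => u x * qexp (fejer_freq N a - fejer_freq N b) (cpt x 0)).
    by apply: apfM; [exact: au|exact: apf_qexp].
  have -> : (fun x : 'rV[R]_n => u x * fejer N J' x) = (fun x : 'rV[R]_n => (J'.+1%:R ^+ n)^-1 *
     \sum_(a : {ffun 'I_n -> 'I_J'.+1}) \sum_(b : {ffun 'I_n -> 'I_J'.+1})
        (u x * qexp (fejer_freq N a - fejer_freq N b) (cpt x 0))).
    apply/funext => x; rewrite /fejer mulrCA; congr (_ * _).
    by rewrite mulr_sumr; apply: eq_bigr => a _; rewrite mulr_sumr.
  rewrite meanZ; last by apply: apf_sum => a; exact: apf_sum.
  rewrite mean_sum => [|a]; last exact: apf_sum.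
  rewrite big1 ?mulr0 // => a _; rewrite mean_sum //.
  by rewrite big1 // => b _; exact: u0.
have aD : apf (fun x : 'rV[R]_n => (u 0 - u x) * fejer N J' x).
  by apply: apfM => //; apply: apfB => //; exact: apf_cst.
have mD : mean (fun x : 'rV[R]_n => (u 0 - u x) * fejer N J' x) = u 0.
  have -> : (fun x : 'rV[R]_n => (u 0 - u x) * fejer N J' x) =
      (fun x : 'rV[R]_n => u 0 * fejer N J' x - u x * fejer N J' x).
    by apply/funext => x; rewrite mulrBl.
  by rewrite (meanB (apfZ (u 0) aK) aU) mU subr0 (meanZ _ aK) mean_fejer // mulr1.
have := mean_le_Re aD aG; rewrite mD mG /= => H.
apply: le_trans (H _) _ => [x|]; last first.
  have : B * (n%:R / J'.+1%:R) <= e.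
    rewrite mulrA ler_pdivrMr // [e * _]mulrC -ler_pdivrMr //.
    exact: ltW (truncnS_gt _).
  by move: (B * _) => w w1; lra.
have [t t0 ->] := fejer_ge0 N J' x.
have -> : (2 * e)%:C + B%:C * \sum_j (1 - (cos (x 0 j / N%:R))%:C) =
   (2 * e + B * \sum_j (1 - cos (x 0 j / N%:R)))%:C :> C.
  rewrite [RHS](rmorphD (real_complex R)) (rmorphM (real_complex R) B) (rmorph_sum (real_complex R)) /=; congr (_ + _ * _).
  by apply: eq_bigr => j _; rewrite rmorphB rmorph1.
by rewrite -(rmorphM (real_complex R)) /= cabsM cabs_real (ger0_norm t0) ler_wpM2r.
Qed.

(** Translating u multiplies each coefficient by a phase, so the vanishing of all coefficients is
    translation invariant and 0 can be replaced by any point. *)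
Theorem mean0_eq0 n (u : 'rV[R]_n -> C) : apf u ->
  (forall q, mean (fun x : 'rV[R]_n => u x * qexp q (cpt x 0)) = 0) -> forall x, u x = 0.
Proof.
move=> au u0 x0; rewrite -[x0]add0r.
apply: (@mean0_eq0_at0 n (fun x : 'rV[R]_n => u (x + x0))) => [|q]; first exact: apf_shift.
have aq : apf (fun x : 'rV[R]_n => u x * qexp q (cpt x 0)) by apply: apfM; [exact: au|exact: apf_qexp].
have -> : (fun x : 'rV[R]_n => u (x + x0) * qexp q (cpt x 0)) =
    (fun x : 'rV[R]_n => qexp (- q) (cpt x0 0) * (u (x + x0) * qexp q (cpt (x + x0) 0))).
  apply/funext => x.
  have -> : cpt (x + x0) 0 = cpt x 0 + cpt x0 0 by rewrite -cptD addr0.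
  have h : qexp (- q) (cpt x0 0) * qexp q (cpt x0 0) = 1 by rewrite -qexpD addNr qexp0.
  by rewrite qexpDr -[LHS]mul1r -h; ring.
by rewrite meanZ ?(mean_shift x0 aq) ?u0 ?mulr0 //; exact: (apf_shift x0 aq).
Qed.

End UniquenessTheorem.

(** * Absolutely summable families *)

Section AbsoluteFamilies.
Variables (R : realType) (I : choiceType).
Local Notation C := (Cx R).
Local Open Scope fset_scope.

#[local] Existing Instance summability.totally_filter.

Definition sum_bounded (w : I -> R) (B : R) := forall s : seq I, uniq s -> \sum_(i <- s) w i <= B.

Definition tail_le (w : I -> R) (A : {fset I}) (e : R) := forall s : seq I, uniq s ->
  (forall i, i \in s -> i \notin A) -> \sum_(i <- s) w i <= e.

(** Kept convertible with the sum in [periodic_part], which makes [periodic_partE] hold by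
    definition. *)
Definition csum (u : I -> C) : C^o := summability.sum (u : I -> C^o).

(** A finite set whose sum is within e of the supremum of all finite sums leaves at most e to any
    finite set disjoint from it. *)
Lemma sum_bounded_tail (w : I -> R) B (e : R) : sum_bounded w B -> 0 < e ->
  exists A : {fset I}, tail_le w A e.
Proof.
move=> wB e0.
pose S := [set r | exists2 s : seq I, uniq s & r = \sum_(i <- s) w i].
have S0 : S !=set0 by exists 0, [::]; rewrite ?big_nil.
have Sub : has_ubound S by exists B => _ [s us ->]; exact: wB.
have [_ [s us ->] hs] := sup_adherent e0 (conj S0 Sub).
exists [fset i in s] => s' us' disj.
have : \sum_(i <- s ++ s') w i <= sup S.
  apply: sup_upper_bound => //; exists (s ++ s') => //.
  rewrite cat_uniq us us' andbT /=; apply/hasPn => i is' /=.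
  by have := disj i is'; rewrite in_fset.
by rewrite big_cat /=; lra.
Qed.

Lemma partial_sumE (u : I -> C^o) (A : {fset I}) :
  summability.partial_sum u A = \sum_(i <- A) u i.
Proof. by rewrite /summability.partial_sum big_seq_fsetE. Qed.

Lemma fset_sum_diff (u : I -> C) (A A' : {fset I}) : A `<=` A' ->
  \sum_(i <- A') u i - \sum_(i <- A) u i = \sum_(i <- A' `\` A) u i.
Proof.
move=> AA'; have -> : \sum_(i <- A') u i = \sum_(i <- enum_fset A ++ enum_fset (A' `\` A)) u i.
  apply: perm_big; apply: uniq_perm => [||i]; first exact: fset_uniq.
    rewrite cat_uniq !fset_uniq /= andbT; apply/hasPn => i.
    by rewrite in_fsetD => /andP[].
  rewrite mem_cat -[RHS]/((i \in A) || (i \in A' `\` A)) in_fsetD.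
  by have := fsubsetP AA' i; case: (i \in A) => //= ->.
by rewrite big_cat addrC addKr.
Qed.

Variables (u : I -> C) (w : I -> R).
Hypothesis uw : forall i, cabs (u i) <= w i.

Lemma cabs_sum_le (s : seq I) : cabs (\sum_(i <- s) u i) <= \sum_(i <- s) w i.
Proof. by apply: le_trans (cabs_sum _ _ _) _; apply: ler_sum. Qed.

Lemma partial_sum_tail (A A' : {fset I}) (e : R) : tail_le w A e -> A `<=` A' ->
  cabs (\sum_(i <- A') u i - \sum_(i <- A) u i) <= e.
Proof.
move=> tA AA'; rewrite fset_sum_diff //; apply: le_trans (cabs_sum_le _) _.
by apply: tA; [exact: fset_uniq|move=> i; rewrite in_fsetD => /andP[]].
Qed.

Lemma csum_cvg B : sum_bounded w B ->
  (fun A : {fset I} => \sum_(i <- A) u i : C^o) @ summability.totally --> csum u.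
Proof.
move=> wB.
have -> : (fun A : {fset I} => \sum_(i <- A) u i : C^o) = summability.partial_sum (u : I -> C^o).
  by apply/funext => A; rewrite partial_sumE.
have near_tail (e : R) : 0 < e -> exists A : {fset I},
    \forall A' \near summability.totally,
      cabs (summability.partial_sum (u : I -> C^o) A' - \sum_(i <- A) u i) < e.
  move=> e0; have e2 : 0 < e / 2 by lra.
  have [A tA] := sum_bounded_tail wB e2.
  exists A; exists A => // A' /= AA'; rewrite partial_sumE.
  by apply: le_lt_trans (partial_sum_tail tA AA') _; lra.
have cR : cvg (complex.Re (summability.partial_sum (u : I -> C^o) A) @[A --> summability.totally]).
  apply/cauchy_cvgP/cauchy_exP => e e0.
  have [A0 HA] := near_tail e e0; exists (complex.Re (\sum_(i <- A0) u i)).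
  apply: (filterS _ HA) => A; apply: le_lt_trans.
  by rewrite distrC -ReN -ReD abs_Re.
have cI : cvg (complex.Im (summability.partial_sum (u : I -> C^o) A) @[A --> summability.totally]).
  apply/cauchy_cvgP/cauchy_exP => e e0.
  have [A0 HA] := near_tail e e0; exists (complex.Im (\sum_(i <- A0) u i)).
  apply: (filterS _ HA) => A; apply: le_lt_trans.
  by rewrite distrC -ImN -ImD abs_Im.
apply/cvg_ex.
exists ((lim (complex.Re (summability.partial_sum (u : I -> C^o) A) @[A --> summability.totally]) +i*
  lim (complex.Im (summability.partial_sum (u : I -> C^o) A) @[A --> summability.totally])) : C^o).
apply/cvgC_cabs => e e0; have e20 : 0 < e / 2 by lra.
move/cvgrPdist_le : cR => /(_ _ e20) hR; move/cvgrPdist_le : cI => /(_ _ e20) hI.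
apply: filterS2 hR hI => A hR hI.
apply: le_trans (cabs_le _) _; rewrite ReD ImD ReN ImN /= (splitr e).
by apply: lerD; rewrite distrC.
Qed.

Lemma csum_approx B (A A' : {fset I}) (e : R) : sum_bounded w B -> tail_le w A e -> A `<=` A' ->
  cabs (csum u - \sum_(i <- A') u i) <= e.
Proof.
move=> wB tA AA'; apply/ler_addgt0Pr => d d0.
have H1 : summability.totally [set A1 : {fset I} | A' `<=` A1] by exists A'.
have H2 : summability.totally [set A1 : {fset I} | cabs (\sum_(i <- A1) u i - csum u) <= d].
  by move/cvgC_cabs : (csum_cvg wB); apply.
have [A1 [A'1 h1]] := filter_ex (filterI H1 H2).
have h2 : cabs (\sum_(i <- A1) u i - \sum_(i <- A') u i) <= e.
  apply: partial_sum_tail => //; move=> s us sA; apply: tA => // i /sA.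
  by apply: contraNN; exact: (fsubsetP AA').
rewrite /= in h1; have := cabs_distD (\sum_(i <- A1) u i) (csum u) (\sum_(i <- A') u i).
rewrite (cabsC (csum u) (\sum_(i <- A1) u i)); lra.
Qed.

Lemma csum_le B : sum_bounded w B -> cabs (csum u) <= B.
Proof.
move=> wB; apply/ler_addgt0Pr => e e0.
have [A tA] := sum_bounded_tail wB e0.
have h := csum_approx wB tA (fsubset_refl A).
have := cabsD (csum u - \sum_(i <- A) u i) (\sum_(i <- A) u i); rewrite subrK.
have := le_trans (cabs_sum_le A) (wB _ (fset_uniq A)); lra.
Qed.

End AbsoluteFamilies.

(** * Sums over the integer lattice *)

Section LatticeSums.
Variable R : realType.

Lemma exprn_le_expR (x : R) m : 0 <= x -> x ^+ m <= m`!%:R * expR x.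
Proof.
move=> x0; case: m => [|m].
  by rewrite expr0 mul1r -expR0 ler_expR.
have := expR_ge1Dxn m x0 => h.
rewrite mulrC -ler_pdivrMr ?ltr0n ?fact_gt0 //; lra.
Qed.

Lemma geometric_le (r : R) M : 0 <= r < 1 -> \sum_(a < M) r ^+ a <= (1 - r)^-1.
Proof.
move=> /andP[r0 r1]; have r1' : 0 < 1 - r by lra.
rewrite -[(1 - r)^-1]mul1r ler_pdivlMr //.
have -> : (\sum_(a < M) r ^+ a) * (1 - r) = 1 - r ^+ M.
  elim: M => [|M IH]; first by rewrite big_ord0 mul0r expr0 subrr.
  by rewrite big_ord_recr mulrDl /= IH exprSr; ring.
by rewrite lerBlDr lerDl exprn_ge0.
Qed.

Lemma sum_uniq_le (T : finType) (s : seq T) (psi : T -> R) : uniq s -> (forall f, 0 <= psi f) ->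
  \sum_(f <- s) psi f <= \sum_f psi f.
Proof.
move=> us psi0; rewrite big_uniq // big_mkcond /=; apply: ler_sum => f _.
by case: ifP.
Qed.

(** Sign and absolute value encode the entries of k injectively in a finite type, where the sum of
    products is a product of sums; each factor is twice a truncated geometric series. *)
Lemma prod_geometric_le n (r : R) (s : seq 'rV[int]_n) : 0 <= r < 1 -> uniq s ->
  \sum_(k <- s) \prod_j r ^+ absz (k 0 j) <= (2 / (1 - r)) ^+ n.
Proof.
move=> r01 us; have /andP[r0 r1] := r01.
pose M := (\max_(k <- s) \max_j absz (k 0%R j)).+1.
have kM k j : k \in s -> (absz (k 0%R j) < M)%N.
  move=> ks; rewrite ltnS (big_rem k) //= leq_max.
  by rewrite (bigD1 j) //= leq_maxl.
pose T := (bool * 'I_M)%type.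
pose enc (k : 'rV[int]_n) : {ffun 'I_n -> T} :=
  [ffun j => (k 0%R j < 0, inord (absz (k 0%R j)))].
pose psi (f : {ffun 'I_n -> T}) : R := \prod_j r ^+ (f j).2.
have encK : {in s &, injective enc}.
  move=> k l ks ls /ffunP kl; apply/rowP => j; have := kl j; rewrite !ffunE => -[].
  move=> sg /(congr1 val); rewrite /= !inordK ?kM // => ab.
  by rewrite [LHS]intEsign [RHS]intEsign sg ab.
have -> : \sum_(k <- s) \prod_j r ^+ absz (k 0 j) = \sum_(f <- map enc s) psi f.
  rewrite big_map big_seq [RHS]big_seq; apply: eq_bigr => k ks.
  by apply: eq_bigr => j _; rewrite ffunE /= inordK // kM.
have psi0 f : 0 <= psi f by apply: prodr_ge0 => j _; exact: exprn_ge0.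
apply: (@le_trans _ _ (\sum_f psi f)).
  apply: sum_uniq_le => //; rewrite map_inj_in_uniq //.
rewrite -(bigA_distr_bigA (fun (j : 'I_n) (b : T) => r ^+ b.2)) /=.
rewrite prodr_const card_ord; apply: lerXn2r; rewrite ?nnegrE.
- by apply: sumr_ge0 => b _; exact: exprn_ge0.
- by rewrite divr_ge0 // ltW // subr_gt0.
rewrite -(pair_bigA _ (fun (x : bool) (a : 'I_M) => r ^+ a)) /= big_bool /=.
by have := geometric_le M r01; rewrite mulr_natl mulr2n => h; exact: lerD.
Qed.

(** Half of the exponential absorbs |k|^m. A quarter is at most a product of geometric terms, as the
    sum of the |k_j| is at most n |k|. The last quarter is at most e^(-t/4), since |k| >= 1, and
    compensates the growth of (t + 4n)^n for large t: this makes the bound valid for every t > 0 and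
    not only for small t. *)
Lemma lattice_sum_bound n m : exists2 K : R, 0 <= K & forall (t : R) (s : seq 'rV[int]_n),
  0 < t -> uniq s -> (forall k, k \in s -> k != 0) ->
  \sum_(k <- s) enorm (map_mx (intr : int -> R) k) ^+ m * expR (- (t * enorm (map_mx intr k)))
    <= K / t ^+ (m + n).
Proof.
case: n => [|n'].
  exists 0 => // t s t0 us s0; rewrite mul0r big1_seq // => k /andP[_ /s0].
  have -> : k = 0 by apply/rowP => -[].
  by rewrite eqxx.
set n := n'.+1.
exists (m`!%:R * 2 ^+ (m + n) * n`!%:R * 4 ^+ n * expR n%:R).
  by rewrite !mulr_ge0 ?exprn_ge0 ?expR_ge0.
move=> t s t0 us s0.
have n0 : 0 < (n%:R : R) by rewrite ltr0n.
pose tau := t / (4 * n%:R); have tau0 : 0 < tau by rewrite divr_gt0 // mulr_gt0.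
pose r := expR (- tau).
have r01 : 0 <= r < 1 by rewrite expR_ge0 /= -expR0 ltr_expR oppr_lt0.
have term k : k \in s -> enorm (map_mx (intr : int -> R) k) ^+ m * expR (- (t * enorm (map_mx intr k)))
   <= (m`!%:R * (2 / t) ^+ m * expR (- (t / 4))) * \prod_j r ^+ absz (k 0 j).
  move=> ks; set N := enorm _; have N0 : 0 <= N by exact: enorm_ge0.
  have cN j : (absz (k 0%R j))%:R <= N.
    by have := coord_le_enorm (map_mx (intr : int -> R) k) j; rewrite mxE natr_absz intr_norm.
  have N1 : 1 <= N.
    have [j kj] : exists j, k 0 j != 0.
      apply: contrapT => H; have /eqP := s0 k ks; apply; apply/rowP => j; rewrite mxE.
      by apply/eqP/negPn/negP => kj; apply: H; exists j.
    by apply: le_trans (cN j); rewrite ler1n absz_gt0.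
  have pE : \prod_j r ^+ absz (k 0%R j) = expR (- tau * \sum_j (absz (k 0%R j))%:R).
    rewrite mulr_sumr expR_sum; apply: eq_bigr => j _.
    by rewrite /r -expRM_natr.
  have sumN : \sum_j (absz (k 0%R j))%:R <= n%:R * N.
    apply: le_trans (ler_sum _ (fun j _ => cN j)) _.
    by rewrite sumr_const card_ord -[leLHS]mulr_natl.
  have pw : (t / 2 * N) ^+ m <= m`!%:R * expR (t / 2 * N).
    by apply: exprn_le_expR; rewrite !mulr_ge0 // ltW.
  have -> : N ^+ m = (2 / t) ^+ m * (t / 2 * N) ^+ m.
    by rewrite -exprMn; congr (_ ^+ m); field; rewrite lt0r_neq0.
  have q0 : 0 <= (2 / t) ^+ m by rewrite exprn_ge0 // divr_ge0 // ltW.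
  rewrite pE; apply: (@le_trans _ _ ((2 / t) ^+ m * (m`!%:R * expR (t / 2 * N)) * expR (- (t * N)))).
    by rewrite ler_wpM2r ?expR_ge0 // ler_wpM2l.
  rewrite -[X in X <= _]mulrA -[X in _ * X <= _]mulrA -expRD [leLHS]mulrCA.
  rewrite -[leRHS]mulrA -expRD -[leRHS]mulrA.
  rewrite !ler_wpM2l // ler_expR.
  have : tau * (n%:R * N) = t / 4 * N by rewrite /tau; field; rewrite lt0r_neq0.
  have := ler_wpM2l (ltW tau0) sumN.
  have : t / 4 <= t / 4 * N by rewrite ler_peMr // divr_ge0 // ltW.
  by move: (\sum_j _) => S; lra.
rewrite big_seq; apply: le_trans (ler_sum _ term) _; rewrite -big_seq -mulr_sumr.
have /andP[r0 r1] := r01.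
(* From e^tau >= 1 + tau comes 1 - r >= tau / (1 + tau). *)
have r1tau : 2 / (1 - r) <= 2 * (t + 4 * n%:R) / t.
  have h : expR tau * r = 1 by rewrite -expRD subrr expR0.
  have h1 := expR_ge1Dx tau.
  have h2 : r * (1 + tau) <= 1 by have := ler_wpM2l r0 h1; lra.
  rewrite ler_pdivrMr ?subr_gt0 // mulrAC ler_pdivlMr //.
  have : t = tau * (4 * n%:R) by rewrite /tau; field; rewrite lt0r_neq0.
  nra.
have step : \sum_(k <- s) \prod_j r ^+ absz (k 0 j) <= (2 * (t + 4 * n%:R) / t) ^+ n.
  apply: le_trans (prod_geometric_le r01 us) _.
  apply: lerXn2r => //; rewrite nnegrE.
    by rewrite divr_ge0 // ltW // subr_gt0.
  by rewrite divr_ge0 ?(ltW t0) // mulr_ge0 // addr_ge0 ?(ltW t0).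
have pol : (t / 4 + n%:R) ^+ n <= n`!%:R * expR (t / 4 + n%:R).
  by apply: exprn_le_expR; rewrite addr_ge0 // divr_ge0 // ltW.
have c0 : 0 <= m`!%:R * (2 / t) ^+ m * expR (- (t / 4)).
  by rewrite !mulr_ge0 ?expR_ge0 ?exprn_ge0 ?divr_ge0 ?ltW.
apply: le_trans (ler_wpM2l c0 step) _.
have -> : 2 * (t + 4 * n%:R) / t = 2 * 4 / t * (t / 4 + n%:R) by field; rewrite lt0r_neq0.
rewrite [X in _ * X <= _](exprMn n (2 * 4 / t)).
apply: (@le_trans _ _ (m`!%:R * (2 / t) ^+ m * expR (- (t / 4)) * ((2 * 4 / t) ^+ n * (n`!%:R * expR (t / 4 + n%:R))))).
  apply: ler_wpM2l => //; apply: ler_wpM2l => //.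
  by rewrite exprn_ge0 // divr_ge0 ?(ltW t0) // mulr_ge0.
rewrite expRD expRN !exprMn !exprVn !exprD le_eqVlt; apply/orP; left; apply/eqP.
by field; rewrite !expf_neq0 ?lt0r_neq0 ?expR_gt0.
Qed.

End LatticeSums.

(** * Series of characters and their coefficients *)

Section CharacterSeries.
Variables (R : realType) (n : nat) (I : choiceType).
Local Notation C := (Cx R).
Local Open Scope fset_scope.
Variables (freq : I -> 'rV[rat]_n) (a : I -> C) (y : 'rV[R]_n) (B : R).
Hypothesis aB : sum_bounded (fun i => cabs (a i) * expR (- rdot (freq i) y)) B.

Definition char_series (z : 'rV[C]_n) : C^o := csum (fun i => a i * qexp (freq i) z).

Lemma cabs_char_term x i :
  cabs (a i * qexp (freq i) (cpt x y)) <= cabs (a i) * expR (- rdot (freq i) y).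
Proof. by rewrite cabsM cabs_qexp. Qed.

Lemma apf_char_series : apf (fun x => char_series (cpt x y)).
Proof.
apply: apf_uniform_limit => e e0; have [A tA] := sum_bounded_tail aB e0.
exists (fun x => \sum_(i <- A) a i * qexp (freq i) (cpt x y)).
  by apply: apf_sum => i; apply: apfZ; exact: apf_qexp.
by move=> x; exact: (csum_approx (cabs_char_term x) aB tA (fsubset_refl A)).
Qed.

(** A large partial sum has coefficient v at q, and the remainder is uniformly small on the slice.
    Phrasing this with the eventual value v covers both a frequency attained once and one never
    attained. *)
Lemma mean_char_series (q : 'rV[rat]_n) (v : C) (A1 : {fset I}) :
  (forall A : {fset I}, A1 `<=` A -> \sum_(i <- A) a i * (freq i == q)%:R = v) ->
  mean (fun x => char_series (cpt x y) * qexp (- q) (cpt x y)) = v.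
Proof.
move=> Av; apply/eqP; rewrite -subr_eq0; apply/eqP.
have aS : apf (fun x => char_series (cpt x y) * qexp (- q) (cpt x y)).
  by apply: apfM; [exact: apf_char_series|exact: apf_qexp].
apply: (@cabs_le0_eq R _ (expR (- rdot (- q) y)) (expR_gt0 _)) => e e0.
have [A0 tA] := sum_bounded_tail aB e0.
pose A := A0 `|` A1.
pose P (x : 'rV[R]_n) := \sum_(i <- A) a i * qexp (freq i - q) (cpt x y).
have aP : apf P by apply: apf_sum => i; apply: apfZ; exact: apf_qexp.
have mP : mean P = v.
  rewrite -(Av A (fsubsetUr _ _)) /P mean_sum => [|i]; last by apply: apfZ; exact: apf_qexp.
  apply: eq_bigr => i _; rewrite meanZ; last exact: apf_qexp.
  congr (_ * _).
  have -> : (fun x : 'rV[R]_n => qexp (freq i - q) (cpt x y)) =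
     (fun x => qexp (freq i - q) (cpt 0 y) * qexp (freq i - q) (cpt x 0)).
    by apply/funext => x; rewrite -qexpDr -cptD add0r addr0.
  rewrite meanZ; last exact: apf_qexp.
  rewrite mean_qexp subr_eq0; have [->|_] := eqVneq (freq i) q; last by rewrite mulr0.
  by rewrite subrr qexp0 mulr1.
rewrite -mP -meanB //; apply: mean_le; first exact: apfB.
move=> x; have -> : P x = (\sum_(i <- A) a i * qexp (freq i) (cpt x y)) * qexp (- q) (cpt x y).
  by rewrite mulr_suml; apply: eq_bigr => i _; rewrite qexpD mulrA.
rewrite -mulrBl cabsM cabs_qexp mulrC ler_wpM2l ?expR_ge0 //.
exact: (csum_approx (cabs_char_term x) aB tA (fsubsetUl _ _)).
Qed.

Lemma mean_char_series_in i : injective freq ->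
  mean (fun x => char_series (cpt x y) * qexp (- freq i) (cpt x y)) = a i.
Proof.
move=> fi; apply: (@mean_char_series _ _ [fset i]) => A; rewrite fsub1set => iA.
rewrite (big_fsetD1 i) //= eqxx mulr1 big_seq big1 ?addr0 // => k.
rewrite in_fsetD1 => /andP[ki _]; case: eqP => [/fi kE|_]; last by rewrite mulr0.
by rewrite kE eqxx in ki.
Qed.

Lemma mean_char_series_notin q : (forall i, freq i != q) ->
  mean (fun x => char_series (cpt x y) * qexp (- q) (cpt x y)) = 0.
Proof.
move=> fq; apply: (@mean_char_series _ _ fset0) => A _.
by rewrite big1 // => i _; rewrite (negPf (fq i)) mulr0.
Qed.

End CharacterSeries.

(** * Decay of the coefficients *)

Section Coefficients.
Variable R : realType.
Local Notation C := (Cx R).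

Definition qnorm n (q : 'rV[rat]_n) : R := enorm (map_mx (ratr : rat -> R) q).

Definition lat_freq n (L : nat) (k : 'rV[int]_n) : 'rV[rat]_n :=
  map_mx (fun a : int => a%:~R / L%:R : rat) k.

Lemma rdotN n (q : 'rV[rat]_n) (y : 'rV[R]_n) : rdot (- q) y = - rdot q y.
Proof. by rewrite /rdot -sumrN; apply: eq_bigr => k _; rewrite mxE rmorphN mulNr. Qed.

Lemma rdot_le_qnorm n (q : 'rV[rat]_n) (y : 'rV[R]_n) : `|rdot q y| <= qnorm q * enorm y.
Proof. exact: rdot_le. Qed.

Lemma qnorm_ge0 n (q : 'rV[rat]_n) : 0 <= qnorm q.
Proof. exact: enorm_ge0. Qed.

Lemma qnorm_lat_freq n L (k : 'rV[int]_n) : (0 < L)%N ->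
  qnorm (lat_freq L k) = enorm (map_mx (intr : int -> R) k) / L%:R.
Proof.
move=> L0.
have -> : qnorm (lat_freq L k) = enorm ((L%:R)^-1 *: map_mx (intr : int -> R) k).
  congr enorm; apply/rowP => j; rewrite !mxE rmorphM fmorphV /= ratr_int ratr_nat.
  by rewrite mulrC.
by rewrite enormZ ger0_norm ?invr_ge0 // mulrC.
Qed.

Lemma lat_freq_inj n L : (0 < L)%N -> injective (@lat_freq n L).
Proof.
move=> L0 k l /rowP kl; apply/rowP => j; have := kl j; rewrite !mxE.
have Lr : L%:R^-1 != 0 :> rat by rewrite invr_eq0 pnatr_eq0 -lt0n.
by move/(mulIf Lr)/intr_inj.
Qed.

(* An exponential bound in every direction of a ball improves to the radial bound
   by choosing the shift [y] antiparallel to [q]. *)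
Lemma radial_decay n (q : 'rV[rat]_n) (rho A B t : R) :
  (forall y : 'rV[R]_n, enorm y < rho -> A <= B * expR (rdot q y)) ->
  0 <= t < rho -> A <= B * expR (- (t * qnorm q)).
Proof.
move=> H /andP[t0 tr]; set N := qnorm q.
have [N0|N0] := eqVneq N 0.
  have e0 : enorm (0 : 'rV[R]_n) < rho.
    have -> : enorm (0 : 'rV[R]_n) = 0.
      by rewrite /enorm big1 ?sqrtr0 // => j _; rewrite mxE expr0n.
    exact: le_lt_trans tr.
  have := H 0 e0; rewrite N0 mulr0 oppr0 /rdot big1 // => j _; by rewrite mxE mulr0.
have Np : 0 < N by rewrite lt0r N0 qnorm_ge0.
have yr : enorm ((- (t / N)) *: map_mx (ratr : rat -> R) q) < rho.
  by rewrite enormZ normrN ger0_norm ?divr_ge0 ?(ltW Np) // divfK.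
have := H _ yr; congr (_ <= _ * expR _).
have -> : rdot q ((- (t / N)) *: map_mx (ratr : rat -> R) q) = - (t / N) * N ^+ 2.
  rewrite /N /qnorm enorm_sqr mulr_sumr; apply: eq_bigr => j _.
  by rewrite !mxE; ring.
by field.
Qed.

Section Holomorphic.
Variables (n : nat) (rho : R) (g : 'rV[C]_n -> C^o).
Hypothesis rho0 : 0 < rho.
Hypothesis gCQ : CQ rho g.
Local Notation c := (pcoef g).

Lemma pcoef_le q (y : 'rV[R]_n) : enorm y < rho ->
  cabs (c q) <= fine (snorm rho g) * expR (rdot q y).
Proof.
move=> yr; rewrite (pcoef_mean gCQ q yr); apply: mean_le.
  exact: (apf_twist gCQ q yr).
move=> x; rewrite /twist cabsM cabs_qexp rdotN opprK ler_wpM2r ?expR_ge0 //.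
by case: gCQ => _ bg _; apply: snorm_fin_bound => //; apply/strip_cpt.
Qed.

(** Splits off the frequency 0, which [lattice_sum_bound] excludes. *)
Lemma sum_bounded_but (I : choiceType) (w : I -> R) k0 B : 0 <= w k0 -> 0 <= B ->
  (forall s : seq I, uniq s -> (forall k, k \in s -> k != k0) -> \sum_(k <- s) w k <= B) ->
  sum_bounded w (w k0 + B).
Proof.
move=> w0 B0 H s us; have [ks|ks] := boolP (k0 \in s).
  rewrite (big_rem k0) //= lerD2l; apply: H; first exact: rem_uniq.
  move=> k kr; apply/eqP => kk0; move: kr; rewrite kk0 mem_rem_uniqF //.
apply: le_trans (H s us _) _ => [k ks'|]; last by rewrite lerDr.
by apply: contraNneq ks => <-.
Qed.

Lemma periodic_part_bounded L (y : 'rV[R]_n) : (0 < L)%N -> enorm y < rho ->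
  exists B, sum_bounded (fun k : 'rV[int]_n => cabs (c (lat_freq L k)) * expR (- rdot (lat_freq L k) y)) B.
Proof.
move=> L0 yr.
pose w k := cabs (c (lat_freq L k)) * expR (- rdot (lat_freq L k) y).
have w0 k : 0 <= w k by rewrite mulr_ge0 ?cabs_ge0 ?expR_ge0.
have y0 := enorm_ge0 y.
(* t + |y| lies halfway between |y| and rho. The coefficients decay at this rate, the characters
   grow at rate at most |y| on the slice, and t is left for convergence. *)
pose t := (rho - enorm y) / 2; have t0 : 0 < t by rewrite /t; lra.
pose G := fine (snorm rho g).
have G0 : 0 <= G.
  apply: le_trans (cabs_ge0 (g (cpt 0 0))) _; case: gCQ => _ bg _; apply: snorm_fin_bound => //.
  by apply/strip_cpt; rewrite /enorm big1 ?sqrtr0 // => j _; rewrite mxE expr0n.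
have wle k : w k <= G * expR (- (t / L%:R * enorm (map_mx (intr : int -> R) k))).
  have H := @radial_decay n (lat_freq L k) rho _ G (t + enorm y) (fun z zr => pcoef_le _ zr).
  have {}H := H ltac:(by apply/andP; split; rewrite /t; lra).
  apply: le_trans (ler_wpM2r (expR_ge0 _) H) _.
  rewrite -[leLHS]mulrA ler_wpM2l // -expRD ler_expR.
  have := rdot_le_qnorm (lat_freq L k) y; rewrite ler_norml => /andP[h _].
  have -> : t / L%:R * enorm (map_mx (intr : int -> R) k) = t * qnorm (lat_freq L k).
    by rewrite qnorm_lat_freq //; ring.
  lra.
have [K K0 HK] := lattice_sum_bound R n 0.
have tL : 0 < t / L%:R by rewrite divr_gt0 // ltr0n.
exists (w 0 + G * (K / (t / L%:R) ^+ (0 + n))).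
apply: (sum_bounded_but (w0 0)).
  by apply: mulr_ge0 => //; apply: divr_ge0 => //; rewrite exprn_ge0 // ltW.
move=> s us s0; apply: le_trans (ler_sum _ (fun k _ => wle k)) _.
rewrite -mulr_sumr ler_wpM2l //; have := HK _ s tL us s0.
by under eq_bigr do rewrite expr0 mul1r.
Qed.

Lemma periodic_partE L : periodic_part g L = char_series (@lat_freq n L) (fun k => c (lat_freq L k)).
Proof. by []. Qed.

Definition in_lattice (L : nat) (q : 'rV[rat]_n) := exists k, q = lat_freq L k.

Lemma periodic_part_mean_in L q (y : 'rV[R]_n) : (0 < L)%N -> enorm y < rho -> in_lattice L q ->
  mean (fun x => periodic_part g L (cpt x y) * qexp (- q) (cpt x y)) = c q.
Proof.
move=> L0 yr [k ->]; have [B HB] := periodic_part_bounded L0 yr.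
rewrite periodic_partE.
exact: (mean_char_series_in HB k (lat_freq_inj L0)).
Qed.

Lemma periodic_part_mean_notin L q (y : 'rV[R]_n) : (0 < L)%N -> enorm y < rho -> ~ in_lattice L q ->
  mean (fun x => periodic_part g L (cpt x y) * qexp (- q) (cpt x y)) = 0.
Proof.
move=> L0 yr nq; have [B HB] := periodic_part_bounded L0 yr.
rewrite periodic_partE; apply: (mean_char_series_notin HB) => k.
by apply/eqP => kq; apply: nq; exists k.
Qed.

Lemma apf_periodic_part L (y : 'rV[R]_n) : (0 < L)%N -> enorm y < rho ->
  apf (fun x => periodic_part g L (cpt x y)).
Proof.
move=> L0 yr; have [B HB] := periodic_part_bounded L0 yr.
by rewrite periodic_partE; exact: (apf_char_series HB).
Qed.

(** Here h will be g_{n_1} or a difference of consecutive periodic parts. Its slice means are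
    computed termwise, so the contour shift is carried out for g alone, while the decay estimate
    sees the sup norm of h. *)
Lemma pcoef_le_of_mean (h : 'rV[C]_n -> C^o) q (t : R) :
  (snorm rho h < +oo)%E ->
  (forall y : 'rV[R]_n, enorm y < rho -> apf (fun x => h (cpt x y))) ->
  (forall y : 'rV[R]_n, enorm y < rho ->
     mean (fun x => h (cpt x y) * qexp (- q) (cpt x y)) = c q) ->
  0 <= t < rho -> cabs (c q) <= fine (snorm rho h) * expR (- (t * qnorm q)).
Proof.
move=> hfin ah mh; apply: radial_decay => y yr; rewrite -(mh y yr); apply: mean_le.
  by apply: apfM; [exact: ah|exact: apf_qexp].
move=> x; rewrite cabsM cabs_qexp rdotN opprK ler_wpM2r ?expR_ge0 //.
by apply: snorm_fin_bound => //; apply/strip_cpt.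
Qed.

Lemma pcoef_le_first L q (t : R) : (0 < L)%N -> in_lattice L q ->
  (snorm rho (periodic_part g L) < +oo)%E -> 0 <= t < rho ->
  cabs (c q) <= fine (snorm rho (periodic_part g L)) * expR (- (t * qnorm q)).
Proof.
move=> L0 qL hfin; apply: pcoef_le_of_mean => // y yr; first exact: apf_periodic_part.
exact: periodic_part_mean_in.
Qed.

(** The frequency q is new at level L', so its coefficient in the difference is the full g_q. *)
Lemma pcoef_le_layer L L' q (t : R) : (0 < L)%N -> (0 < L')%N ->
  ~ in_lattice L q -> in_lattice L' q ->
  (snorm rho (fun z => (periodic_part g L' z - periodic_part g L z)%R) < +oo)%E -> 0 <= t < rho ->
  cabs (c q) <= fine (snorm rho (fun z => periodic_part g L' z - periodic_part g L z))
    * expR (- (t * qnorm q)).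
Proof.
move=> L0 L'0 qL qL' hfin; apply: pcoef_le_of_mean => // y yr.
  by apply: apfB; exact: apf_periodic_part.
have aL : apf (fun x => periodic_part g L (cpt x y) * qexp (- q) (cpt x y)).
  by apply: apfM; [exact: apf_periodic_part|exact: apf_qexp].
have aL' : apf (fun x => periodic_part g L' (cpt x y) * qexp (- q) (cpt x y)).
  by apply: apfM; [exact: apf_periodic_part|exact: apf_qexp].
transitivity (mean (fun x => periodic_part g L' (cpt x y) * qexp (- q) (cpt x y) -
    periodic_part g L (cpt x y) * qexp (- q) (cpt x y))).
  by congr mean; apply/funext => x; rewrite -mulrBl.
have M' := periodic_part_mean_in L'0 yr qL'; have M := periodic_part_mean_notin L0 yr qL.
apply: etrans (meanB aL' aL) _.
by apply: etrans (congr2 (fun u v : C => u - v) M' M) _; exact: subr0.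
Qed.

End Holomorphic.
End Coefficients.

(** * Holomorphic sums of character series *)

Section CsumLinear.
Variables (R : realType) (I : choiceType).
Local Notation C := (Cx R).
#[local] Existing Instance summability.totally_filter.
Implicit Types (u v : I -> C) (w : I -> R).

Definition summable_fam u := exists w B, (forall i, cabs (u i) <= w i) /\ sum_bounded w B.

Lemma csum_cvg_fam u : summable_fam u ->
  (fun A : {fset I} => \sum_(i <- A) u i : C^o) @ summability.totally --> csum u.
Proof. by move=> [w [B [uw wB]]]; exact: (csum_cvg uw wB). Qed.

Lemma csum_unique u (l : C^o) :
  (fun A : {fset I} => \sum_(i <- A) u i : C^o) @ summability.totally --> l -> csum u = l.
Proof.
move=> ul; rewrite /csum /summability.sum.
have -> : summability.partial_sum (u : I -> C^o) = (fun A : {fset I} => \sum_(i <- A) u i : C^o).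
  by apply/funext => A; rewrite partial_sumE.
exact: (cvg_lim (@norm_hausdorff _ C^o) ul).
Qed.

Lemma csumD u v : summable_fam u -> summable_fam v ->
  csum (fun i => u i + v i) = csum u + csum v.
Proof.
move=> su sv; apply: csum_unique.
have -> : (fun A : {fset I} => \sum_(i <- A) (u i + v i) : C^o) =
  (fun A : {fset I} => (\sum_(i <- A) u i : C^o) + (\sum_(i <- A) v i : C^o)).
  by apply/funext => A; rewrite big_split.
by apply: (@cvgD C C^o); exact: csum_cvg_fam.
Qed.

Lemma csumZ (c : C) u : summable_fam u -> csum (fun i => c * u i) = c * csum u.
Proof.
move=> su; apply: csum_unique.
have -> : (fun A : {fset I} => \sum_(i <- A) (c * u i) : C^o) =
  (fun A : {fset I} => c *: (\sum_(i <- A) u i : C^o)).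
  by apply/funext => A; rewrite -mulr_sumr.
by apply: (@cvgZr _ C^o); exact: csum_cvg_fam.
Qed.

Lemma summable_famZ (c : C) u : summable_fam u -> summable_fam (fun i => c * u i).
Proof.
move=> [w [B [uw wB]]]; exists (fun i => cabs c * w i), (cabs c * B); split=> [i|s us].
  by rewrite cabsM ler_wpM2l ?cabs_ge0.
by rewrite -mulr_sumr ler_wpM2l ?cabs_ge0 //; exact: wB.
Qed.

Lemma summable_famD u v : summable_fam u -> summable_fam v -> summable_fam (fun i => u i + v i).
Proof.
move=> [w [B [uw wB]]] [w' [B' [vw wB']]].
exists (fun i => w i + w' i), (B + B'); split=> [i|s us].
  exact: le_trans (cabsD _ _) (lerD _ _).
by rewrite big_split; apply: lerD; [exact: wB|exact: wB'].
Qed.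

Lemma csum0 : csum (fun _ : I => 0 : C) = 0.
Proof.
apply: csum_unique.
have -> : (fun A : {fset I} => \sum_(i <- A) 0 : C^o) = (fun=> 0).
  by apply/funext => A; rewrite big1.
exact: cvg_cst.
Qed.

Lemma summable_fam_csum_sum (J : Type) (r : seq J) (u : J -> I -> C) :
  (forall j, summable_fam (u j)) ->
  summable_fam (fun i => \sum_(j <- r) u j i) /\
  csum (fun i => \sum_(j <- r) u j i) = \sum_(j <- r) csum (u j).
Proof.
move=> su; elim: r => [|j r [IH1 IH2]].
  have -> : (fun i => \sum_(j <- [::]) u j i) = (fun=> 0 : C).
    by apply/funext => i; rewrite big_nil.
  split; last by rewrite big_nil csum0.
  exists (fun=> 0), 0; split=> [i|s us]; first by rewrite cabs0.
  by rewrite big1.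
have -> : (fun i => \sum_(j0 <- j :: r) u j0 i) = (fun i => u j i + \sum_(j <- r) u j i).
  by apply/funext => i; rewrite big_cons.
split; first exact: summable_famD.
by rewrite csumD // big_cons IH2.
Qed.

Lemma csumB u v : summable_fam u -> summable_fam v ->
  csum (fun i => u i - v i) = csum u - csum v.
Proof.
move=> su sv; rewrite -mulN1r -csumZ // -csumD //; last exact: summable_famZ.
by congr csum; apply/funext => i; rewrite mulN1r.
Qed.

End CsumLinear.

Section SeriesAnalytic.
Variables (R : realType) (n : nat).
Local Notation C := (Cx R).
Variables (a : 'rV[rat]_n -> C) (r B0 B1 : R).
Hypothesis aB0 : sum_bounded (fun q => cabs (a q) * expR (r * qnorm R q)) B0.
Hypothesis aB1 : sum_bounded (fun q => cabs (a q) * qnorm R q * expR (r * qnorm R q)) B1.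

Lemma qexp_strip_le (q : 'rV[rat]_n) z : strip r z -> cabs (qexp q z) <= expR (r * qnorm R q).
Proof.
move=> sz; rewrite (cpt_Re_Im z) cabs_qexp ler_expR.
have := rdot_le_qnorm q (map_mx (@complex.Im R) z); rewrite ler_norml => /andP[h _].
have := ler_wpM2l (qnorm_ge0 R q) (ltW sz : _ <= r).
by rewrite (mulrC r); lra.
Qed.

Lemma qdot_bound (q : 'rV[rat]_n) (h : 'rV[C]_n) (D : R) : (forall j, cabs (h 0 j) <= D) ->
  cabs (qdot q h) <= n%:R * qnorm R q * D.
Proof.
move=> hD; apply: le_trans (cabs_sum _ _ _) _.
have -> : n%:R * qnorm R q * D = \sum_(j < n) (qnorm R q * D).
  by rewrite sumr_const card_ord -[RHS]mulr_natl mulrA.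
apply: ler_sum => j _; rewrite cabsM ratr_C cabs_real; apply: ler_pM => //.
  exact: cabs_ge0.
by have := coord_le_enorm (map_mx (ratr : rat -> R) q) j; rewrite mxE.
Qed.

(** The increment enters through its l1 norm, which coordinatewise bounds control directly; this
    gives openness of the strip. *)
Lemma enormD_le (x y : 'rV[R]_n) : enorm (x + y) <= enorm x + \sum_j `|y 0 j|.
Proof.
have S0 : 0 <= \sum_j `|y 0 j| by exact: sumr_ge0.
rewrite -ler_sqr ?nnegrE ?enorm_ge0 ?addr_ge0 ?enorm_ge0 //.
have yS : enorm y <= \sum_j `|y 0 j|.
  rewrite -ler_sqr ?nnegrE ?enorm_ge0 // enorm_sqr expr2 mulr_suml; apply: ler_sum => j _.
  rewrite -[leLHS]real_normK ?num_real // expr2 ler_wpM2l //.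
  by rewrite (bigD1 j) //= lerDl sumr_ge0.
have h1 := cauchy_schwarz x y; rewrite ler_norml in h1; have /andP[_ h2] := h1.
have E : enorm (x + y) ^+ 2 = enorm x ^+ 2 + 2 * \sum_j x 0 j * y 0 j + enorm y ^+ 2.
  rewrite !enorm_sqr mulr_sumr -!big_split; apply: eq_bigr => j _ /=.
  by rewrite mxE; ring.
rewrite E; have := enorm_ge0 x; have := enorm_ge0 y; nra.
Qed.

Lemma strip_open (z : 'rV[C]_n) : strip r z -> exists2 d : R, 0 < d &
  forall h : 'rV[C]_n, (forall j, cabs (h 0 j) <= d) -> strip r (z + h).
Proof.
rewrite /strip /= => sz; set y := map_mx _ z in sz *.
exists ((r - enorm y) / (2 * (n%:R + 1))) => [|h hd].
  by rewrite divr_gt0 ?subr_gt0 // mulr_gt0 // ltr_wpDl.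
have -> : map_mx (@complex.Im R) (z + h) = y + map_mx (@complex.Im R) h.
  by apply/rowP => j; rewrite !mxE ImD.
apply: le_lt_trans (enormD_le _ _) _.
have : \sum_j `|map_mx (@complex.Im R) h 0 j| <= n%:R * ((r - enorm y) / (2 * (n%:R + 1))).
  rewrite -[n%:R * _]/(n%:R * _) mulr_natl -[n in _ *+ n]card_ord -sumr_const.
  by apply: ler_sum => j _; rewrite mxE; apply: le_trans (abs_Im _) (hd j).
have n1 : 0 < (n%:R : R) + 1 by rewrite ltr_wpDl.
have -> : n%:R * ((r - enorm y) / (2 * (n%:R + 1))) = (r - enorm y) / 2 * (n%:R / (n%:R + 1)).
  by field; lra.
have q1 : (n%:R : R) / (n%:R + 1) <= 1 by rewrite ler_pdivrMr //; lra.
have := ler_wpM2l (_ : 0 <= (r - enorm y) / 2) q1.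
have p : 0 <= (r - enorm y) / 2 by lra.
by move=> /(_ p); lra.
Qed.

Local Notation S := (char_series id a).

Lemma series_summable z : strip r z -> summable_fam (fun q => a q * qexp q z).
Proof.
move=> sz; exists (fun q => cabs (a q) * expR (r * qnorm R q)), B0; split=> // q.
by rewrite cabsM ler_wpM2l ?cabs_ge0 // qexp_strip_le.
Qed.

Lemma series_le z : strip r z -> cabs (S z) <= B0.
Proof.
move=> sz; apply: (@csum_le _ _ _ (fun q => cabs (a q) * expR (r * qnorm R q))) => // q.
by rewrite cabsM ler_wpM2l ?cabs_ge0 // qexp_strip_le.
Qed.

(** The q-th term of the differentiated series in the direction h. *)
Definition dterm (h z : 'rV[C]_n) (q : 'rV[rat]_n) : C :=
  a q * ((0 +i* 1) * qdot q h) * qexp q z.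

Lemma dterm_bound (h z : 'rV[C]_n) (D : R) q : strip r z -> (forall j, cabs (h 0 j) <= D) ->
  cabs (dterm h z q) <= n%:R * D * (cabs (a q) * qnorm R q * expR (r * qnorm R q)).
Proof.
move=> sz hD; rewrite /dterm cabsM [cabs (a q * _)]cabsM [cabs (_ * qdot q h)]cabsM cabs_i mul1r.
have h1 := qdot_bound q hD; have h2 := qexp_strip_le q sz.
have -> : n%:R * D * (cabs (a q) * qnorm R q * expR (r * qnorm R q)) =
  (cabs (a q) * (n%:R * qnorm R q * D)) * expR (r * qnorm R q) by ring.
by apply: ler_pM; [rewrite mulr_ge0 ?cabs_ge0|exact: cabs_ge0|rewrite ler_wpM2l ?cabs_ge0|exact: h2].
Qed.

Lemma dterm_summable (h z : 'rV[C]_n) : strip r z -> summable_fam (dterm h z).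
Proof.
move=> sz; pose D := \sum_j cabs (h 0 j).
have hD j : cabs (h 0 j) <= D.
  by rewrite /D (bigD1 j) //= lerDl sumr_ge0 // => k _; exact: cabs_ge0.
have D0 : 0 <= D by apply: sumr_ge0 => k _; exact: cabs_ge0.
exists (fun q => n%:R * D * (cabs (a q) * qnorm R q * expR (r * qnorm R q))), (n%:R * D * B1).
split=> [q|s us]; first exact: dterm_bound.
by rewrite -mulr_sumr ler_wpM2l ?mulr_ge0 //; exact: aB1.
Qed.

Definition dcoef (z : 'rV[C]_n) : 'rV[C]_n := \row_j csum (dterm (delta_mx 0 j) z).

Lemma lin_form_dcoef z h : strip r z -> lin_form (dcoef z) h = csum (dterm h z).
Proof.
move=> sz; rewrite /lin_form.
transitivity (\sum_j csum (fun q => h 0 j * dterm (delta_mx 0 j) z q)).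
  apply: eq_bigr => j _; rewrite csumZ; last exact: dterm_summable.
  by rewrite mxE mulrC.
rewrite -(summable_fam_csum_sum _ (fun j => summable_famZ (h 0 j) (dterm_summable (delta_mx 0 j) sz))).2.
congr csum; apply/funext => q; rewrite /dterm /qdot.
rewrite mulr_sumr mulr_sumr mulr_suml; apply: eq_bigr => j _.
rewrite (bigD1 j) //= big1 ?addr0 => [|k kj]; last by rewrite mxE (negPf kj) mulr0.
by rewrite mxE !eqxx /=; ring.
Qed.

End SeriesAnalytic.

Section SeriesSolution.
Variables (R : realType) (n : nat).
Local Notation C := (Cx R).
Variables (a : 'rV[rat]_n -> C) (r B0 B1 : R).
Let w0 (q : 'rV[rat]_n) := cabs (a q) * expR (r * qnorm R q).
Let w1 (q : 'rV[rat]_n) := cabs (a q) * qnorm R q * expR (r * qnorm R q).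
Hypothesis aB0 : sum_bounded w0 B0.
Hypothesis aB1 : sum_bounded w1 B1.
Local Notation S := (char_series id a).

(** A first-order bound valid however large |q| D is; it controls the tail of the series, while
    [char_increment_quad] handles finitely many terms. *)
Lemma char_increment_le (q : 'rV[rat]_n) (z h : 'rV[C]_n) (D : R) :
  strip r z -> strip r (z + h) -> (forall j, cabs (h 0 j) <= D) ->
  cabs (a q * qexp q (z + h) - a q * qexp q z - dterm a h z q) <= 3 * n%:R * D * w1 q.
Proof.
move=> sz szh hD.
apply: le_trans (cabsB _ _) _.
have d1 := dterm_bound a q sz hD.
have -> : 3 * n%:R * D * w1 q = 2 * (n%:R * D * w1 q) + n%:R * D * w1 q by ring.
apply: lerD => //.
have -> : a q * qexp q (z + h) - a q * qexp q z = a q * (qexp q z * (qexp q h - 1)).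
  by rewrite qexpDr; ring.
set u := (0 +i* 1) * qdot q h : C.
have uD : cabs u <= n%:R * qnorm R q * D by rewrite /u cabsM cabs_i mul1r qdot_bound.
have E : cabs (qexp q z * (qexp q h - 1)) <= 2 * cabs u * expR (r * qnorm R q).
  rewrite cabsM; have H := cabs_cexp_sub1 u.
  apply: le_trans (ler_wpM2l (cabs_ge0 (qexp q z)) H) _.
  have -> : cabs (qexp q z) * (2 * cabs u * Num.max 1 (expR (complex.Re u))) =
    2 * cabs u * (cabs (qexp q z) * Num.max 1 (expR (complex.Re u))) by ring.
  apply: ler_wpM2l; first by rewrite mulr_ge0 ?cabs_ge0.
  have h1 := qexp_strip_le q sz; have h2 := qexp_strip_le q szh.
  rewrite qexpDr cabsM [cabs (qexp q h)]cabs_cexp -/u in h2.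
  by rewrite /Num.max; case: ifP => _; rewrite ?mulr1.
rewrite cabsM; apply: le_trans (ler_wpM2l (cabs_ge0 _) E) _.
have -> : 2 * (n%:R * D * w1 q) = cabs (a q) * (2 * (n%:R * qnorm R q * D) * expR (r * qnorm R q)).
  by rewrite /w1; ring.
by rewrite ler_wpM2l ?cabs_ge0 // ler_wpM2r ?expR_ge0 // ler_wpM2l.
Qed.

Lemma char_increment_quad (q : 'rV[rat]_n) (z h : 'rV[C]_n) (D : R) :
  strip r z -> (forall j, cabs (h 0 j) <= D) -> n%:R * qnorm R q * D <= 1 / 2 -> 0 <= D ->
  cabs (a q * qexp q (z + h) - a q * qexp q z - dterm a h z q) <=
    (w0 q * (6 * (n%:R * qnorm R q) ^+ 2)) * D ^+ 2.
Proof.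
move=> sz hD qD D0; set u := (0 +i* 1) * qdot q h : C.
have uD : cabs u <= n%:R * qnorm R q * D by rewrite /u cabsM cabs_i mul1r qdot_bound.
have -> : a q * qexp q (z + h) - a q * qexp q z - dterm a h z q =
    (a q * qexp q z) * (cexp u - 1 - u).
  by rewrite qexpDr /dterm -/u; rewrite -[qexp q h]/(cexp u); ring.
rewrite cabsM; have H := cexp_quad (le_trans uD qD).
have h1 : cabs (a q * qexp q z) <= w0 q.
  by rewrite cabsM /w0 ler_wpM2l ?cabs_ge0 // qexp_strip_le.
have h2 : cabs (cexp u - 1 - u) <= 6 * (n%:R * qnorm R q) ^+ 2 * D ^+ 2.
  apply: le_trans H _; rewrite -mulrA -exprMn ler_wpM2l // ler_sqr ?nnegrE ?cabs_ge0 //.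
  by rewrite !mulr_ge0 // qnorm_ge0.
rewrite -mulrA; apply: ler_pM => //; exact: cabs_ge0.
Qed.

(** The first moment sum |a_q| |q| e^(r|q|) suffices on the full strip of radius r: the tail
    contributes an error linear in D with a small coefficient, and the finitely many other terms
    contribute O(D^2). *)
Lemma series_differentiable z : strip r z ->
  differentiable S z /\ 'd S z = lin_form (dcoef a z) :> ('rV[C]_n -> C^o).
Proof.
move=> sz; apply: differentiable_of_approx => e e0.
(* Makes the tail error 3 n D e1 at most e D / 2. *)
pose e1 := e / (2 * (3 * n%:R + 1)).
have n3 : 0 < 3 * (n%:R : R) + 1 by rewrite ltr_wpDl // mulr_ge0.
have e10 : 0 < e1 by rewrite divr_gt0 // mulr_gt0.
have [A tA] := sum_bounded_tail aB1 e10.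
pose K := \sum_(q <- A) w0 q * (6 * (n%:R * qnorm R q) ^+ 2).
have w00 q : 0 <= w0 q by rewrite mulr_ge0 ?cabs_ge0 ?expR_ge0.
have K0 : 0 <= K.
  by apply: sumr_ge0 => q _; rewrite mulr_ge0 // mulr_ge0 // exprn_ge0 // mulr_ge0 // qnorm_ge0.
pose Q := \sum_(q <- A) n%:R * qnorm R q.
have nq0 (q : 'rV[rat]_n) : 0 <= n%:R * qnorm R q by rewrite mulr_ge0 // qnorm_ge0.
have Q0 : 0 <= Q by apply: sumr_ge0.
have [d1 d10 Hd1] := strip_open sz.
exists (Num.min d1 (Num.min (1 / (2 * (Q + 1))) (e / (2 * (K + 1))))).
  by rewrite !lt_min d10 !divr_gt0 // ?mulr_gt0 //; lra.
move=> h D hD; rewrite !le_min => /andP[Dd1 /andP[DQ DK]] D0.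
have szh : strip r (z + h) by apply: Hd1 => j; exact: le_trans (hD j) Dd1.
pose E q := a q * qexp q (z + h) - a q * qexp q z - dterm a h z q.
have sE : S (z + h) - S z - lin_form (dcoef a z) h = csum E.
  have s1 := series_summable aB0 szh; have s2 := series_summable aB0 sz.
  have s3 := dterm_summable aB1 h sz.
  rewrite (lin_form_dcoef aB1 h sz) /char_series -csumB // -csumB //.
  have -> : (fun i => a i * qexp (id i) (z + h) - a i * qexp (id i) z) =
     (fun i => a i * qexp i (z + h) + (-1) * (a i * qexp i z)).
    by apply/funext => i; rewrite mulN1r.
  exact: summable_famD s1 (summable_famZ _ s2).
rewrite sE.
have bE q := char_increment_le q sz szh hD.
have cD0 : 0 <= 3 * n%:R * D by rewrite !mulr_ge0.
have wB : sum_bounded (fun q => 3 * n%:R * D * w1 q) (3 * n%:R * D * B1).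
  by move=> s us; rewrite -mulr_sumr ler_wpM2l //; exact: aB1.
have wT : tail_le (fun q => 3 * n%:R * D * w1 q) A (3 * n%:R * D * e1).
  by move=> s us sA; rewrite -mulr_sumr ler_wpM2l //; exact: tA.
have h1 := csum_approx bE wB wT (fsubset_refl A).
have h2 : cabs (\sum_(q <- A) E q) <= K * D ^+ 2.
  apply: le_trans (cabs_sum _ _ _) _; rewrite /K mulr_suml big_seq [leRHS]big_seq.
  apply: ler_sum => q qA; apply: char_increment_quad => //.
  have qQ : n%:R * qnorm R q <= Q.
    by rewrite /Q (big_fsetD1 q) //= lerDl sumr_ge0.
  apply: le_trans (ler_pM (nq0 q) D0 qQ DQ) _.
  have -> : Q * (1 / (2 * (Q + 1))) = 1 / 2 * (Q / (Q + 1)) by field; lra.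
  by rewrite ler_piMr ?divr_ge0 // ler_pdivrMr; lra.
have h3 : K * D ^+ 2 <= e / 2 * D.
  rewrite expr2 mulrA ler_wpM2r //.
  apply: le_trans (ler_wpM2l K0 DK) _.
  have -> : K * (e / (2 * (K + 1))) = e / 2 * (K / (K + 1)) by field; lra.
  by rewrite ler_piMr ?divr_ge0 ?(ltW e0) // ler_pdivrMr; lra.
have h4 : 3 * n%:R * D * e1 <= e / 2 * D.
  have -> : 3 * n%:R * D * e1 = e / 2 * D * (3 * n%:R / (3 * n%:R + 1)) by rewrite /e1; field; lra.
  by rewrite ler_piMr ?mulr_ge0 ?divr_ge0 ?(ltW e0) // ler_pdivrMr //; lra.
have := cabsD (csum E - \sum_(q <- A) E q) (\sum_(q <- A) E q); rewrite subrK.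
have -> : e * D = e / 2 * D + e / 2 * D by field.
move: h1; lra.
Qed.

Lemma common_denominators (s : seq 'rV[rat]_n) : exists2 N, (0 < N)%N &
  forall q, q \in s -> forall j, exists k : int, q 0 j * N%:R = k%:~R.
Proof.
elim: s => [|q s [N N0 IH]]; first by exists 1%N.
have [M M0 HM] := common_denominator q.
exists (M * N)%N => [|p]; first by rewrite muln_gt0 M0.
rewrite inE => /orP[/eqP->|ps] j; first by apply: HM; rewrite dvdn_mulr.
have [k pk] := IH p ps j; exists (k * M%:Z).
by rewrite mulnC natrM mulrA pk rmorphM.
Qed.

(** Up to a tail that is small on the whole strip, the series is a finite sum of characters, which
    is exactly periodic once N clears all its denominators. *)
Lemma series_limit_periodic : limit_periodic r S.
Proof.
move=> e e0; have e3 : 0 < e / 3 by lra.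
have [A tA] := sum_bounded_tail aB0 e3.
have [N N0 HN] := common_denominators (enum_fset A).
exists N => // m z sz.
have H x : strip r x -> cabs (S x - \sum_(q <- A) a q * qexp q x) <= e / 3.
  move=> sx; apply: (@csum_approx _ _ _ w0 _ B0 A A) => // q.
  by rewrite cabsM ler_wpM2l ?cabs_ge0 // qexp_strip_le.
have h1 := H z sz; have h2 := H _ (strip_latC N m sz).
have E : \sum_(q <- A) a q * qexp q (z + latC R N m) = \sum_(q <- A) a q * qexp q z.
  rewrite big_seq [RHS]big_seq; apply: eq_bigr => q qA.
  by rewrite qexp_lattice //; exact: HN.
rewrite E in h2; rewrite -/(latC R N m).
have := cabs_distD (\sum_(q <- A) a q * qexp q z) (S (z + latC R N m)) (S z).
rewrite (cabsC (\sum_(q <- A) a q * qexp q z) (S z)); lra.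
Qed.

Lemma series_CQ : CQ r S.
Proof.
split.
- by move=> z sz; case: (series_differentiable sz).
- apply: (@le_lt_trans _ _ B0%:E); last exact: ltry.
  by apply: ge_ereal_sup => _ [z sz <-]; rewrite lee_fin (series_le aB0).
- exact: series_limit_periodic.
Qed.

Lemma series_snorm : (snorm r S <= B0%:E)%E.
Proof. by apply: ge_ereal_sup => _ [z sz <-]; rewrite lee_fin (series_le aB0). Qed.

Lemma series_diffE z h : strip r z -> 'd S z h = csum (dterm a h z).
Proof.
by move=> sz; case: (series_differentiable sz) => _ ->; rewrite (lin_form_dcoef aB1).
Qed.

(** Testing the gradient v against h = conj v gives |v|^2 as a single series, in which |q.h| <= |q|
    |v| by Cauchy-Schwarz; hence |v|^2 <= |v| B1. The Euclidean norm is thus bounded without a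
    dimensional factor. *)
Lemma cenorm_dcoef z : strip r z -> cenorm (dcoef a z) <= B1.
Proof.
move=> sz; set v := dcoef a z; set N := cenorm v.
have N0 : 0 <= N by exact: sqrtr_ge0.
have NE : N ^+ 2 = \sum_j cabs (v 0 j) ^+ 2.
  by rewrite sqr_sqrtr // sumr_ge0 // => j _; exact: sqr_ge0.
have B10 : 0 <= B1 by have := aB1 (isT : uniq [::]); rewrite big_nil.
pose h : 'rV[C]_n := \row_j conjc (v 0 j).
have hv j : cabs (h 0 j) = cabs (v 0 j).
  by rewrite mxE; case: (v 0 j) => x y; rewrite /cabs /= sqrrN.
have E : (N ^+ 2)%:C = csum (dterm a h z) :> C.
  rewrite -(lin_form_dcoef aB1 h sz) NE rmorph_sum; apply: eq_bigr => j _.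
  rewrite -/v (_ : h 0 j = conjc (v 0 j)); last by rewrite mxE.
  by rewrite cabs_sqr; case: (v 0 j) => x y; apply: complexP => /=; ring.
have qh q : cabs (qdot q h) <= qnorm R q * N.
  apply: le_trans (cabs_sum _ _ _) _.
  have := cauchy_schwarz (\row_j `|ratr (q 0 j)| : 'rV[R]_n) (\row_j cabs (v 0 j)).
  have -> : enorm (\row_j `|ratr (q 0 j)| : 'rV[R]_n) = qnorm R q.
    by congr Num.sqrt; apply: eq_bigr => j _; rewrite !mxE real_normK ?num_real.
  have -> : enorm (\row_j cabs (v 0 j)) = N.
    by congr Num.sqrt; apply: eq_bigr => j _; rewrite mxE.
  move=> CS; apply: le_trans (le_trans (ler_norm _) CS).
  by apply: ler_sum => j _; rewrite cabsM ratr_C cabs_real hv !mxE.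
have : cabs (csum (dterm a h z)) <= N * B1.
  apply: (@csum_le _ _ _ (fun q => N * w1 q)) => [q|s us]; last first.
    by rewrite -mulr_sumr ler_wpM2l //; exact: aB1.
  rewrite /dterm cabsM [cabs (a q * _)]cabsM [cabs (_ * qdot q h)]cabsM cabs_i mul1r.
  have -> : N * w1 q = cabs (a q) * (qnorm R q * N) * expR (r * qnorm R q) by rewrite /w1; ring.
  apply: ler_pM; [by rewrite mulr_ge0 ?cabs_ge0|exact: cabs_ge0| |exact: qexp_strip_le].
  by rewrite ler_wpM2l ?cabs_ge0.
rewrite -E cabs_real ger0_norm ?exprn_ge0 // expr2.
have [->//|Nn0] := eqVneq N 0.
by rewrite ler_pM2l // lt0r Nn0.
Qed.

End SeriesSolution.

(** * Summation over the layers *)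

Section LayerSums.
Variables (R : realType) (n : nat).
Local Notation C := (Cx R).
Variables (rho delta gamma : R) (omega : 'rV[R]_n) (c : 'rV[rat]_n -> C).
Hypotheses (gamma0 : 0 < gamma) (delta0 : 0 < delta).
Hypothesis dioph : diophantine gamma omega.

(** Solves i (omega.q) a_q = c_q term by term; at q = 0 the inverse of 0 is 0, so a_0 = 0. *)
Definition sol_coef (q : 'rV[rat]_n) : C := c q / ((0 +i* 1) * (rdot q omega)%:C).

Definition sol_weight (p : nat) (q : 'rV[rat]_n) : R :=
  cabs (sol_coef q) * qnorm R q ^+ p * expR ((rho - delta) * qnorm R q).

Lemma sol_weight0 p : sol_weight p 0 = 0.
Proof.
rewrite /sol_weight /sol_coef (_ : rdot 0 omega = 0).
  by rewrite mulr0 invr0 mulr0 cabs0 !mul0r.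
by rewrite /rdot big1 // => j _; rewrite mxE rmorph0 mul0r.
Qed.

Lemma rdot_lat_freq L (k : 'rV[int]_n) : (0 < L)%N ->
  rdot (lat_freq L k) omega = (\sum_j omega 0 j * (k 0 j)%:~R) / L%:R.
Proof.
move=> L0; rewrite /rdot mulr_suml; apply: eq_bigr => j _.
by rewrite mxE rmorphM fmorphV /= ratr_int ratr_nat; ring.
Qed.

Lemma small_divisor L (k : 'rV[int]_n) : (0 < L)%N -> k != 0 ->
  `|rdot (lat_freq L k) omega|^-1 <= L%:R * enorm (map_mx (intr : int -> R) k) ^+ n / gamma.
Proof.
move=> L0 k0; rewrite rdot_lat_freq //; have := dioph k0.
set N := enorm _; set w := \sum_j _ => h.
have Lr : 0 < (L%:R : R) by rewrite ltr0n.
have Np : 0 < N.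
  rewrite lt0r enorm_ge0 andbT; apply/eqP => NN; case/eqP: k0; apply/rowP => j; rewrite mxE.
  have := coord_le_enorm (map_mx (intr : int -> R) k) j.
  by rewrite -/N NN normr_le0 mxE intr_eq0 => /eqP.
have Nn : 0 < N ^+ n by rewrite exprn_gt0.
have w0 : 0 < `|w| by apply: lt_trans h; rewrite divr_gt0.
rewrite normrM normfV (ger0_norm (ltW Lr)) invfM invrK mulrC -mulrA ler_pM2l //.
rewrite ler_pdivlMr // -ler_pdivlMl ?invr_gt0 // invrK -ler_pdivrMr //.
exact: ltW.
Qed.

(** The small divisor contributes L |k|^n / gamma and |q|^p contributes |k|^p / L^p. The growth rate
    rho - delta of the weight against the decay rate rho - delta/2 leaves delta/2. *)
Lemma sol_weight_term p L H (k : 'rV[int]_n) : (0 < L)%N -> k != 0 -> 0 <= H ->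
  cabs (c (lat_freq L k)) <= H * expR (- ((rho - delta / 2) * qnorm R (lat_freq L k))) ->
  sol_weight p (lat_freq L k) <= H * L%:R / (gamma * L%:R ^+ p) *
    (enorm (map_mx (intr : int -> R) k) ^+ (n + p) *
     expR (- (delta / 2 / L%:R * enorm (map_mx (intr : int -> R) k)))).
Proof.
move=> L0 k0 H0 cH; have Lr : 0 < (L%:R : R) by rewrite ltr0n.
have sd := small_divisor L0 k0.
rewrite /sol_weight /sol_coef cabsM cabsV cabsM cabs_i mul1r cabs_real.
set q := lat_freq L k in cH sd *; set N := enorm _ in sd *.
have qN : qnorm R q = N / L%:R by exact: qnorm_lat_freq.
have N0 : 0 <= N by exact: enorm_ge0.
have LN0 : 0 <= L%:R * N ^+ n / gamma.
  by rewrite divr_ge0 ?(ltW gamma0) // mulr_ge0 ?exprn_ge0.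
have h1 : cabs (c q) * `|rdot q omega|^-1 <=
    H * expR (- ((rho - delta / 2) * qnorm R q)) * (L%:R * N ^+ n / gamma).
  by apply: ler_pM => //; exact: cabs_ge0.
have E0 : 0 <= qnorm R q ^+ p * expR ((rho - delta) * qnorm R q).
  by rewrite mulr_ge0 ?exprn_ge0 ?qnorm_ge0 ?expR_ge0.
rewrite -mulrA; apply: le_trans (ler_wpM2r E0 h1) _.
have -> : - (delta / 2 / L%:R * N) = - ((rho - delta / 2) * qnorm R q) + (rho - delta) * qnorm R q.
  by rewrite qN; field; rewrite lt0r_neq0.
rewrite expRD exprD qN expr_div_n le_eqVlt; apply/orP; left; apply/eqP.
by field; rewrite expf_neq0 ?lt0r_neq0.
Qed.

(** With t = delta / (2L) the lattice sum gives (2L / delta)^(2n+p), and the prefactor L^(1-p) turns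
    the power of L into L^(2n+1) whatever p is: hence the same weight for f and for Df. *)
Lemma sol_weight_layer p K L H (A : seq 'rV[rat]_n) :
  (forall (t : R) (s : seq 'rV[int]_n), 0 < t -> uniq s -> (forall k, k \in s -> k != 0) ->
    \sum_(k <- s) enorm (map_mx (intr : int -> R) k) ^+ (n + p) *
      expR (- (t * enorm (map_mx intr k))) <= K / t ^+ (n + p + n)) ->
  0 <= K -> (0 < L)%N -> 0 <= H -> uniq A ->
  (forall q, q \in A -> in_lattice L q /\
     cabs (c q) <= H * expR (- ((rho - delta / 2) * qnorm R q))) ->
  \sum_(q <- A) sol_weight p q <=
    K * 2 ^+ (n + p + n) / (gamma * delta ^+ (n + p + n)) * (L%:R ^+ n.*2.+1 * H).
Proof.
move=> HK K0 L0 H0 uA HA; have Lr : 0 < (L%:R : R) by rewrite ltr0n.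
have [kap Hkap] : {f : 'rV[rat]_n -> 'rV[int]_n & forall q, in_lattice L q -> q = lat_freq L (f q)}.
  apply: (@choice _ _ (fun q k => in_lattice L q -> q = lat_freq L k)) => q.
  have [[k qk]|nq] := pselect (in_lattice L q); last by exists 0.
  by exists k.
(* The frequency 0 carries no weight and is removed, as the lattice sum runs over nonzero k. *)
pose A' := [seq q <- A | q != 0].
have -> : \sum_(q <- A) sol_weight p q = \sum_(q <- A') sol_weight p q.
  rewrite /A' big_filter [RHS]big_mkcond; apply: eq_bigr => q _.
  by case: eqP => [->|_] //=; rewrite sol_weight0.
have inA' q : q \in A' -> [/\ q = lat_freq L (kap q), kap q != 0 &
     cabs (c q) <= H * expR (- ((rho - delta / 2) * qnorm R q))].
  rewrite mem_filter => /andP[q0 /HA[qL qc]]; have qE := Hkap _ qL; split=> //.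
  apply: contraNneq q0 => k0; rewrite qE k0; apply/eqP/rowP => j.
  by rewrite !mxE mul0r.
have kinj : {in A' &, injective kap}.
  by move=> q q' /inA'[qE _ _] /inA'[qE' _ _] kk; rewrite qE qE' kk.
pose X := H * L%:R / (gamma * L%:R ^+ p).
have X0 : 0 <= X by rewrite divr_ge0 ?mulr_ge0 ?exprn_ge0 // ltW.
pose t := delta / 2 / L%:R; have t0 : 0 < t by rewrite !divr_gt0.
apply: (@le_trans _ _ (\sum_(k <- map kap A') X * (enorm (map_mx (intr : int -> R) k) ^+ (n + p) *
     expR (- (t * enorm (map_mx (intr : int -> R) k)))))).
  rewrite big_map big_seq [leRHS]big_seq; apply: ler_sum => q /inA'[qE k0 qc].
  by rewrite [in leLHS]qE; apply: sol_weight_term => //; rewrite -qE.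
rewrite -mulr_sumr; apply: le_trans (ler_wpM2l X0 (HK t _ t0 _ _)) _.
- by rewrite map_inj_in_uniq // filter_uniq.
- by move=> k /mapP[q /inA'[_ k0 _] ->].
have -> : (L%:R : R) ^+ n.*2.+1 = L%:R * (L%:R ^+ n * L%:R ^+ n) by rewrite exprS -addnn exprD.
have LE : (L%:R : R) ^+ (n + p + n) = L%:R ^+ n * L%:R ^+ p * L%:R ^+ n by rewrite !exprD.
rewrite /X /t !expr_div_n LE le_eqVlt; apply/orP; left; apply/eqP.
by field; rewrite !expf_neq0 ?lt0r_neq0.
Qed.

(** The function [lay] charges every q to one layer, so the layers partition any finite set of
    frequencies and their bounds add up. *)
Lemma sol_weight_total p Cst (S : R) (T : nat -> R) (lay : 'rV[rat]_n -> nat) :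
  (forall (i : nat) (A : seq 'rV[rat]_n), uniq A -> (forall q, q \in A -> lay q = i) ->
     \sum_(q <- A) sol_weight p q <= Cst * T i) ->
  0 <= Cst -> (forall M, \sum_(i < M) T i <= S) ->
  sum_bounded (sol_weight p) (Cst * S).
Proof.
move=> H C0 HT A uA.
pose M := (\max_(q <- A) lay q).+1.
have qM q : q \in A -> (lay q < M)%N.
  by move=> qA; rewrite ltnS (big_rem q) //= leq_maxl.
have -> : \sum_(q <- A) sol_weight p q =
    \sum_(i < M) \sum_(q <- [seq q <- A | lay q == i]) sol_weight p q.
  under [RHS]eq_bigr do rewrite big_filter big_mkcond.
  rewrite exchange_big big_seq [RHS]big_seq; apply: eq_bigr => q qA.
  rewrite (bigD1 (Ordinal (qM q qA))) //= eqxx big1 ?addr0 // => i iq.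
  by case: eqP => // li; case/eqP: iq; apply/val_inj.
apply: le_trans (ler_wpM2l C0 (HT M)); rewrite mulr_sumr; apply: ler_sum => i _.
by apply: H; [exact: filter_uniq|move=> q; rewrite mem_filter => /andP[/eqP]].
Qed.

End LayerSums.

(** * Layers of g, its Pontryagin series and the solution *)

Section MainAux.
Variable R : realType.
Local Notation C := (Cx R).

Lemma snorm_ge0 n (rho : R) (f : 'rV[C]_n -> C^o) : 0 < rho -> (0 <= snorm rho f)%E.
Proof.
move=> rho0; have s0 : strip rho (cpt (0 : 'rV[R]_n) 0).
  by apply/strip_cpt; rewrite /enorm big1 ?sqrtr0 // => j _; rewrite mxE expr0n.
by apply: le_trans (snorm_ub f s0); rewrite lee_fin cabs_ge0.
Qed.

Lemma scaled_fin_num (x : R) (y : \bar R) : 0 < x -> (0 <= y)%E -> (x%:E * y < +oo)%E ->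
  y = (fine y)%:E.
Proof.
move=> x0; case: y => [r| |] //= _.
by rewrite gt0_muley ?ltxx // lte_fin.
Qed.

(** Index 0 is g_{n_1} itself, so that the isolated first term of the norm and the differences form
    one sequence. *)
Definition layer_norm n (rho : R) (s : nat -> nat) (g : 'rV[C]_n -> C^o) (i : nat) : \bar R :=
  if i is i'.+1 then snorm rho (fun z => (periodic_part g (s i'.+1) z - periodic_part g (s i') z)%R)
  else snorm rho (periodic_part g (s 0%N)).

Lemma layer_norm_ge0 n (rho : R) s (g : 'rV[C]_n -> C^o) i : 0 < rho ->
  (0 <= layer_norm rho s g i)%E.
Proof. by case: i => [|i] rho0; exact: snorm_ge0. Qed.

Lemma layer_norm_fin n (rho : R) s (g : 'rV[C]_n -> C^o) : 0 < rho ->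
  (forall i, (0 < s i)%N) -> (snormS rho s g < +oo)%E ->
  [/\ 0 <= fine (snormS rho s g), snormS rho s g = (fine (snormS rho s g))%:E,
      forall i, layer_norm rho s g i = (fine (layer_norm rho s g i))%:E &
      forall M, \sum_(i < M) (s i)%:R ^+ n.*2.+1 * fine (layer_norm rho s g i)
                  <= fine (snormS rho s g)].
Proof.
move=> rho0 s0 fin.
pose T i : \bar R := (((s i)%:R ^+ n.*2.+1)%:E * layer_norm rho s g i)%E.
have p0 i : 0 < ((s i)%:R : R) ^+ n.*2.+1 by rewrite exprn_gt0 // ltr0n.
have T0 i : (0 <= T i)%E by rewrite mule_ge0 ?layer_norm_ge0 // lee_fin ltW.
have partial M : (\sum_(i < M) T i <= snormS rho s g)%E.
  case: M => [|M].
    rewrite big_ord0; apply: adde_ge0; first exact: (T0 0%N).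
    by apply: nneseries_ge0 => i _ _; exact: (T0 i.+1).
  rewrite big_ord_recl; apply: leeD => //.
  rewrite -(big_mkord xpredT (fun i => T i.+1)).
  by apply: (@nneseries_lim_ge R (fun i => T i.+1) xpredT 0%N M) => i _ _; exact: T0.
have S0 : (0 <= snormS rho s g)%E by have := partial 0%N; rewrite big_ord0.
have Sfin : snormS rho s g = (fine (snormS rho s g))%:E by rewrite fineK // ge0_fin_numE.
have Hfin i : layer_norm rho s g i = (fine (layer_norm rho s g i))%:E.
  apply: (scaled_fin_num (p0 i)); first exact: layer_norm_ge0.
  apply: le_lt_trans fin; apply: le_trans (partial i.+1).
  rewrite big_ord_recr /= leeDr //; exact: sume_ge0.
split=> //; first exact: fine_ge0.
move=> M; rewrite -lee_fin -Sfin; apply: le_trans (partial M).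
rewrite -sumEFin; apply: lee_sum => i _.
by rewrite EFinM -Hfin.
Qed.

Lemma in_lattice_cofinal n (s : nat -> nat) (q : 'rV[rat]_n) : (forall i, (0 < s i)%N) ->
  cofinal_div s -> exists i, in_lattice (s i) q.
Proof.
move=> s0 cof; have [N N0 HN] := common_denominator q; have [i Ni] := cof N N0.
have [k Hk] := fin_all_exists (HN _ Ni).
exists i, (\row_j k j); apply/rowP => j; rewrite !mxE -Hk mulfK //.
by rewrite pnatr_eq0 -lt0n.
Qed.

(** Descend along the sequence to an index whose lattice contains q and which is either the first
    one or has a predecessor whose lattice does not; there the layer has coefficient g_q at q. *)
Lemma pcoef_layer n (rho : R) (g : 'rV[C]_n -> C^o) s t q : 0 < rho -> CQ rho g ->
  (forall i, (0 < s i)%N) -> cofinal_div s ->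
  (forall i, layer_norm rho s g i = (fine (layer_norm rho s g i))%:E) -> 0 <= t < rho ->
  exists i, in_lattice (s i) q /\
    cabs (pcoef g q) <= fine (layer_norm rho s g i) * expR (- (t * qnorm R q)).
Proof.
move=> rho0 gCQ s0 cof Hfin t01.
have fini i : (layer_norm rho s g i < +oo)%E by rewrite Hfin ltry.
have [i0] := in_lattice_cofinal q s0 cof.
elim: i0 => [|i IH] qi; first by exists 0%N; split=> //; exact: (pcoef_le_first rho0 gCQ (s0 0%N) qi (fini 0%N)).
have [|nqi] := pselect (in_lattice (s i) q); first exact: IH.
exists i.+1; split=> //.
exact: (pcoef_le_layer rho0 gCQ (s0 i) (s0 i.+1) nqi qi (fini i.+1)).
Qed.

Lemma rdot_neq0 n gamma (omega : 'rV[R]_n) (q : 'rV[rat]_n) : 0 < gamma ->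
  diophantine gamma omega -> q != 0 -> rdot q omega != 0.
Proof.
move=> gamma0 dioph q0; have [N N0 HN] := common_denominator q.
have [k Hk] := fin_all_exists (HN _ (dvdnn N)).
have qE : q = lat_freq N (\row_j k j).
  by apply/rowP => j; rewrite !mxE -Hk mulfK // pnatr_eq0 -lt0n.
have k0 : \row_j k j != 0.
  apply: contraNneq q0 => kE; rewrite qE kE; apply/eqP/rowP => j.
  by rewrite !mxE mul0r.
rewrite qE rdot_lat_freq // mulf_neq0 // ?invr_eq0 ?pnatr_eq0 -?lt0n //.
have := dioph _ k0; apply: contraTneq => ->.
by rewrite normr0 -leNgt divr_ge0 ?(ltW gamma0) // exprn_ge0 // enorm_ge0.
Qed.

(* On each real slice the difference of [g] and its absolutely convergent
   Pontryagin series has vanishing coefficients. *)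
Lemma pontryagin_series_eq n (rho r B : R) (g : 'rV[C]_n -> C^o) z : CQ rho g -> r < rho ->
  sum_bounded (fun q => cabs (pcoef g q) * expR (r * qnorm R q)) B ->
  strip r z -> char_series id (pcoef g) z = g z.
Proof.
move=> gCQ rr bB sz.
pose y := map_mx (@complex.Im R) z; pose x0 := map_mx (@complex.Re R) z.
have yr : enorm y < r by exact: sz.
have yrho : enorm y < rho by exact: lt_trans rr.
have zE : z = cpt x0 y by exact: cpt_Re_Im.
have bB' : sum_bounded (fun q => cabs (pcoef g q) * expR (- rdot (id q) y)) B.
  move=> A uA; apply: le_trans (bB A uA); apply: ler_sum => q _.
  rewrite ler_wpM2l ?cabs_ge0 // ler_expR.
  have := rdot_le_qnorm q y; rewrite ler_norml => /andP[h _].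
  have := ler_wpM2l (qnorm_ge0 R q) (ltW yr); rewrite (mulrC r); lra.
pose G x : C := char_series id (pcoef g) (cpt x y).
have aG : apf G := apf_char_series bB'.
have ag := apf_slice gCQ yrho.
have au : apf (fun x => (g (cpt x y) : C) - G x) by exact: apfB.
have := mean0_eq0 au; move/(_ _ x0); rewrite /G -zE => H.
apply/esym/eqP; rewrite -subr_eq0; apply/eqP; apply: H => q.
have aE := apf_qexp q y.
(* The characters on the real axis and on the slice at height y differ by a constant factor; the
   double sign matches [pcoef_mean] and [mean_char_series_in] at -q. *)
have -> : (fun x => ((g (cpt x y) : C) - G x) * qexp q (cpt x 0)) =
   (fun x => qexp q (cpt 0 (- y)) * (g (cpt x y) * qexp (- - q) (cpt x y) -
       G x * qexp (- - q) (cpt x y))).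
  apply/funext => x; rewrite opprK.
  have -> : cpt x 0 = cpt x y + cpt 0 (- y) by rewrite -cptD addr0 subrr.
  by rewrite qexpDr; ring.
have a1 : apf (fun x => (g (cpt x y) : C) * qexp (- - q) (cpt x y)).
  by apply: apfM => //; exact: apf_qexp.
have a2 : apf (fun x => G x * qexp (- - q) (cpt x y)).
  by apply: apfM => //; exact: apf_qexp.
have m1 := pcoef_mean gCQ (- q) yrho.
have m2 := mean_char_series_in bB' (- q) (@inj_id _).
apply: etrans (meanZ _ (apfB a1 a2)) _; apply/eqP; rewrite mulf_eq0; apply/orP; right.
apply/eqP; apply: etrans (meanB a1 a2) _.
by apply: etrans (congr2 (fun u v : C => u - v) (esym m1) m2) _; exact: subrr.
Qed.

End MainAux.

Theorem theorem2p3 (R : realType) (n : nat) (n_gt0 : (0 < n)%N) :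
  exists k : R,
  forall (rho : R) (g : 'rV[Cx R]_n -> (Cx R)^o) (gamma : R) (omega : 'rV[R]_n)
      (s : nat -> nat),
    0 < rho ->
    CQ rho g ->
    pcoef g 0 = 0 ->
    0 < gamma ->
    diophantine gamma omega ->
    (forall i, (0 < s i)%N) ->
    cofinal_div s ->
    (forall i, (s i %| s i.+1)%N) ->
    (snormS rho s g < +oo)%E ->
    forall delta : R, 0 < delta < rho ->
      exists f : 'rV[Cx R]_n -> (Cx R)^o,
        [/\ CQ (rho - delta) f,
            forall z, strip (rho - delta) z ->
              'd f z (map_mx (real_complex R) omega) = g z,
            (snorm (rho - delta) f
               <= (k / (gamma * delta ^+ n.*2))%:E * snormS rho s g)%E
          & (dsnorm (rho - delta) f
               <= (k / (gamma * delta ^+ n.*2.+1))%:E * snormS rho s g)%E].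
Proof.
(* The power n comes from the small divisor; the additional 0 or 1 is for f or Df. *)
have [K0 K00 HK0] := lattice_sum_bound R n (n + 0).
have [K1 K10 HK1] := lattice_sum_bound R n (n + 1).
pose k0 := K0 * 2 ^+ (n + 0 + n); pose k1 := K1 * 2 ^+ (n + 1 + n).
have k00 : 0 <= k0 by rewrite mulr_ge0 // exprn_ge0.
have k10 : 0 <= k1 by rewrite mulr_ge0 // exprn_ge0.
exists (k0 + k1) => rho g gamma omega s rho0 gCQ g0 gamma0 dioph s0 cof _ fin delta /andP[delta0 drho].
have [S0 SE Hfin HS] := layer_norm_fin rho0 s0 fin.
set S := fine (snormS rho s g) in S0 SE HS *.
pose H i := fine (layer_norm rho s g i).
have H0 i : 0 <= H i by apply: fine_ge0; exact: layer_norm_ge0.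
have r0 : 0 < rho - delta by lra.
have t01 : 0 <= rho - delta / 2 < rho by apply/andP; split; lra.
have [lay Hlay] : {l : 'rV[rat]_n -> nat & forall q, in_lattice (s (l q)) q /\
    cabs (pcoef g q) <= H (l q) * expR (- ((rho - delta / 2) * qnorm R q))}.
  apply: (@choice _ _ (fun q i => in_lattice (s i) q /\
    cabs (pcoef g q) <= H i * expR (- ((rho - delta / 2) * qnorm R q)))) => q.
  exact: (pcoef_layer q rho0 gCQ s0 cof Hfin t01).
have total p K : 0 <= K ->
    (forall (t : R) (A : seq 'rV[int]_n), 0 < t -> uniq A -> (forall k, k \in A -> k != 0) ->
      \sum_(k <- A) enorm (map_mx (intr : int -> R) k) ^+ (n + p) *
        expR (- (t * enorm (map_mx intr k))) <= K / t ^+ (n + p + n)) ->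
    sum_bounded (sol_weight rho delta omega (pcoef g) p)
      (K * 2 ^+ (n + p + n) / (gamma * delta ^+ (n + p + n)) * S).
  move=> KK HK; apply: (sol_weight_total (T := fun i => (s i)%:R ^+ n.*2.+1 * H i) (lay := lay)) => //.
    move=> i A uA Ai; apply: (sol_weight_layer gamma0 delta0 dioph HK) => // q qA.
    by rewrite -(Ai q qA); exact: Hlay.
  apply: divr_ge0; first by rewrite mulr_ge0 ?exprn_ge0.
  by rewrite mulr_ge0 ?(ltW gamma0) // exprn_ge0 // ltW.
pose a := sol_coef omega (pcoef g).
have e0 : (n + 0 + n = n.*2)%N by rewrite addn0 addnn.
have e1 : (n + 1 + n = n.*2.+1)%N by rewrite addn1 addSn addnn.
pose B0 := k0 / (gamma * delta ^+ n.*2) * S; pose B1 := k1 / (gamma * delta ^+ n.*2.+1) * S.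
have aB0 : sum_bounded (fun q => cabs (a q) * expR ((rho - delta) * qnorm R q)) B0.
  move=> A uA; have := total 0%N K0 K00 HK0 A uA; rewrite -/k0 e0 -/B0; apply: le_trans.
  by apply: ler_sum => q _; rewrite /sol_weight expr0 mulr1.
have aB1 : sum_bounded (fun q => cabs (a q) * qnorm R q * expR ((rho - delta) * qnorm R q)) B1.
  move=> A uA; have := total 1%N K1 K10 HK1 A uA; rewrite -/k1 e1 -/B1; apply: le_trans.
  by apply: ler_sum => q _; rewrite /sol_weight expr1.
(* For q = 0 both sides vanish, the left one by the convention on the inverse of 0 and the right one
   by g_0 = 0. *)
have cE q : a q * ((0 +i* 1) * (rdot q omega)%:C) = pcoef g q.
  have [->|q0] := eqVneq q 0; first by rewrite /a /sol_coef g0 !mul0r.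
  rewrite /a /sol_coef divfK // mulf_neq0 //; last by rewrite fmorph_eq0 (rdot_neq0 gamma0 dioph).
  by apply/eqP => /(congr1 (@complex.Im R)) /= /eqP; rewrite oner_eq0.
(* Since |g_q| = |omega.q| |a_q| <= |omega| |q| |a_q|, the bound obtained for Df also gives absolute
   convergence of the Pontryagin series of g. *)
have cB : sum_bounded (fun q => cabs (pcoef g q) * expR ((rho - delta) * qnorm R q)) (enorm omega * B1).
  move=> A uA; apply: le_trans (ler_wpM2l (enorm_ge0 omega) (aB1 A uA)).
  rewrite mulr_sumr; apply: ler_sum => q _.
  rewrite mulrA ler_wpM2r ?expR_ge0 // -cE cabsM [cabs (_ * _%:C)]cabsM cabs_i mul1r cabs_real.
  by rewrite mulrCA ler_wpM2l ?cabs_ge0 // mulrC rdot_le_qnorm.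
have B_le (c c' : R) (m : nat) : 0 <= c' -> ((c / (gamma * delta ^+ m) * S)%:E <=
    ((c + c') / (gamma * delta ^+ m))%:E * snormS rho s g)%E.
  move=> c'0; rewrite SE -EFinM lee_fin ler_wpM2r // ler_wpM2r ?lerDl //.
  by rewrite invr_ge0 mulr_ge0 ?(ltW gamma0) // exprn_ge0 // ltW.
exists (char_series id a); split.
- exact: (series_CQ aB0 aB1).
- move=> z sz; rewrite (series_diffE aB0 aB1) //.
  have -> : dterm a (map_mx (real_complex R) omega) z = (fun q => pcoef g q * qexp q z).
    apply/funext => q; rewrite /dterm -cE; congr (_ * (_ * _) * _).
    rewrite cpt_real qdot_cpt; congr (_ +i* _).
    by rewrite /rdot big1 // => j _; rewrite mxE mulr0.
  by apply: (pontryagin_series_eq gCQ _ cB) => //; lra.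
- exact: le_trans (series_snorm aB0) (B_le _ _ _ k10).
- apply: le_trans (_ : (B1%:E <= _)%E); last first.
    by rewrite [k0 + k1]addrC; exact: B_le.
  apply: ge_ereal_sup => _ [z sz <-]; rewrite lee_fin.
  have -> : covec (char_series id a) z = dcoef a z; last exact: (cenorm_dcoef aB1).
  apply/rowP => j; rewrite !mxE.
  exact: (series_diffE aB0 aB1).
Qed.
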